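(* \[ \mu_2(1+x+y+z) = \frac{12}{\pi^2}\,\lambda_4\!\left(\tfrac12\right) - \frac{\pi^2}{5}. \]
   Context: For a Laurent polynomial $P$ in $n$ variables, the higher Mahler measure is $\mu_k(P) := \int_0^1\cdots\int_0^1 \log^k\left|P\left(e^{2\pi i t_1},\ldots,e^{2\pi i t_n}\right)\right|\mathrm{d}t_1\cdots\mathrm{d}t_n$; here $k=2$ and $P=1+x+y+z$ in three variables. For $n\ge2$, $\lambda_n(x) := (n-2)!\sum_{k=0}^{n-2}\frac{(-1)^k}{k!}\mathrm{Li}_{n-k}(x)\log^k|x| + \frac{(-1)^n}{n}\log^n|x|$, where $\mathrm{Li}_m(x)=\sum_{j\ge1}x^j/j^m$ is the polylogarithm. *)

(* Defs.v *)
From mathcomp Require Import all_boot all_order all_algebra.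
From mathcomp Require Import all_classical all_reals all_analysis.
Set Implicit Arguments. Unset Strict Implicit. Unset Printing Implicit Defensive.
Import Order.TTheory GRing.Theory Num.Theory.
Local Open Scope classical_set_scope.
Local Open Scope ring_scope.

Definition Li (R : realType) (m : nat) (x : R) : R :=
  limn (fun n => \sum_(1 <= j < n) (x ^+ j / (j%:R ^+ m))).

Definition lambda (R : realType) (n : nat) (x : R) : R :=
  (n - 2)`!%:R * (\sum_(0 <= k < n.-1)
      ((-1) ^+ k / k`!%:R * Li (n - k) x * (ln `|x|) ^+ k))
  + (-1) ^+ n / n%:R * (ln `|x|) ^+ n.

(* |P(e^{2 pi i t1}, e^{2 pi i t2}, e^{2 pi i t3})| for P = 1 + x + y + z,
   written via real and imaginary parts *)
Definition absP (R : realType) (t1 t2 t3 : R) : R :=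
  Num.sqrt ((1 + cos (2 * pi * t1) + cos (2 * pi * t2) + cos (2 * pi * t3)) ^+ 2
          + (sin (2 * pi * t1) + sin (2 * pi * t2) + sin (2 * pi * t3)) ^+ 2).

(* mu_k(1+x+y+z) for even k as the (nonnegative) Lebesgue integral over [0,1]^3,
   written as an iterated integral (equal to the product-measure integral by Tonelli) *)
Definition mu_1xyz (R : realType) (k : nat) : \bar R :=
  (\int[lebesgue_measure]_(t1 in `[0%R, 1%R])
     \int[lebesgue_measure]_(t2 in `[0%R, 1%R])
       \int[lebesgue_measure]_(t3 in `[0%R, 1%R])
          ((ln (absP t1 t2 t3)) ^+ k)%:E)%E.

(* Main.v *)
(** Put [F a b := ln^2 max(a,b) + Li_2 ((min(a,b)/max(a,b))^2) / 2]. For fixed [t1], the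
    translation [t3 = t2 + s] makes [|1 + x + y + z|] the norm of
    [2 cos(pi t1) + 2 cos(pi s) e^(i theta)] with [theta = 2 pi t2 + pi s - pi t1], so that
    Parseval for [log |1 - r e^(i theta)| = - sum_n r^n cos(n theta) / n] turns the integral
    over [t2] into [F (2 |cos(pi t1)|) (2 |cos(pi s)|)]. Folding both remaining variables onto
    [[0, pi/2]] and using the symmetry of [F], the integral becomes [8 / pi^2 * (I + J / 2)] with
    [I = int_0^(pi/2) t ln^2(2 sin t) dt],
    [J = sum_n n^-2 int_0^(pi/2) (int_0^t sin^(2n)) / sin^(2n) t dt].
    - The inner integrals of [J] satisfy a two-term recurrence and equal
      [(1 + 1/3 + ... + 1/(2n-1)) / (2n)], so [J] is a combination of Euler sums.
    - [I] comes from the real part [log^2 - arg^2] of [log^2 (1 - r e^(2it))], integrated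
      against [t] and passed to the limit [r -> 1]. The same Abel limit of the imaginary part
      of the logarithm gives [zeta(2)] and [zeta(4)].
    - With [A = sum_n (-1)^n H_(n-1) / n^3], both reduce to [A], [zeta(2)^2] and [zeta(4)], since
      [sum_n H_n / n^3 = zeta(2)^2 / 2]. Finally
      [lambda_4 (1/2) = zeta(4) - sum_n (-1)^n / n^4 + A], because an explicit modification of
      [lambda_4 (1/(1+x)) + lambda_4 (x/(1+x))] has zero derivative on [(0, 1)], and its limits
      at both ends can be computed. *)
Require Import Defs.
From mathcomp Require Import all_boot all_order all_algebra.
From mathcomp Require Import all_classical all_reals all_analysis.
From mathcomp Require Import measurable_realfun ring lra.
Import Order.TTheory GRing.Theory Num.Theory.
Import numFieldNormedType.Exports.
Set Implicit Arguments. Unset Strict Implicit. Unset Printing Implicit Defensive.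
Local Open Scope classical_set_scope.
Local Open Scope ring_scope.

(** * Dominated series and power series on the open unit disc *)

Section Series.
Context {R : realType}.
Implicit Types (c u v M : nat -> R) (x : R).

(** The obstacle is the boundary of the disc: at radius 1 the Fourier series of log and arg converge
    only conditionally, and log is unbounded. So they are used only at radius below 1. The radius
    then tends to 1 along a sequence, controlled by a uniform bound on the weighted integrand on one
    side and by absolute convergence of the integrated coefficients on the other. The weight [t] in
    [I], which is the length of the slice [s < t] after symmetrisation, is what makes such a bound
    possible: it absorbs the singularity at [t = 0]. Complex numbers are replaced by pairs of real
    functions. On the measure side everything is nonnegative, so that exchanges of integrals and
    sums take place in the extended reals, before any finiteness is known. The constant 12 arises as
    follows: [A] has weight 1/2 in [I] and weight 1 in [J / 2], and 8 times 3/2 is 12. All the other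
    contributions are rational multiples of pi^4. *)

Lemma limn_series_tail_le u M N : cvgn (series M) -> (forall k, `|u k| <= M k) ->
  `|limn (series u) - series u N| <= limn (series M) - series M N.
Proof.
move=> cM uM.
have cu : cvgn (series u).
  apply: normed_cvg; apply: (series_le_cvg _ _ _ cM) => //= n.
  exact: le_trans (uM n).
have cuN : (fun n => `|series u n - series u N|) @ \oo --> `|limn (series u) - series u N|.
  by apply: cvg_norm; apply: cvgB => //; exact: cvg_cst.
have cMN : (fun n => series M n - series M N) @ \oo --> limn (series M) - series M N.
  by apply: cvgB => //; exact: cvg_cst.
apply: ler_cvg_to cuN cMN _.
near=> n.
have Nn : (N <= n)%N by near: n; exact: nbhs_infty_ge.
rewrite !sub_series_geq//; apply: le_trans (ler_norm_sum _ _ _) _.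
by apply: ler_sum => i _; exact: uM.
Unshelve. all: by end_near. Qed.

Lemma is_cvg_series_dom u M : cvgn (series M) -> (forall k, `|u k| <= M k) ->
  cvgn (series u).
Proof.
move=> cM uM; apply: normed_cvg; apply: (series_le_cvg _ _ _ cM) => //= n.
exact: le_trans (uM n).
Qed.

(** Dominated convergence for series: beyond a fixed [N] the tails are bounded by that of [M] for
    all [n] at once, and the finite sum up to [N] converges termwise; hence the three thirds of
    [e]. *)
Lemma tannery (w : nat -> nat -> R) (W M : nat -> R) :
  cvgn (series M) -> (forall n k, `|w n k| <= M k) ->
  (forall k, w n k @[n --> \oo] --> W k) ->
  limn (series (w n)) @[n --> \oo] --> limn (series W).
Proof.
move=> cM wM wW.
have WM k : `|W k| <= M k.
  have h : `|w n k| @[n --> \oo] --> `|W k| by apply: cvg_norm; exact: wW.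
  apply: (cvgr_to_le h).
  by near=> n; exact: wM.
have T0 : (fun N => limn (series M) - series M N) @ \oo --> 0.
  by rewrite -[X in _ --> X](subrr (limn (series M))); apply: cvgB => //; exact: cvg_cst.
apply/cvgrPdist_lt => e e0.
have e3 : 0 < e / 3 by rewrite divr_gt0.
have [N _ /(_ N (leqnn N)) hN] : \forall N \near \oo, `|limn (series M) - series M N| < e / 3.
  by move/cvgr0Pnorm_lt : T0; apply.
have fin : series (w n) N @[n --> \oo] --> series W N.
  rewrite /series /=; apply: cvg_big => [|i _]; last exact: wW.
  exact: add_continuous.
near=> n.
have h1 := limn_series_tail_le N cM WM.
have h2 := limn_series_tail_le N cM (wM n).
have h3 : `|series W N - series (w n) N| < e / 3.
  by near: n; move/cvgrPdist_lt : fin; apply.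
have h4 := ler_norm (limn (series M) - series M N).
rewrite distrC in h2.
have -> : limn (series W) - limn (series (w n)) =
  (limn (series W) - series W N) + (series W N - series (w n) N) +
  (series (w n) N - limn (series (w n))) by ring.
apply: le_lt_trans (ler_normD _ _) _.
have := ler_normD (limn (series W) - series W N) (series W N - series (w n) N).
lra.
Unshelve. all: by end_near. Qed.

Lemma is_cvg_series_deriv_geometric (q : R) : 0 <= q < 1 ->
  cvgn (series (fun n => n.+1%:R * q ^+ n)).
Proof.
move=> /andP[q0 q1].
(* Closed form of the partial sums; after multiplication by (1 - q)^2 they stay below 1. *)
have E n : series (fun n => n.+1%:R * q ^+ n) n * (1 - q) ^+ 2 =
    1 - n.+1%:R * q ^+ n + n%:R * q ^+ n.+1.
  elim: n => [|n IH]; first by rewrite /series /= big_geq// expr0; ring.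
  rewrite seriesSr mulrDl IH -!natr1 !exprS; ring.
have q2 : 0 < (1 - q) ^+ 2 by rewrite exprn_gt0// subr_gt0.
apply: nondecreasing_is_cvgn.
  apply/nondecreasing_seqP => n; rewrite seriesSr lerDl.
  by rewrite mulr_ge0// exprn_ge0.
exists ((1 - q) ^- 2) => _ [n _ <-].
rewrite -[leRHS]mul1r ler_pdivlMr// E.
have : 0 <= q ^+ n by rewrite exprn_ge0.
have : 0 <= n%:R :> R by [].
have : q ^+ n.+1 <= q ^+ n by rewrite exprS; apply: ler_piMl; [exact: exprn_ge0|exact: ltW].
rewrite -natr1 => h1 h2 h3; have := ler_wpM2l h2 h1; lra.
Qed.

Definition psum c x : R := limn (pseries c x).

(** Convergence on the whole open disc, unlike convergence at one point, is stable under
    [pseries_diffs], so termwise differentiation can be iterated. *)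
Definition cvg_unit_disc c := forall z : R, `|z| < 1 -> cvgn (pseries c z).

Lemma cvg_unit_disc_diffs c : cvg_unit_disc c -> cvg_unit_disc (pseries_diffs c).
Proof.
move=> cc z z1.
(* Midpoint between |z| and 1: the terms are bounded at [w], and the factor n + 1 created by
   differentiation is absorbed by the ratio |z| / w < 1. *)
pose w : R := (1 + `|z|) / 2.
have w0 : 0 < w by rewrite divr_gt0// ltr_wpDr.
have zw : `|z| < w by rewrite /w ltr_pdivlMr//; lra.
have w1 : `|w| < 1 by rewrite ger0_norm 1?ltW// /w ltr_pdivrMr//; lra.
have [K [Kreal Kf]] := cvg_series_bounded (cc _ w1).

pose B := `|K + 1|.
have KB n : `|c n * w ^+ n| <= B.
  by apply: le_trans (ler_norm _); apply: Kf => //; rewrite ltrDl.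
pose q := `|z| / w.
have q0 : 0 <= q by rewrite divr_ge0// ltW.
have q1 : q < 1 by rewrite ltr_pdivrMr// mul1r.
have qq : 0 <= q < 1 by rewrite q0.
have cM : cvgn (series (fun n => (B / w) * (n.+1%:R * q ^+ n))).
  have := is_cvg_series_deriv_geometric qq => h.
  have -> : series (fun n => (B / w) * (n.+1%:R * q ^+ n)) =
    (fun n => (B / w) * series (fun n => n.+1%:R * q ^+ n) n).
    by apply/funext => n; rewrite /series/= mulr_sumr.
  exact: is_cvgMr.
apply: (is_cvg_series_dom cM) => n.
rewrite /pseries_diffs !normrM normrX /q expr_div_n.
rewrite (ger0_norm (ler0n _ _)) -mulrA.
have := KB n.+1; rewrite normrM normrX (ger0_norm (ltW w0)) => h.
have wn : 0 < w ^+ n.+1 by rewrite exprn_gt0.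
have -> : B / w * (n.+1%:R * (`|z| ^+ n / w ^+ n)) =
  n.+1%:R * (B / w ^+ n.+1 * `|z| ^+ n).
  by rewrite exprS; field; rewrite !gt_eqF//= exprn_gt0.
rewrite ler_wpM2l// ler_wpM2r ?exprn_ge0//.
by rewrite ler_pdivlMr.
Qed.

Lemma is_derive_psum c x : cvg_unit_disc c -> `|x| < 1 ->
  is_derive x 1 (psum c) (psum (pseries_diffs c) x).
Proof.
move=> cc x1.
have cd := cvg_unit_disc_diffs cc.
have cdd := cvg_unit_disc_diffs cd.
pose w : R := (1 + `|x|) / 2.
have w0 : 0 < w by rewrite divr_gt0// ltr_wpDr.
have w1 : `|w| < 1 by rewrite ger0_norm 1?ltW// /w ltr_pdivrMr//; lra.
have xw : `|x| < `|w| by rewrite (ger0_norm (ltW w0)) /w ltr_pdivlMr//; lra.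
exact: (pseries_snd_diffs (cc _ w1) (cd _ w1) (cdd _ w1) xw).
Qed.

Lemma cvg_unit_disc_bounded c B : (forall n, `|c n| <= B) -> cvg_unit_disc c.
Proof.
move=> cB z z1.
apply: (@is_cvg_series_dom _ (geometric B `|z|)).
  by apply: is_cvg_geometric_series; rewrite normr_id.
by move=> n; rewrite normrM normrX /= ler_wpM2r// exprn_ge0.
Qed.

(** Abel's limit theorem in the absolutely convergent case, where it is an instance of [tannery]. *)
Lemma psum_abel c (u : nat -> R) : cvgn (series (fun n => `|c n|)) ->
  (forall n, `|u n| <= 1) -> u @ \oo --> (1 : R) ->
  (fun n => psum c (u n)) @ \oo --> limn (series c).
Proof.
move=> cc u1 cu; apply: (tannery cc) => [n k|k].
  by rewrite normrM normrX ler_piMr// exprn_ile1.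
rewrite -[X in _ --> X]mulr1; apply: cvgMr => //.
rewrite -(expr1n _ k).
apply: (@continuous_cvg _ _ _ _ _ _ (fun x : R => x ^+ k)) => //.
exact: exprn_continuous.
Qed.

End Series.

(** * Calculus of derivatives and functions with equal derivatives *)

Section Derivatives.
Context {R : realType}.
Implicit Types (f g : R -> R) (x a b df dg : R).

Lemma is_derive_to f x df dg : is_derive x 1 f df -> df = dg -> is_derive x 1 f dg.
Proof. by move=> h <-. Qed.

Lemma is_derive_add f g x df dg : is_derive x 1 f df -> is_derive x 1 g dg ->
  is_derive x 1 (fun y => f y + g y) (df + dg).
Proof. by move=> hf hg; apply: is_deriveD. Qed.

Lemma is_derive_sub f g x df dg : is_derive x 1 f df -> is_derive x 1 g dg ->
  is_derive x 1 (fun y => f y - g y) (df - dg).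
Proof. by move=> hf hg; apply: is_deriveB. Qed.

Lemma is_derive_opp f x df : is_derive x 1 f df ->
  is_derive x 1 (fun y => - f y) (- df).
Proof. by move=> hf; apply: is_deriveN. Qed.

Lemma is_derive_mul f g x df dg : is_derive x 1 f df -> is_derive x 1 g dg ->
  is_derive x 1 (fun y => f y * g y) (df * g x + f x * dg).
Proof.
move=> hf hg; rewrite (_ : (fun y => f y * g y) = f * g)//.
apply: is_derive_eq.
by rewrite /GRing.scale/= addrC mulrC [X in _ + X]mulrC; ring.
Qed.

Lemma is_derive_exprn f n x df : is_derive x 1 f df ->
  is_derive x 1 (fun y => f y ^+ n) (n%:R * f x ^+ n.-1 * df).
Proof.
move=> hf.
elim: n => [|n IH].
  have -> : (fun y => f y ^+ 0) = cst 1 by [].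
  by rewrite !mul0r; exact: is_derive_cst.
have -> : (fun y => f y ^+ n.+1) = (fun y => f y * f y ^+ n).
  by apply/funext => y; rewrite exprS.
apply: is_derive_to (is_derive_mul hf IH) _.
case: n {IH} => [|n] /=; first by rewrite expr0; ring.
by rewrite exprS -!natr1; ring.
Qed.

Lemma is_derive_inv f x df : f x != 0 -> is_derive x 1 f df ->
  is_derive x 1 (fun y => (f y)^-1) (- df / f x ^+ 2).
Proof.
move=> fx hf; have h := is_deriveV fx hf.
apply: is_derive_to h _.
by rewrite /GRing.scale/=; field.
Qed.

Lemma is_derive_compose f g x df dg : is_derive (g x) 1 f df ->
  is_derive x 1 g dg -> is_derive x 1 (fun y => f (g y)) (df * dg).
Proof.
move=> hf hg; have := @is_derive1_comp _ f g x df dg hf hg.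
exact.
Qed.

Lemma is_derive_lnc f x df : 0 < f x -> is_derive x 1 f df ->
  is_derive x 1 (fun y => ln (f y)) ((f x)^-1 * df).
Proof.
move=> fx hf; exact: is_derive_compose (is_derive1_ln fx) hf.
Qed.

Lemma is_derive_var x : is_derive x 1 (fun y : R => y) 1.
Proof. exact: is_derive_id. Qed.

Lemma is_derive_const (c : R) x : is_derive x 1 (fun _ : R => c) 0.
Proof. exact: is_derive_cst. Qed.

Lemma is_derive_continuous f x df : is_derive x 1 f df -> {for x, continuous f}.
Proof.
move=> hf; apply: differentiable_continuous; apply/derivable1_diffP.
exact: (@ex_derive _ _ _ _ _ _ _ hf).
Qed.

(** The mean value theorem makes [f - g] constant. Power series are matched with closed forms in
    this way, by derivatives and the value at 0; with [g] zero it gives constancy of [f]. *)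
Lemma eq_derive_itv f g (df : R -> R) a b :
  (forall x, a < x < b -> is_derive x 1 f (df x)) ->
  (forall x, a < x < b -> is_derive x 1 g (df x)) ->
  forall x y, a < x < b -> a < y < b -> f x - g x = f y - g y.
Proof.
move=> hf hg.
suff H x y : a < x < b -> a < y < b -> x <= y -> f x - g x = f y - g y.
  move=> x y xab yab; have [xy|/ltW xy] := leP x y; first exact: H.
  by apply/esym/H.
move=> /andP[ax xb] /andP[ay yb] xy.
have D z : z \in `[x, y] -> is_derive z 1 (fun z => f z - g z) 0.
  rewrite in_itv/= => /andP[xz zy].
  have zab : a < z < b by rewrite (lt_le_trans ax xz) (le_lt_trans zy yb).
  by apply: is_derive_to (is_derive_sub (hf _ zab) (hg _ zab)) _; rewrite subrr.
have C : {within `[x, y], continuous (fun z => f z - g z)}.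
  apply: continuous_in_subspaceT => z; rewrite inE/= => zxy.
  exact: is_derive_continuous (D z zxy).
have D' z : z \in `]x, y[ -> is_derive z 1 (fun z => f z - g z) ((fun=> 0) z).
  by move=> zxy; apply: D; exact: subset_itv_oo_cc.
have [c _] := MVT_segment xy D' C.
by rewrite mul0r => /eqP; rewrite subr_eq0 => /eqP.
Qed.

End Derivatives.

(* [is_derive] is a class: plain [apply] would start an instance search on each premise. *)
Ltac derive_step := lazymatch goal with
  | |- is_derive _ _ (fun y => y) _ => notypeclasses refine (is_derive_var _)
  | |- is_derive _ _ (fun y => GRing.add _ (GRing.opp _)) _ =>
      notypeclasses refine (is_derive_sub _ _)
  | |- is_derive _ _ (fun y => GRing.add _ _) _ => notypeclasses refine (is_derive_add _ _)
  | |- is_derive _ _ (fun y => GRing.opp _) _ => notypeclasses refine (is_derive_opp _)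
  | |- is_derive _ _ (fun y => GRing.mul _ _) _ => notypeclasses refine (is_derive_mul _ _)
  | |- is_derive _ _ (fun y => GRing.inv _) _ =>
      first [notypeclasses refine (is_derive_const _ _) | notypeclasses refine (is_derive_inv _ _)]
  | |- is_derive _ _ (fun y => GRing.exp _ _) _ => notypeclasses refine (is_derive_exprn _ _)
  | |- is_derive _ _ (fun y => ln _) _ => notypeclasses refine (is_derive_lnc _ _)
  | |- is_derive ?x ?v (GRing.add ?a) ?d => change (is_derive x v (fun y => a + y) d)
  | |- is_derive ?x ?v (GRing.mul ?a) ?d => change (is_derive x v (fun y => a * y) d)
  | |- is_derive ?x ?v (@GRing.opp ?V) ?d =>
      change (is_derive x v (fun y => @GRing.opp V y) d)
  | |- is_derive _ _ (@ln _) _ => notypeclasses refine (is_derive1_ln _)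
  | H : is_derive ?x ?v ?f ?d |- is_derive ?x ?v ?f _ => exact: H
  | H : is_derive ?x ?v ?f ?d |- is_derive ?x ?v (fun y => ?f y) _ => exact: H
  | |- is_derive _ _ _ _ => notypeclasses refine (is_derive_const _ _)
  | |- is_true _ => assumption
  end.

Ltac derive_to := notypeclasses refine (is_derive_to _ _).

(** * Coefficients 1/n^m and H_(n-1)/n^m and their generating functions *)

Section PowerSums.
Context {R : realType}.
Implicit Types (c : nat -> R) (x y : R) (m n : nat).

(** For m > 0 the value at n = 0 is 0, because the inverse of 0 is 0: series indexed from 0 agree
    with the usual ones indexed from 1. *)
Definition ipow m : nat -> R := fun n => (n%:R ^+ m)^-1.

(** [series harmonic n] is H_n, so the numerator is H_(n-1). With this shift [hpow 1] lists the
    coefficients of [ln (1 - y) ^+ 2 / 2]. *)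
Definition hpow m : nat -> R := fun n => series harmonic n.-1 * ipow m n.

Lemma ipow0 m : ipow m.+1 0 = 0.
Proof. by rewrite /ipow expr0n invr0. Qed.

Lemma ipow_ge0 m n : 0 <= ipow m n.
Proof. by rewrite invr_ge0 exprn_ge0. Qed.

Lemma ipow_le1 m n : ipow m.+1 n <= 1.
Proof.
case: n => [|n]; first by rewrite ipow0.
by rewrite invf_le1 ?exprn_gt0// exprn_ege1// ler1n.
Qed.

Lemma mul_ipow m n : n%:R * ipow m.+2 n = ipow m.+1 n.
Proof.
case: n => [|n]; first by rewrite !ipow0 mulr0.
by rewrite /ipow [in LHS]exprS invfM mulrA mulfV ?pnatr_eq0// mul1r.
Qed.

Lemma mul_hpow m n : n%:R * hpow m.+2 n = hpow m.+1 n.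
Proof. by rewrite /hpow mulrCA mul_ipow. Qed.

Lemma harmonic_sum_ge0 n : 0 <= series harmonic n :> R.
Proof. by apply: sumr_ge0 => i _; exact: harmonic_ge0. Qed.

Lemma harmonic_sumS n : series harmonic n.+1 = series harmonic n + n.+1%:R^-1 :> R.
Proof. by rewrite seriesSr. Qed.

Lemma harmonic_sum_le n : series harmonic n <= n%:R :> R.
Proof.
elim: n => [|n IH]; first by rewrite /series /= big_geq.
by rewrite harmonic_sumS -[leRHS]natr1 lerD// invf_le1 ?ltr0n// ler1n.
Qed.

Lemma hpow_ge0 m n : 0 <= hpow m n.
Proof. by rewrite mulr_ge0 ?ipow_ge0// harmonic_sum_ge0. Qed.

Lemma hpow_le m n : hpow m.+1 n <= ipow m n.
Proof.
case: n => [|n]; first by rewrite /hpow ipow0 mulr0 ipow_ge0.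
rewrite /hpow/= /ipow exprS invfM mulrA ler_piMl ?invr_ge0 ?exprn_ge0//.
rewrite ler_pdivrMr ?ltr0n// mul1r.
by apply: le_trans (harmonic_sum_le _) _; rewrite ler_nat.
Qed.

Lemma hpow_le1 m n : hpow m.+1 n <= 1.
Proof.
apply: le_trans (hpow_le _ _) _; case: m => [|m]; last exact: ipow_le1.
by rewrite /ipow expr0 invr1.
Qed.

Lemma cvg_disc_ipow m : cvg_unit_disc (ipow m.+1).
Proof.
by apply: (@cvg_unit_disc_bounded _ _ 1) => n; rewrite ger0_norm ?ipow_ge0 ?ipow_le1.
Qed.

Lemma cvg_disc_hpow m : cvg_unit_disc (hpow m.+1).
Proof.
by apply: (@cvg_unit_disc_bounded _ _ 1) => n; rewrite ger0_norm ?hpow_ge0 ?hpow_le1.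
Qed.

Lemma psum0 c : psum c 0 = c 0%N.
Proof.
apply/cvg_lim => //; rewrite -cvg_shiftS /=.
rewrite (_ : (fun _ => _) = fun _ => c 0%N); first exact: cvg_cst.
apply/funext => n; rewrite /pseries /series /= big_nat_recl//= expr0 mulr1.
by rewrite big1 ?addr0// => i _; rewrite exprS mul0r mulr0.
Qed.

Lemma mul_psum_diffs c y : cvg_unit_disc c -> `|y| < 1 ->
  y * psum (pseries_diffs c) y = psum (fun n => n%:R * c n) y.
Proof.
move=> cc y1; apply/esym/cvg_lim => //.
rewrite (_ : pseries _ y = fun n => y * series (fun i => i%:R * c i * y ^+ i.-1) n).
  by apply: cvgMr; exact: (pseries_diffs_equiv (cvg_unit_disc_diffs cc y1)).
apply/funext => n; rewrite /series /pseries /= /series/= mulr_sumr.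
apply: eq_bigr => -[|i] _ /=; first by rewrite !mul0r mulr0.
by rewrite exprS; ring.
Qed.

(** The operator y d/dy multiplies the n-th coefficient by n, which lowers the exponent by one. *)
Lemma is_derive_ipow m y : y != 0 -> `|y| < 1 ->
  is_derive y 1 (psum (ipow m.+2)) (psum (ipow m.+1) y / y).
Proof.
move=> y0 y1; apply: is_derive_to (is_derive_psum (@cvg_disc_ipow m.+1) y1) _.
apply: (mulfI y0); rewrite mul_psum_diffs//; last exact: cvg_disc_ipow.
by rewrite mulrCA mulfV// mulr1; congr psum; apply/funext => n; rewrite mul_ipow.
Qed.

Lemma is_derive_hpow m y : y != 0 -> `|y| < 1 ->
  is_derive y 1 (psum (hpow m.+2)) (psum (hpow m.+1) y / y).
Proof.
move=> y0 y1; apply: is_derive_to (is_derive_psum (@cvg_disc_hpow m.+1) y1) _.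
apply: (mulfI y0); rewrite mul_psum_diffs//; last exact: cvg_disc_hpow.
by rewrite mulrCA mulfV// mulr1; congr psum; apply/funext => n; rewrite mul_hpow.
Qed.

Lemma psum_ipow1 y : `|y| < 1 -> psum (ipow 1) y = - ln (1 - y).
Proof.
move=> y1; have y1' : -1 < y < 1 by rewrite -ltr_norml.
have : psum (ipow 1) y - (- ln (1 - y)) = psum (ipow 1) 0 - (- ln (1 - 0)).
  apply: (@eq_derive_itv _ _ (fun y => - ln (1 - y)) (fun x => (1 - x)^-1) (-1) 1) => //.
  - move=> x x1; have x1' : `|x| < 1 by rewrite ltr_norml.
    apply: is_derive_to (is_derive_psum (@cvg_disc_ipow 0) x1') _.
    rewrite (_ : pseries_diffs _ = fun=> 1); last first.
      by apply/funext => n; rewrite /pseries_diffs /ipow expr1 mulfV ?pnatr_eq0.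
    by apply/cvg_lim => //; rewrite -[X in _ --> X]mul1r; exact: cvg_geometric_series.
  - move=> x /andP[x1 x2]; have x0 : 0 < 1 - x by lra.
    derive_to.
      by do !derive_step.
    by rewrite /=; field; lra.
  - by rewrite ltrN10 ltr01.
by rewrite psum0 ipow0 subr0 ln1 oppr0 subr0 => /eqP; rewrite subr_eq0 => /eqP.
Qed.

Lemma diffs_hpow1 : pseries_diffs (hpow 1) = series harmonic.
Proof.
apply/funext => n; rewrite /pseries_diffs /hpow /ipow /= expr1 mulrCA.
by rewrite mulfV ?mulr1// pnatr_eq0.
Qed.

Lemma mul_psum_harmonic y : `|y| < 1 ->
  (1 - y) * psum (series harmonic) y = psum (ipow 1) y.
Proof.
move=> y1.
have cd : cvgn (pseries (series harmonic) y).
  by rewrite -diffs_hpow1; apply: cvg_unit_disc_diffs y1; exact: cvg_disc_hpow.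
apply/esym/cvg_lim => //.
(* Summation by parts at finite order, from H_n - H_(n-1) = 1/n. The boundary term tends to 0, being
   [y] times the general term of a convergent series. *)
have E n : pseries (ipow 1) y n =
    (1 - y) * pseries (series harmonic) y n + y * (series harmonic n.-1 * y ^+ n.-1).
  elim: n => [|n IH].
    by rewrite /pseries /series /= !big_geq// mulr0 mul0r mulr0 addr0.
  rewrite /pseries /= !seriesSr [series _ n]IH /=.
  case: n {IH} => [|n]; first by rewrite ipow0 /pseries /series /= !big_geq//; ring.
  by rewrite /= harmonic_sumS /ipow expr1 exprS /pseries; ring.
rewrite (funext E).
rewrite -[X in _ --> X]addr0; apply: cvgD; first exact: cvgMr.
rewrite -[X in _ --> X](mulr0 y); apply: cvgMr.
rewrite -cvg_shiftS /=; exact: (cvg_series_cvg_0 cd).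
Qed.

Lemma psum_hpow1 y : `|y| < 1 -> psum (hpow 1) y = ln (1 - y) ^+ 2 / 2.
Proof.
move=> y1; have y1' : -1 < y < 1 by rewrite -ltr_norml.
have : psum (hpow 1) y - ln (1 - y) ^+ 2 / 2 = psum (hpow 1) 0 - ln (1 - 0) ^+ 2 / 2.
  apply: (@eq_derive_itv _ _ (fun y => ln (1 - y) ^+ 2 / 2)
    (fun x => - ln (1 - x) / (1 - x)) (-1) 1) => //.
  - move=> x x1; have x1' : `|x| < 1 by rewrite ltr_norml.
    have x0 : 0 < 1 - x by lra.
    apply: is_derive_to (is_derive_psum (@cvg_disc_hpow 0) x1') _.
    rewrite diffs_hpow1 -psum_ipow1// -mul_psum_harmonic//; field; lra.
  - move=> x /andP[x1 x2]; have x0 : 0 < 1 - x by lra.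
    derive_to; first by do !derive_step.
    by rewrite /=; field; lra.
  - by rewrite ltrN10 ltr01.
rewrite psum0 subr0 ln1 expr0n mul0r subr0 /hpow ipow0 mulr0.
by move=> /eqP; rewrite subr_eq0 => /eqP.
Qed.

Lemma Li_psum m x : Li m.+1 x = psum (ipow m.+1) x.
Proof.
rewrite /Li /psum; congr (limn _); apply/funext => -[|n].
  by rewrite /pseries /series /= !big_geq.
rewrite /pseries /series /= [in RHS]big_ltn// ipow0 mul0r add0r.
by apply: eq_bigr => i _; rewrite mulrC.
Qed.

End PowerSums.

(** * The function lambda_4 and an invariant combination of its values *)

Section Lambda4.
Context {R : realType}.
Implicit Types (c : nat -> R) (x y : R) (m n : nat).

Notation L m := (psum (ipow m)).

Definition alt c : nat -> R := fun n => (-1) ^+ n * c n.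

Lemma psumN c x : psum c (- x) = psum (alt c) x.
Proof.
rewrite /psum /alt; congr (limn (series _)); apply/funext => n.
by rewrite /= [in LHS]exprNn mulrCA mulrA.
Qed.

Definition lam4 y : R :=
  2 * L 4 y - 2 * (ln y * L 3 y) + ln y ^+ 2 * L 2 y + ln y ^+ 4 / 4.

Lemma lambda4E y : 0 < y -> lambda 4 y = lam4 y.
Proof.
move=> y0; rewrite /lambda /lam4 /= big_nat_recr// big_nat_recr// big_nat1 /=.
rewrite !Li_psum gtr0_norm// /= !factS fact0 !muln1 /=.
by rewrite !expr0 !expr1; field.
Qed.

(** The weights in lambda_4 make the polylogarithms of order 2 and 3 telescope away in the
    derivative; only [L 1], which is [- ln (1 - y)], survives. *)
Lemma is_derive_lam4 y : 0 < y < 1 ->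
  is_derive y 1 lam4 (ln y ^+ 2 * (ln y - ln (1 - y)) / y).
Proof.
move=> /andP[y0 y1].
have yN0 : y != 0 by rewrite gt_eqF.
have ny : `|y| < 1 by rewrite ger0_norm// ltW.
have d4 := is_derive_ipow 2 yN0 ny.
have d3 := is_derive_ipow 1 yN0 ny.
have d2 := is_derive_ipow 0 yN0 ny.
derive_to; first by rewrite /lam4; do !derive_step.
by rewrite /= psum_ipow1//; field.
Qed.

(* With [a = ln x] and [b = ln (1 + x)], the derivatives of the two values of [lam4] sum
   up to the exact form [d (a^4/4 + a^2 b^2 - a^3 b)] plus [(a^2 b - a b^2) da]; the last
   two brackets are antiderivatives of [- a^2 b / x] and [a b^2 / x]. *)
Definition lam4_invariant x : R :=
  lam4 (1 + x)^-1 + lam4 (x * (1 + x)^-1)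
  - ln x ^+ 4 / 4 - ln x ^+ 2 * ln (1 + x) ^+ 2 + ln x ^+ 3 * ln (1 + x)
  + (ln x ^+ 2 * L 2 (- x) - 2 * (ln x * L 3 (- x)) + 2 * L 4 (- x))
  + (2 * (ln x * psum (hpow 2) (- x)) - 2 * psum (hpow 3) (- x)).

Lemma is_derive_lam4_invariant x : 0 < x < 1 -> is_derive x 1 lam4_invariant 0.
Proof.
move=> /andP[x0 x1].
have xN0 : - x != 0 by rewrite oppr_eq0 gt_eqF.
have nx : `|- x| < 1 by rewrite normrN ger0_norm// ltW.
have p0 : 0 < 1 + x by lra.
have dN : is_derive x 1 (fun y : R => - y) (- 1) by derive_step; exact: is_derive_var.
have d4 := is_derive_compose (is_derive_ipow 2 xN0 nx) dN.
have d3 := is_derive_compose (is_derive_ipow 1 xN0 nx) dN.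
have d2 := is_derive_compose (is_derive_ipow 0 xN0 nx) dN.
have h3 := is_derive_compose (is_derive_hpow 1 xN0 nx) dN.
have h2 := is_derive_compose (is_derive_hpow 0 xN0 nx) dN.
have t01 : 0 < (1 + x)^-1 < 1 by rewrite invr_gt0 p0 invf_lt1//; lra.
have u01 : 0 < x * (1 + x)^-1 < 1.
  by rewrite mulr_gt0 ?invr_gt0// ltr_pdivrMr//; lra.
have dt : is_derive x 1 (fun y : R => (1 + y)^-1) (- 1 / (1 + x) ^+ 2).
  derive_to.
    by derive_step; [rewrite gt_eqF|do !derive_step].
  by rewrite /= add0r.
have du : is_derive x 1 (fun y : R => y * (1 + y)^-1) (1 / (1 + x) ^+ 2).
  apply: is_derive_to (is_derive_mul (is_derive_var x) dt) _.
  by field; lra.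
have lt := @is_derive_compose _ lam4 (fun y => (1 + y)^-1) x _ _ (is_derive_lam4 t01) dt.
have lu := @is_derive_compose _ lam4 (fun y => y * (1 + y)^-1) x _ _ (is_derive_lam4 u01) du.
derive_to; first by rewrite /lam4_invariant; do !derive_step.
have lnt : ln (1 + x)^-1 = - ln (1 + x) by rewrite lnV// posrE.
have lnu : ln (x * (1 + x)^-1) = ln x - ln (1 + x).
  by rewrite lnM ?posrE ?invr_gt0// lnt.
(* The two arguments of [lam4] sum to 1, so the derivatives of both terms involve only [ln x] and
   [ln (1 + x)]. *)
have -> : 1 - (1 + x)^-1 = x * (1 + x)^-1 by field; lra.
have -> : 1 - x * (1 + x)^-1 = (1 + x)^-1 by field; lra.
rewrite /= lnt lnu psum_ipow1// psum_hpow1// !opprK.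
by field; rewrite !gt_eqF.
Qed.

(** As [c 0] vanishes, a geometric tail gives the bound |y| / (1 - |y|). Being linear in |y|, it
    absorbs any power of a logarithm near 0. *)
Lemma psum_le c y : c 0%N = 0 -> (forall n, `|c n| <= 1) -> `|y| <= 2^-1 ->
  `|psum c y| <= 2 * `|y|.
Proof.
move=> c0 c1 y2.
have y1 : `|(`|y|)| < 1 by rewrite normr_id; lra.
have := @limn_series_tail_le _ (fun n => c n * y ^+ n) (geometric 1 `|y|) 1
  (is_cvg_geometric_series y1).
rewrite !(cvg_lim _ (cvg_geometric_series y1))// => h.
have {h} := h _; rewrite /series /= !big_nat1 c0 mul0r subr0 expr0 mulr1 => h.
apply: le_trans; first apply: h => n.
  by rewrite normrM normrX mul1r ler_piMl// exprn_ge0.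
move: (normr_ge0 y) y2; set z := `|y| => z0 z2.
have -> : 1 * (1 - z)^-1 - 1 = z / (1 - z) by field; lra.
rewrite ler_pdivrMr; last by lra.
by nra.
Qed.

Lemma cvg_series_ipow m : cvgn (series (ipow m.+2 : nat -> R)).
Proof.
have : cvgn (series (fun n => ipow 2 n : R)).
  apply: nondecreasing_is_cvgn.
    by apply/nondecreasing_seqP => n; rewrite seriesSr lerDl ipow_ge0.
  exists 2 => _ [n _ <-].
  (* Telescoping of 1/k^2 <= 1/(k^2 - 1/4) = 2/(2k - 1) - 2/(2k + 1). *)
  suff : forall n, series (ipow 2) n.+1 <= 2 - 2 / (2 * n%:R + 1) :> R.
    move=> h; case: n => [|n]; first by rewrite /series /= big_geq.
    apply: le_trans (h n) _; rewrite gerBl divr_ge0// addr_ge0// mulr_ge0//.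
  elim=> [|{}n IH].
    by rewrite /series /= big_nat1 ipow0 mulr0 add0r divr1 subrr.
  rewrite seriesSr; apply: le_trans (lerD IH (lexx _)) _.
  rewrite /ipow -(natr1 n).
  have n0 : 0 <= n%:R :> R by [].
  move: n0; set z := n%:R => n0.
  rewrite -subr_ge0 (_ : _ - _ = 1 / ((2 * z + 1) * (2 * z + 3) * (z + 1) ^+ 2)); last first.
    by field; do !(apply/andP; split); rewrite gt_eqF//; lra.
  by rewrite divr_ge0// !mulr_ge0 ?exprn_ge0//; lra.
move=> h2; apply: (is_cvg_series_dom h2) => -[|n]; first by rewrite !ipow0 normr0.
rewrite ger0_norm ?ipow_ge0// /ipow lef_pV2 ?posrE ?exprn_gt0//.
by rewrite ler_weXn2l// ler1n.
Qed.

(** Summation by parts: H_(k-1)/k^2 <= H_(k-1) (1/(k-1) - 1/k) for k >= 2, and the increments of H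
    produce the terms 1/k^2. The boundary term H_(n+1)/(n+1) is kept because the induction closes
    only with it. *)
Lemma series_hpow2_le n : series (hpow 2) n.+2 + series harmonic n.+1 / n.+1%:R <=
  series (ipow 2) n.+2 :> R.
Proof.
elim: n => [|n IH].
  have S0 (v : nat -> R) : series v 0 = 0 by rewrite /series /= big_geq.
  by rewrite !seriesSr !S0 /hpow !ipow0 /= S0 /ipow /harmonic /=; lra.
rewrite [series (hpow 2) _]seriesSr [series (ipow 2) _]seriesSr harmonic_sumS.
have H0 := harmonic_sum_ge0 n.+1 : 0 <= series harmonic n.+1 :> R.
move: IH; rewrite /hpow /= /ipow; move: (series harmonic n.+1) H0 => H H0.
move: (series _ n.+2) (series _ n.+2) => A B.
rewrite -(natr1 n.+1); have : 1 <= n.+1%:R :> R by rewrite ler1n.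
move: n.+1%:R => z z1 IH.
have : 0 <= H / z - H * ((z + 1) ^+ 2)^-1 - H / (z + 1).
  rewrite (_ : _ - _ = H * (z * (z + 1) ^+ 2)^-1).
    by rewrite mulr_ge0// invr_ge0 mulr_ge0 ?exprn_ge0//; lra.
  by field; apply/andP; split; rewrite gt_eqF//; lra.
have -> : (H + (z + 1)^-1) / (z + 1) = H / (z + 1) + ((z + 1) ^+ 2)^-1.
  by field; rewrite gt_eqF//; lra.
lra.
Qed.

Lemma cvg_series_hpow m : cvgn (series (hpow m.+2 : nat -> R)).
Proof.
have h2 : cvgn (series (fun n => hpow 2 n : R)).
  have nd : {homo series (fun n => hpow 2 n : R) : n m / (n <= m)%N >-> n <= m}.
    by apply/nondecreasing_seqP => n; rewrite seriesSr lerDl hpow_ge0.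
  apply: (nondecreasing_is_cvgn nd); exists (limn (series (fun n => ipow 2 n : R))) => _ [n _ <-].
  apply: le_trans (nd n n.+2 _) _; first by rewrite -addn2 leq_addr.
  apply: (@le_trans _ _ (series (ipow 2) n.+2)).
    apply: le_trans (series_hpow2_le n); rewrite lerDl divr_ge0//.
    exact: harmonic_sum_ge0.
  apply: nondecreasing_cvgn_le; last exact: cvg_series_ipow.
  by apply/nondecreasing_seqP => k; rewrite seriesSr lerDl ipow_ge0.
apply: (is_cvg_series_dom h2) => -[|n]; first by rewrite /hpow !ipow0 !mulr0 normr0.
rewrite ger0_norm ?hpow_ge0// /hpow ler_wpM2l ?harmonic_sum_ge0//.
rewrite /ipow lef_pV2 ?posrE ?exprn_gt0//.
by rewrite ler_weXn2l// ler1n.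
Qed.

Lemma norm_alt c n : `|alt c n| = `|c n|.
Proof. by rewrite /alt normrM normrX normrN1 expr1n mul1r. Qed.

Lemma norm_ipow m : (fun n => `|ipow m n|) = ipow m :> (nat -> R).
Proof. by apply/funext => n; rewrite ger0_norm ?ipow_ge0. Qed.

Lemma norm_hpow m : (fun n => `|hpow m n|) = hpow m :> (nat -> R).
Proof. by apply/funext => n; rewrite ger0_norm ?hpow_ge0. Qed.

Lemma norm_alt_fun c : (fun n => `|alt c n|) = (fun n => `|c n|).
Proof. by apply/funext => n; rewrite norm_alt. Qed.

Lemma psum_alt_abel c (u : nat -> R) : cvgn (series (fun n => `|c n|)) ->
  (forall n, 0 <= u n <= 1) -> u @ \oo --> (1 : R) ->
  (fun n => psum c (- u n)) @ \oo --> limn (series (alt c)).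
Proof.
move=> cc u1 cu; under eq_fun do rewrite psumN.
apply: psum_abel => //; first by rewrite norm_alt_fun.
by move=> n; have /andP[u0 ?] := u1 n; rewrite ger0_norm.
Qed.

(** Both arguments 1/(1+x) and x/(1+x) tend to 1/2, while [ln x] tends to 0 and removes every term
    that carries it; what remains are absolutely convergent series at -1. *)
Lemma lam4_invariant_at1 :
  lam4_invariant (1 - n.+2%:R^-1) @[n --> \oo] -->
  2 * lam4 2^-1 + 2 * limn (series (alt (ipow 4))) - 2 * limn (series (alt (hpow 3))).
Proof.
pose x n : R := 1 - n.+2%:R^-1.
have x01 n : 0 < x n < 1.
  by rewrite /x subr_gt0 invf_lt1 ?ltr1n//= gtrBl invr_gt0.
have x0 n : 0 < x n by have /andP[] := x01 n.
have x01' n : 0 <= x n <= 1 by have /andP[/ltW -> /ltW ->] := x01 n.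
have cx : x @ \oo --> (1 : R).
  rewrite -[X in _ --> X]subr0; apply: cvgB; first exact: cvg_cst.
  by have := @cvg_harmonic R; rewrite -cvg_shiftS.
have ca : ln (x n) @[n --> \oo] --> (0 : R).
  rewrite -(@ln1 R); apply: (@continuous_cvg _ _ _ _ _ _ (@ln R)) => //.
  exact: continuous_ln.
have c1x : 1 + x n @[n --> \oo] --> (2 : R).
  rewrite (_ : 2 = 1 + 1 :> R); last by ring.
  by apply: cvgD => //; exact: cvg_cst.
have cb : ln (1 + x n) @[n --> \oo] --> ln (2 : R).
  apply: (@continuous_cvg _ _ _ _ _ _ (@ln R)) => //.
  exact: continuous_ln.
have ct : (1 + x n)^-1 @[n --> \oo] --> (2^-1 : R) by apply: cvgV.
have cu : x n * (1 + x n)^-1 @[n --> \oo] --> (2^-1 : R).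
  by rewrite -[X in _ --> X]mul1r; apply: cvgM.
have clam : {for 2^-1, continuous lam4}.
  apply: is_derive_continuous; apply: is_derive_lam4.
  by rewrite invr_gt0 ltr0n invf_lt1 ?ltr1n.
have clt : lam4 (1 + x n)^-1 @[n --> \oo] --> lam4 2^-1 by exact: continuous_cvg clam ct.
have clu : lam4 (x n * (1 + x n)^-1) @[n --> \oo] --> lam4 2^-1 by exact: continuous_cvg clam cu.
have cL m : (fun n => L m.+2 (- x n)) @ \oo --> limn (series (alt (ipow m.+2))).
  by apply: psum_alt_abel => //; rewrite norm_ipow; exact: cvg_series_ipow.
have cH m : (fun n => psum (hpow m.+2) (- x n)) @ \oo --> limn (series (alt (hpow m.+2))).
  by apply: psum_alt_abel => //; rewrite norm_hpow; exact: cvg_series_hpow.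
have cXn (f : nat -> R) (l : R) k : f @ \oo --> l -> f n ^+ k @[n --> \oo] --> l ^+ k.
  move=> cf; apply: (@continuous_cvg _ _ _ _ _ _ (fun y : R => y ^+ k)) => //.
  exact: exprn_continuous.
have C (k : R) : k @[_ --> \oo] --> k by exact: cvg_cst.
rewrite [X in _ --> X](_ : _ =
  lam4 2^-1 + lam4 2^-1
  - 0 ^+ 4 / 4 - 0 ^+ 2 * ln 2 ^+ 2 + 0 ^+ 3 * ln 2
  + (0 ^+ 2 * limn (series (alt (ipow 2))) - 2 * (0 * limn (series (alt (ipow 3))))
     + 2 * limn (series (alt (ipow 4))))
  + (2 * (0 * limn (series (alt (hpow 2)))) - 2 * limn (series (alt (hpow 3))))); last first.
  by rewrite !expr0n /=; ring.
rewrite /lam4_invariant.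
apply: cvgD; last first.
  apply: cvgB; first by apply: cvgM => //; apply: cvgM => //; exact: cH.
  by apply: cvgM => //; exact: cH.
apply: cvgD; last first.
  apply: cvgD; last by apply: cvgM => //; exact: cL.
  apply: cvgB; first by apply: cvgM; [exact: cXn|exact: cL].
  by apply: cvgM => //; apply: cvgM => //; exact: cL.
apply: cvgD; last by apply: cvgM => //; exact: cXn.
apply: cvgB; last by apply: cvgM => //; exact: cXn.
apply: cvgB; last by apply: cvgM => //; exact: cXn.
exact: cvgD.
Qed.

End Lambda4.

(** * The limit of the invariant at 0 and the value of lambda_4 at 1/2 *)

Ltac cvg_step := lazymatch goal with
  | |- _ --> (_ + - _) => apply: cvgB
  | |- _ --> (_ + _) => apply: cvgD
  | |- _ --> (_ * _) => apply: cvgM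
  | |- _ --> (_ ^-1) => exact: cvg_cst
  | |- _ --> (_ *+ _) => exact: cvg_cst
  end.

Section Lambda4Half.
Context {R : realType}.
Implicit Types (c : nat -> R) (x y : R) (m n : nat).
Notation L m := (psum (ipow m)).

(** Along [expR (- n.+1%:R)] the logarithm is exactly [- n.+1%:R], so each decay estimate compares a
    power of an integer with an exponential. *)
Lemma lam4_invariant_at0 :
  lam4_invariant (expR (- n.+1%:R) : R) @[n --> \oo] --> 2 * limn (series (ipow 4)).
Proof.
pose s n : R := n.+1%:R.
pose x n := expR (- s n).
have s1 n : 1 <= s n by rewrite /s ler1n.
have x0 n : 0 < x n by exact: expR_gt0.
have lnx n : ln (x n) = - s n by rewrite expRK.
have x2 n : x n <= 2^-1.
  rewrite /x expRN lef_pV2 ?posrE ?expR_gt0//.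
  by apply: le_trans (expR_ge1Dx _); have := s1 n; lra.
(* The cubic term of the exponential suffices: s^k <= s^2 = (6 / s) (s^3 / 6). *)
have sx n k : (k <= 2)%N -> s n ^+ k * x n <= 6 * harmonic n.
  move=> k2; rewrite /x expRN ler_pdivrMr ?expR_gt0//.
  have s0 : 0 < s n by apply: lt_le_trans (s1 n).
  have h : s n ^+ 3 / 6 <= expR (s n).
    have := expR_ge1Dxn 2 (ltW s0); rewrite !factS fact0 !muln1; lra.
  have h2 : s n ^+ k <= s n ^+ 2 by rewrite ler_weXn2l.
  apply: le_trans h2 _.
  have -> : s n ^+ 2 = 6 * harmonic n * (s n ^+ 3 / 6).
    by rewrite /harmonic /= -/(s n); field; rewrite gt_eqF.
  by rewrite ler_wpM2l// mulr_ge0// harmonic_ge0.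
have null (f : nat -> R) k : (k <= 2)%N -> (forall n, `|f n| <= 2 * x n) ->
    ln (x n) ^+ k * f n @[n --> \oo] --> (0 : R).
  move=> k2 fx.
  have c6 : (fun n => 12 * harmonic n) @ \oo --> (0 : R).
    by rewrite -[X in _ --> X](mulr0 12); apply: cvgMr; exact: cvg_harmonic.
  apply/norm_cvg0P; apply: (squeeze_cvgr _ (cvg_cst 0) c6).
  apply: nearW => n; rewrite normr_ge0/= lnx normrM normrX normrN.
  have s0 : 0 <= s n by apply: le_trans (s1 n).
  rewrite (ger0_norm s0).
  apply: le_trans (ler_wpM2l _ (fx n)) _; first exact: exprn_ge0.
  rewrite mulrCA (_ : 12 = 2 * 6 :> R); last by ring.
  by rewrite -mulrA ler_wpM2l// sx.
have null0 (f : nat -> R) : (forall n, `|f n| <= 2 * x n) -> f @ \oo --> (0 : R).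
  move=> fx; rewrite (_ : f = fun n => ln (x n) ^+ 0 * f n); first exact: null.
  by apply/funext => n; rewrite expr0 mul1r.
have null1 (f : nat -> R) : (forall n, `|f n| <= 2 * x n) ->
    ln (x n) * f n @[n --> \oo] --> (0 : R).
  by move=> fx; have := null f 1 isT fx; under eq_fun do rewrite expr1.
have u0 n : 0 < x n * (1 + x n)^-1 <= x n.
  rewrite divr_gt0 ?addr_gt0//= ler_pdivrMr ?addr_gt0//.
  by rewrite ler_peMr ?lerDl// ltW.
have bx n : `|ln (1 + x n)| <= 2 * x n.
  have := x0 n => x0n.
  rewrite ger0_norm; last by apply: ln_ge0; lra.
  by apply: le_trans (le_ln1Dx _) _; lra.
have xN n : `|- x n| = x n by rewrite normrN gtr0_norm.
have I1 m k : `|ipow m.+1 k : R| <= 1 by rewrite ger0_norm ?ipow_ge0 ?ipow_le1.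
have H1 m k : `|hpow m.+1 k : R| <= 1 by rewrite ger0_norm ?hpow_ge0 ?hpow_le1.
have H0 m : hpow m.+1 0 = 0 :> R by rewrite /hpow ipow0 mulr0.
have xN2 n : `|- x n| <= 2^-1 by rewrite xN.
have Lx m n : `|L m.+1 (- x n)| <= 2 * x n.
  by rewrite -[X in 2 * X]xN; exact: (psum_le (ipow0 _) (I1 m) (xN2 n)).
have Hx m n : `|psum (hpow m.+1) (- x n)| <= 2 * x n.
  by rewrite -[X in 2 * X]xN; exact: (psum_le (H0 m) (H1 m) (xN2 n)).
have Lu m n : `|L m.+1 (x n * (1 + x n)^-1)| <= 2 * x n.
  have /andP[un0 unx] := u0 n.
  have uE : `|x n * (1 + x n)^-1| = x n * (1 + x n)^-1 by rewrite gtr0_norm.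
  have u2 : `|x n * (1 + x n)^-1| <= 2^-1 by rewrite uE (le_trans unx).
  by apply: le_trans (psum_le (ipow0 _) (I1 m) u2) _; rewrite uE ler_wpM2l.
have C (k : R) : k @[_ --> \oo] --> k by exact: cvg_cst.
have cb : ln (1 + x n) @[n --> \oo] --> (0 : R) by exact: null0.
have cx : x n @[n --> \oo] --> (0 : R).
  by apply: null0 => n; rewrite gtr0_norm//; have := x0 n; lra.
have c1x : 1 + x n @[n --> \oo] --> (1 : R).
  by rewrite -[X in _ --> X]addr0; apply: cvgD.
have ct : (1 + x n)^-1 @[n --> \oo] --> (1 : R).
  by rewrite -[X in _ --> X]invr1; apply: cvgV => //; exact: oner_neq0.
have cLt m : L m.+2 (1 + x n)^-1 @[n --> \oo] --> limn (series (ipow m.+2) : nat -> R).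
  apply: psum_abel => //; first by rewrite norm_ipow; exact: cvg_series_ipow.
  move=> n; have := x0 n => x0n; rewrite ger0_norm ?invr_ge0; last by lra.
  by rewrite invf_le1; lra.
pose a n := ln (x n); pose b n := ln (1 + x n); pose u n := x n * (1 + x n)^-1.
(* In (a - b)^4 / 4 the terms in a^4 and a^3 b cancel against the corrections built into the
   invariant. The rest is grouped so that every power of [a] multiplies factors of size O(x). *)
rewrite (_ : (fun n => _) = fun n =>
  2 * L 4 (1 + x n)^-1 + 2 * (b n * L 3 (1 + x n)^-1) + b n * b n * L 2 (1 + x n)^-1
  + b n * b n * b n * b n / 4
  + (2 * L 4 (u n) - 2 * (a n * L 3 (u n)) + 2 * (b n * L 3 (u n))
  + (a n ^+ 2 * L 2 (u n) - 2 * (b n * (a n * L 2 (u n))) + b n * b n * L 2 (u n)))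
  + (a n * b n * (a n * b n) / 2 - a n * b n * (b n * b n) + b n * b n * b n * b n / 4)
  + (a n ^+ 2 * L 2 (- x n) - 2 * (a n * L 3 (- x n)) + 2 * L 4 (- x n))
  + (2 * (a n * psum (hpow 2) (- x n)) - 2 * psum (hpow 3) (- x n))); last first.
  apply/funext => n; rewrite /lam4_invariant /lam4 -/(x n).
  have x0n := x0 n; have p0 : 0 < 1 + x n by rewrite addr_gt0.
  have -> : ln (1 + x n)^-1 = - b n by rewrite lnV// posrE.
  have -> : ln (x n * (1 + x n)^-1) = a n - b n.
    by rewrite lnM ?posrE ?invr_gt0// lnV ?posrE.
  by rewrite -/(u n) -/(b n) -/(a n); field.
rewrite [X in _ --> X](_ : _ =
  2 * limn (series (ipow 4)) + 2 * (0 * limn (series (ipow 3)))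
  + 0 * 0 * limn (series (ipow 2)) + 0 * 0 * 0 * 0 / 4
  + (2 * 0 - 2 * 0 + 2 * (0 * 0) + (0 - 2 * (0 * 0) + 0 * 0 * 0))
  + (0 * 0 / 2 - 0 * (0 * 0) + 0 * 0 * 0 * 0 / 4)
  + (0 - 2 * 0 + 2 * 0) + (2 * 0 - 2 * 0)); last by ring.
do !cvg_step.
- exact: (cLt 2).
- exact: cb.
- exact: (cLt 1).
- exact: cb.
- exact: cb.
- exact: (cLt 0).
- exact: cb.
- exact: cb.
- exact: cb.
- exact: cb.
- exact: (null0 _ (Lu 3)).
- exact: (null1 _ (Lu 2)).
- exact: cb.
- exact: (null0 _ (Lu 2)).
- exact: (null _ 2 isT (Lu 1)).
- exact: cb.
- exact: (null1 _ (Lu 1)).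
- exact: cb.
- exact: cb.
- exact: (null0 _ (Lu 1)).
- exact: (null1 _ bx).
- exact: (null1 _ bx).
- exact: (null1 _ bx).
- exact: cb.
- exact: cb.
- exact: cb.
- exact: cb.
- exact: cb.
- exact: cb.
- exact: (null _ 2 isT (Lx 1)).
- exact: (null1 _ (Lx 2)).
- exact: (null0 _ (Lx 3)).
- exact: (null1 _ (Hx 1)).
- exact: (null0 _ (Hx 2)).
Qed.

Lemma lam4_half : lam4 (2^-1 : R) =
  limn (series (ipow 4)) - limn (series (alt (ipow 4))) + limn (series (alt (hpow 3))).
Proof.
have K x : 0 < x < 1 -> lam4_invariant x = lam4_invariant 2^-1.
  move=> x01; have h01 : 0 < (2^-1 : R) < 1 by apply/andP; split; lra.
  have := @eq_derive_itv R lam4_invariant (fun=> 0) (fun=> 0) 0 1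
    (@is_derive_lam4_invariant R) (fun y _ => is_derive_const 0 y) x 2^-1 x01 h01.
  by rewrite !subr0.
have K1 := @lam4_invariant_at1 R.
have K0 := lam4_invariant_at0.
rewrite (_ : (fun _ => _) = fun=> lam4_invariant 2^-1) in K1; last first.
  apply/funext => n; apply: K.
  by rewrite subr_gt0 invf_lt1 ?ltr1n//= gtrBl invr_gt0.
rewrite (_ : (fun _ => _) = fun=> lam4_invariant 2^-1) in K0; last first.
  apply/funext => n; apply: K.
  by rewrite expR_gt0 expR_lt1 oppr_lt0 ltr0n.
have /(_ (@Rhausdorff R) _) E := cvg_unique _ K1 K0.
lra.
Qed.
End Lambda4Half.

(** * Alternating series, even-indexed terms and Euler sums *)

Section EulerSums.
Context {R : realType}.
Implicit Types (c : nat -> R) (x y : R) (m n : nat).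

Lemma cvg_series_alt c : cvgn (series (fun n => `|c n|)) -> cvgn (series (alt c)).
Proof. by move=> h; apply: (is_cvg_series_dom h) => n; rewrite norm_alt. Qed.

Lemma cvg_alt_ipow m : cvgn (series (alt (ipow m.+2) : nat -> R)).
Proof. by apply: cvg_series_alt; rewrite norm_ipow; exact: cvg_series_ipow. Qed.

Lemma cvg_alt_hpow m : cvgn (series (alt (hpow m.+2) : nat -> R)).
Proof. by apply: cvg_series_alt; rewrite norm_hpow; exact: cvg_series_hpow. Qed.

Lemma series_even c n :
  series c n.*2 + series (alt c) n.*2 = 2 * series (fun k => c k.*2) n.
Proof.
elim: n => [|n IH]; first by rewrite /series /= !big_geq//; ring.
have e : (-1) ^+ n.*2 = 1 :> R by rewrite -mul2n exprM sqrrN !expr1n.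
by rewrite doubleS !seriesSr mulrDr -IH /alt exprS e; ring.
Qed.

Lemma cvg_double : (fun n => n.*2) @ \oo --> \oo.
Proof.
apply/cvgnyPge => A; near=> n.
by rewrite (@leq_trans n)//; [near: n; exact: nbhs_infty_ge|rewrite -addnn leq_addr].
Unshelve. all: by end_near. Qed.

Lemma lim_series_even c : cvgn (series c) -> cvgn (series (alt c)) ->
  2 * series (fun k => c k.*2) n @[n --> \oo] --> limn (series c) + limn (series (alt c)).
Proof.
move=> cc ca; under eq_fun do rewrite -series_even.
by apply: cvgD; apply: cvg_comp cvg_double _.
Qed.

(** Adding the alternating series doubles the even-indexed terms and kills the odd ones; the
    even-indexed terms reproduce the series scaled by [2^-1 ^+ m.+2]. *)
Lemma lim_alt_ipow m :
  limn (series (ipow m.+2)) + limn (series (alt (ipow m.+2))) =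
  2 * 2^-1 ^+ m.+2 * limn (series (ipow m.+2)) :> R.
Proof.
have h1 := lim_series_even (@cvg_series_ipow R m) (@cvg_alt_ipow m).
have h2 : 2 * series (fun k => ipow m.+2 k.*2 : R) n @[n --> \oo] -->
    2 * 2^-1 ^+ m.+2 * limn (series (ipow m.+2 : nat -> R)).
  rewrite (_ : (fun _ => _) = fun n => 2 * 2^-1 ^+ m.+2 * series (ipow m.+2) n).
    by apply: cvgMr; exact: cvg_series_ipow.
  apply/funext => n; rewrite -mulrA; congr (_ * _).
  rewrite /series /= mulr_sumr; apply: eq_bigr => k _.
  by rewrite /ipow -mul2n natrM exprMn invfM exprVn.
have /(_ (@Rhausdorff R) _) E := cvg_unique _ h1 h2.
exact: E.
Qed.

(** One factor a_n a_k of a_n^2 a_k^2 is replaced by (a_n + a_k) b_nk; the two resulting double sums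
    coincide after exchange of the indices. *)
Lemma sum_sym_split (N : nat) (a : nat -> R) (b : nat -> nat -> R) :
  (forall n k, b n k = b k n) ->
  (forall n k, a n * a k = (a n + a k) * b n k) ->
  (\sum_(0 <= n < N) a n ^+ 2) ^+ 2 =
  2 * \sum_(0 <= n < N) (a n ^+ 2 * \sum_(0 <= k < N) a k * b n k).
Proof.
move=> bC ab; rewrite expr2 big_distrl /=.
pose f n k := a n ^+ 2 * (a k * b n k).
transitivity (\sum_(0 <= n < N) (\sum_(0 <= k < N) f n k + \sum_(0 <= k < N) f k n)).
  apply: eq_bigr => n _; rewrite big_distrr /= -big_split /=; apply: eq_bigr => k _.
  rewrite (_ : a n ^+ 2 * a k ^+ 2 = a n * a k * (a n * a k)); last by ring.
  by rewrite {2}ab /f (bC k n); ring.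
rewrite big_split /= [X in _ + X]exchange_big /= mulr_natl mulr2n.
by congr (_ + _); apply: eq_bigr => n _; rewrite big_distrr.
Qed.

Lemma harmonic_sum_shift N m : series harmonic (N + m)%N - series harmonic N <=
  m%:R / N.+1%:R :> R.
Proof.
elim: m => [|m IH]; first by rewrite addn0 subrr mul0r.
rewrite addnS harmonic_sumS.
have : (N + m).+1%:R^-1 <= N.+1%:R^-1 :> R.
  by rewrite lef_pV2 ?posrE ?ltr0n// ler_nat ltnS leq_addr.
rewrite -(natr1 m) mulrDl mul1r; move: (N.+1%:R^-1) IH => z IH.
by move: (_^-1) => w wz; move: IH; rewrite !lerBlDr => IH; apply: le_trans (lerD IH wz) _; rewrite addrAC.
Qed.

(* Symmetrising [1/(n^2 k^2) = (1/n + 1/k) / (n k (n + k))] over a square of indices and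
   telescoping the inner sum over [k]. *)
Lemma euler_sum_finite N :
  series (ipow 2) N.+1 ^+ 2 = 2 * \sum_(0 <= n < N)
    (n.+1%:R ^- 3 * (series harmonic n.+1 - (series harmonic (N + n.+1)%N - series harmonic N))) :> R.
Proof.
have -> : series (ipow 2) N.+1 = \sum_(0 <= n < N) n.+1%:R^-1 ^+ 2 :> R.
  rewrite /series /= big_nat_recl// ipow0 add0r.
  by apply: eq_bigr => n _; rewrite /ipow exprVn.
have nz n : n.+1%:R != 0 :> R by rewrite pnatr_eq0.
rewrite (@sum_sym_split N (fun n => n.+1%:R^-1) (fun n k => (n.+1 + k.+1)%:R^-1)).
- congr (_ * _); apply: eq_bigr => n _.
  have -> : n.+1%:R ^- 3 = n.+1%:R^-1 ^+ 2 * n.+1%:R^-1 :> R by field; rewrite nat1r.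
  rewrite -[RHS]mulrA; congr (_ * _).
  transitivity (\sum_(0 <= k < N) n.+1%:R^-1 * (k.+1%:R^-1 - (n.+1 + k.+1)%:R^-1) : R).
    apply: eq_bigr => k _; rewrite natrD -!natr1.
    have : 0 <= n%:R :> R by []; have : 0 <= k%:R :> R by [].
    by move: n%:R k%:R => z w w0 z0; field; do !(apply/andP; split); rewrite gt_eqF//; lra.
  rewrite -big_distrr /=; congr (_ * _); rewrite sumrB.
  have H k : series harmonic (k + n.+1)%N - series harmonic n.+1 =
      \sum_(0 <= j < k) (n.+1 + j.+1)%:R^-1 :> R.
    elim: k => [|k IHk]; first by rewrite add0n subrr big_geq.
    have e : (n.+1 + k.+1 = (k + n.+1).+1)%N by rewrite addnC addSn.
    by rewrite addSn harmonic_sumS big_nat_recr//= -IHk e; ring.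
  have -> : \sum_(0 <= k < N) k.+1%:R^-1 = series harmonic N :> R by [].
  by rewrite -H; ring.
- by move=> n k; rewrite addnC.
- move=> n k; rewrite natrD -!natr1.
  have : 0 <= n%:R :> R by []; have : 0 <= k%:R :> R by [].
  by move: n%:R k%:R => z w w0 z0; field; do !(apply/andP; split); rewrite gt_eqF//; lra.
Qed.

Lemma lim_euler_sum :
  2 * (limn (series (hpow 3)) + limn (series (ipow 4))) = limn (series (ipow 2)) ^+ 2 :> R.
Proof.
have c2 := @cvg_series_ipow R 0.
have h1 : series (ipow 2) N.+1 ^+ 2 @[N --> \oo] --> (limn (series (ipow 2)) ^+ 2 : R).
  apply: (@continuous_cvg _ _ _ _ _ _ (fun y : R => y ^+ 2)); first exact: exprn_continuous.
  by rewrite (cvg_shiftS (series (ipow 2))).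
(* Truncation error of the finite identity: cutting the inner sum at N leaves H_(N+n) - H_N <=
   n/(N+1) against 1/n^3, a total of at most zeta(2)/(N+1). *)
pose e N : R := \sum_(0 <= n < N)
    (n.+1%:R ^- 3 * (series harmonic (N + n.+1)%N - series harmonic N)).
have e0 N : 0 <= e N.
  apply: sumr_ge0 => n _; rewrite mulr_ge0 ?invr_ge0 ?exprn_ge0// subr_ge0.
  apply: nondecreasing_series; last exact: leq_addr.
  by move=> k _ _; exact: harmonic_ge0.
have ele N : e N <= limn (series (ipow 2)) * harmonic N.
  apply: (@le_trans _ _ (series (ipow 2) N.+1 * harmonic N)).
    rewrite [series (ipow 2) _]big_nat_recl// ipow0 add0r mulr_suml.
    apply: ler_sum => n _.
    rewrite (_ : ipow 2 n.+1 * harmonic N = n.+1%:R ^- 3 * (n.+1%:R / N.+1%:R)).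
      by rewrite ler_wpM2l ?invr_ge0 ?exprn_ge0// harmonic_sum_shift.
    by rewrite /ipow /harmonic /=; field; rewrite !nat1r !pnatr_eq0.
  rewrite ler_wpM2r ?harmonic_ge0//; apply: nondecreasing_cvgn_le => //.
  by apply/nondecreasing_seqP => k; rewrite seriesSr lerDl ipow_ge0.
have ce : e @ \oo --> (0 : R).
  apply: (squeeze_cvgr _ (cvg_cst 0) (_ : (fun N => limn (series (ipow 2)) * harmonic N) @ \oo --> 0)).
    by apply: nearW => N; rewrite e0 ele.
  by rewrite -[X in _ --> X](mulr0 (limn (series (ipow 2)))); apply: cvgMr; exact: cvg_harmonic.
have h2 : 2 * (series (hpow 3) N.+1 + series (ipow 4) N.+1 - e N) @[N --> \oo] -->
    2 * (limn (series (hpow 3)) + limn (series (ipow 4)) - 0).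
  apply: cvgMr; apply: cvgB => //; apply: cvgD.
    rewrite (cvg_shiftS (series (hpow 3))); exact: cvg_series_hpow.
  rewrite (cvg_shiftS (series (ipow 4))); exact: cvg_series_ipow.
have E N : series (ipow 2) N.+1 ^+ 2 = 2 * (series (hpow 3) N.+1 + series (ipow 4) N.+1 - e N) :> R.
  rewrite euler_sum_finite; congr (_ * _).
  rewrite ![series _ N.+1]big_nat_recl// /hpow !ipow0 mulr0 !add0r -big_split /= -sumrB.
  apply: eq_bigr => n _; rewrite harmonic_sumS /ipow /=.
  by field; rewrite !nat1r !pnatr_eq0.
rewrite -(funext E) subr0 in h2.
have /(_ (@Rhausdorff R) _) := cvg_unique _ h1 h2.
by move=> ->.
Qed.

Lemma odd_harmonic_sum n :
  \sum_(0 <= j < n) (2 * j%:R + 1)^-1 = series harmonic n.*2 - series harmonic n / 2 :> R.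
Proof.
elim: n => [|n IH]; first by rewrite double0 /series /= !big_geq//; ring.
rewrite big_nat_recr//= IH doubleS !harmonic_sumS -!natr1 -mul2n natrM.
have : 0 <= n%:R :> R by [].
by move: n%:R => z z0; field; do !(apply/andP; split); rewrite gt_eqF//; lra.
Qed.

(** The odd harmonic sum is H_(2n) - H_n / 2, and H_(2n) / (2 n^3) = 4 H_(2n) / (2n)^3 is an
    even-indexed term of the sum of H_k / k^3, which [lim_series_even] extracts. Here H_k / k^3 is
    [hpow 3 k + ipow 4 k]. *)
Lemma cvg_odd_harmonic_sum :
  series (fun n => (\sum_(0 <= j < n) (2 * j%:R + 1)^-1) / (2 * n%:R ^+ 3)) N @[N --> \oo] -->
  2 * (limn (series (hpow 3)) + limn (series (ipow 4))
       + limn (series (alt (hpow 3))) + limn (series (alt (ipow 4))))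
  - 4^-1 * (limn (series (hpow 3)) + limn (series (ipow 4)) : R).
Proof.
have h1 := lim_series_even (@cvg_series_hpow R 1) (@cvg_alt_hpow 1).
have h2 := lim_series_even (@cvg_series_ipow R 2) (@cvg_alt_ipow 2).
have h3 := @cvg_series_hpow R 1.
have h4 := @cvg_series_ipow R 2.
have h : 2 * (2 * series (fun k => hpow 3 k.*2 : R) n + 2 * series (fun k => ipow 4 k.*2 : R) n)
    - 4^-1 * (series (hpow 3) n + series (ipow 4) n) @[n --> \oo] -->
  2 * (limn (series (hpow 3)) + limn (series (alt (hpow 3)))
       + (limn (series (ipow 4)) + limn (series (alt (ipow 4)))))
  - 4^-1 * (limn (series (hpow 3)) + limn (series (ipow 4)) : R).
  by apply: cvgB; apply: cvgMr; apply: cvgD.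
rewrite (_ : _ - _ = 2 * (limn (series (hpow 3)) + limn (series (alt (hpow 3)))
       + (limn (series (ipow 4)) + limn (series (alt (ipow 4)))))
  - 4^-1 * (limn (series (hpow 3)) + limn (series (ipow 4)))); last by ring.
rewrite (_ : (fun _ => _) = fun n =>
  2 * (2 * series (fun k => hpow 3 k.*2 : R) n + 2 * series (fun k => ipow 4 k.*2 : R) n)
    - 4^-1 * (series (hpow 3) n + series (ipow 4) n)) //.
apply/funext => n; rewrite /series /= !mulr_sumr -!big_split /= !mulr_sumr -sumrB.
apply: eq_bigr => -[|k] _.
  by rewrite big_geq// mul0r /hpow !double0 !ipow0; ring.
rewrite odd_harmonic_sum /hpow /ipow doubleS /= !harmonic_sumS -!natr1 -mul2n natrM.
have : 0 <= k%:R :> R by [].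
by move: k%:R => z z0; field; do !(apply/andP; split); rewrite gt_eqF//; lra.
Qed.
End EulerSums.

(** * Fourier expansions of log (1 - r e^(i al)) and of its square, in real terms *)

Section LogFourier.
Context {R : realType}.
Implicit Types (c d w : nat -> R) (r al : R) (m n : nat).

Lemma psum_lin (a b : R) c d r : cvgn (pseries c r) -> cvgn (pseries d r) ->
  psum (fun n => a * c n + b * d n) r = a * psum c r + b * psum d r.
Proof.
move=> cc cd; apply/cvg_lim => //.
rewrite (_ : pseries _ _ = fun n => a * pseries c r n + b * pseries d r n).
  by apply: cvgD; apply: cvgMr.
apply/funext => n; rewrite /pseries /series /= !mulr_sumr -big_split /=.
by apply: eq_bigr => k _; ring.
Qed.

Lemma psum_recl c r : cvgn (pseries (fun n => c n.+1) r) ->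
  psum c r = c 0%N + r * psum (fun n => c n.+1) r.
Proof.
move=> cc; apply/cvg_lim => //; rewrite -cvg_shiftS /=.
rewrite (_ : (fun _ => _) = fun n => c 0%N + r * pseries (fun n => c n.+1) r n).
  by apply: cvgD; [exact: cvg_cst|exact: cvgMr].
apply/funext => n; rewrite /pseries /series /= big_nat_recl// expr0 mulr1.
by rewrite mulr_sumr; congr (_ + _); apply: eq_bigr => k _; rewrite exprS; ring.
Qed.

Lemma cvg_disc_le c w : cvg_unit_disc (fun n => `|w n|) -> (forall n, `|c n| <= `|w n|) ->
  cvg_unit_disc c.
Proof.
move=> cw cwn z z1; apply: (is_cvg_series_dom (cw `|z| _)); first by rewrite normr_id.
by move=> n; rewrite normrM normrX ler_wpM2r ?exprn_ge0.
Qed.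

Definition cosc w al : nat -> R := fun n => w n * cos (n%:R * al).
Definition sinc w al : nat -> R := fun n => w n * sin (n%:R * al).

Lemma norm_cosc_le w al n : `|cosc w al n| <= `|w n|.
Proof. by rewrite normrM ler_piMr// cos_max. Qed.

Lemma norm_sinc_le w al n : `|sinc w al n| <= `|w n|.
Proof. by rewrite normrM ler_piMr// sin_max. Qed.

Lemma cosS n al : cos (n.+1%:R * al) = cos (n%:R * al) * cos al - sin (n%:R * al) * sin al.
Proof. by rewrite -natr1 mulrDl mul1r cosD. Qed.

Lemma sinS n al : sin (n.+1%:R * al) = sin (n%:R * al) * cos al + cos (n%:R * al) * sin al.
Proof. by rewrite -natr1 mulrDl mul1r sinD. Qed.

(** The squared modulus of 1 - r e^(i al). *)
Definition sqdist r al : R := 1 - 2 * r * cos al + r ^+ 2.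

Lemma sqdistE r al : sqdist r al = (1 - r * cos al) ^+ 2 + (r * sin al) ^+ 2.
Proof. by rewrite /sqdist [in RHS]exprMn sin2cos2; ring. Qed.

Lemma sub_mul_cos_gt0 r al : `|r| < 1 -> 0 < 1 - r * cos al.
Proof.
move=> r1; rewrite subr_gt0; apply: le_lt_trans (ler_norm _) _.
by rewrite normrM (le_lt_trans _ r1)// ler_piMr// cos_max.
Qed.

Lemma sqdist_gt0 r al : `|r| < 1 -> 0 < sqdist r al.
Proof.
move=> r1; rewrite sqdistE ltr_pwDl ?sqr_ge0// exprn_gt0//.
exact: sub_mul_cos_gt0.
Qed.

Definition logabs r al : R := ln (sqdist r al) / 2.
(** For |r| < 1 the real part 1 - r cos al is positive, so the arctangent of the quotient is the
    principal argument of 1 - r e^(i al), without a choice of branch. *)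
Definition argm r al : R := - atan (r * sin al / (1 - r * cos al)).

Lemma is_derive_logabs al r : `|r| < 1 ->
  is_derive r 1 (logabs ^~ al) ((r - cos al) / sqdist r al).
Proof.
move=> r1; have D0 := sqdist_gt0 al r1.
rewrite /logabs; derive_to.
  derive_step; last by do !derive_step.
  derive_step; first exact: D0.
  by rewrite /sqdist; do !derive_step.
by rewrite /=; field; rewrite gt_eqF.
Qed.

Lemma is_derive_argm al r : `|r| < 1 ->
  is_derive r 1 (argm ^~ al) (- sin al / sqdist r al).
Proof.
move=> r1; have D0 := sqdist_gt0 al r1; have c0 := sub_mul_cos_gt0 al r1.
have dv : is_derive r 1 (fun r => r * sin al / (1 - r * cos al)) (sin al / (1 - r * cos al) ^+ 2).
  derive_to; first by do !derive_step; rewrite gt_eqF.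
  by rewrite /=; field; rewrite gt_eqF.
rewrite /argm; apply: is_derive_to (is_derive_opp (is_derive_compose (is_derive1_atan _) dv)) _.
rewrite expr_div_n mulNr; congr (- _).
have E := sqdistE r al.
have -> : 1 + (r * sin al) ^+ 2 / (1 - r * cos al) ^+ 2 = sqdist r al / (1 - r * cos al) ^+ 2.
  by rewrite E; field; rewrite gt_eqF.
by field; rewrite !gt_eqF.
Qed.

Section rotation.
Variables (r al : R) (w e : nat -> R) (w0 : R).
Hypotheses (r1 : `|r| < 1) (w0E : w 0%N = w0) (wS : forall n, w n.+1 = w n + e n).
Hypotheses (cw : cvg_unit_disc (fun n => `|w n|)) (ce : cvg_unit_disc (fun n => `|e n|)).
Let C v := psum (fun n => v n * cos (n.+1%:R * al)) r.
Let S v := psum (fun n => v n * sin (n.+1%:R * al)) r.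

Let cC v : cvg_unit_disc (fun n => `|v n|) -> cvgn (pseries (fun n => v n * cos (n.+1%:R * al)) r).
Proof. by move=> cv; apply: (cvg_disc_le cv) => // n; rewrite normrM ler_piMr// cos_max. Qed.

Let cS v : cvg_unit_disc (fun n => `|v n|) -> cvgn (pseries (fun n => v n * sin (n.+1%:R * al)) r).
Proof. by move=> cv; apply: (cvg_disc_le cv) => // n; rewrite normrM ler_piMr// sin_max. Qed.

(** Splitting off the term n = 0 and shifting the index gives Z = w0 e^(i al) + r e^(i al) (Z + E),
    where Z is the sum of w_n r^n e^(i (n+1) al) and E is built likewise from the increments. The
    two equations are its real and imaginary parts. *)
Lemma psum_rot_eqs :
  C w = w0 * cos al + r * (cos al * (C w + C e) - sin al * (S w + S e)) /\
  S w = w0 * sin al + r * (cos al * (S w + S e) + sin al * (C w + C e)).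
Proof.
have cws : cvg_unit_disc (fun n => `|w n + e n|).
  move=> z z1; apply: (is_cvg_series_dom (M := fun n => `|w n| * `|z| ^+ n + `|e n| * `|z| ^+ n)).
    have z2 : `|(`|z|)| < 1 by rewrite normr_id.
    have -> : series (fun n => `|w n| * `|z| ^+ n + `|e n| * `|z| ^+ n) =
       fun n => pseries (fun n => `|w n|) `|z| n + pseries (fun n => `|e n|) `|z| n.
      by apply/funext => n; rewrite /series /= big_split.
    by apply: is_cvgD; [exact: cw|exact: ce].
  by move=> n; rewrite normrM normr_id normrX -mulrDl ler_wpM2r ?exprn_ge0// ler_normD.
have CD : C (fun n => w n + e n) = C w + C e.
  rewrite -[C w]mul1r -[C e]mul1r -psum_lin; [|exact: cC|exact: cC].
  by congr psum; apply/funext => n; ring.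
have SD : S (fun n => w n + e n) = S w + S e.
  rewrite -[S w]mul1r -[S e]mul1r -psum_lin; [|exact: cS|exact: cS].
  by congr psum; apply/funext => n; ring.
rewrite -CD -SD; split.
- rewrite {1}/C psum_recl /= ?w0E ?mul1r.
    congr (_ + _ * _).
    rewrite -mulNr -psum_lin; [|exact: cC|exact: cS].
    by congr psum; apply/funext => n; rewrite wS cosS; ring.
  by under eq_fun do rewrite wS; apply: (cvg_disc_le cws) => // n;
    rewrite normrM ler_piMr// cos_max.
- rewrite {1}/S psum_recl /= ?w0E ?mul1r.
    congr (_ + _ * _).
    rewrite -psum_lin; [|exact: cS|exact: cC].
    by congr psum; apply/funext => n; rewrite wS sinS; ring.
  by under eq_fun do rewrite wS; apply: (cvg_disc_le cws) => // n;
    rewrite normrM ler_piMr// sin_max.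
Qed.

End rotation.

(** Division of p + i q by 1 - r e^(i al), through multiplication by the conjugate. *)
Lemma solve_rotation r al (X Y p q : R) : `|r| < 1 ->
  X = p + r * (cos al * X - sin al * Y) -> Y = q + r * (cos al * Y + sin al * X) ->
  X = ((1 - r * cos al) * p - r * sin al * q) / sqdist r al /\
  Y = ((1 - r * cos al) * q + r * sin al * p) / sqdist r al.
Proof.
move=> r1 EX EY; have D0 : sqdist r al != 0 by rewrite gt_eqF// sqdist_gt0.
have Ep : p = X - r * (cos al * X - sin al * Y) by rewrite {1}EX addrK.
have Eq : q = Y - r * (cos al * Y + sin al * X) by rewrite {1}EY addrK.
split; apply: (mulIf D0); rewrite divfK// sqdistE Ep Eq; ring.
Qed.

Lemma cvg_disc_const (a : R) : cvg_unit_disc (fun=> a).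
Proof. by apply: (@cvg_unit_disc_bounded _ _ `|a|). Qed.

Lemma psum_cos_sin r al : `|r| < 1 ->
  psum (fun n => cos (n.+1%:R * al)) r = (cos al - r) / sqdist r al /\
  psum (fun n => sin (n.+1%:R * al)) r = sin al / sqdist r al.
Proof.
move=> r1.
(* Constant weights with zero increments: the geometric series of ratio r e^(i al). *)
have wS n : (fun=> 1 : R) n.+1 = (fun=> 1 : R) n + (fun=> 0) n by rewrite addr0.
have := psum_rot_eqs al r1 erefl wS (@cvg_disc_const _) (@cvg_disc_const _).
have E (f : nat -> R) : psum (fun n => 0 * f n) r = 0.
  rewrite (_ : (fun n => _) = fun n => 0 * f n + 0 * 0); last first.
    by apply/funext => n; rewrite mulr0 addr0.
  apply/cvg_lim => //.
  rewrite (_ : pseries _ _ = fun=> 0); first exact: cvg_cst.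
  apply/funext => n; rewrite /pseries /series /= big1// => i _.
  by rewrite !mul0r add0r mul0r.
rewrite !E !addr0 !mul1r.
have -> : (fun n => 1 * cos (n.+1%:R * al)) = fun n => cos (n.+1%:R * al).
  by apply/funext => n; rewrite mul1r.
have -> : (fun n => 1 * sin (n.+1%:R * al)) = fun n => sin (n.+1%:R * al).
  by apply/funext => n; rewrite mul1r.
move=> [EX EY]; have [-> ->] := solve_rotation r1 EX EY.
by split; congr (_ / _); [rewrite (_ : _ - _ = cos al - r * (cos al ^+ 2 + sin al ^+ 2));
  [rewrite cos2Dsin2; ring|ring]|ring].
Qed.

Lemma cvg_disc_cosc w al : cvg_unit_disc (fun n => `|w n|) -> cvg_unit_disc (cosc w al).
Proof. by move=> h; apply: (cvg_disc_le h); exact: norm_cosc_le. Qed.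

Lemma cvg_disc_sinc w al : cvg_unit_disc (fun n => `|w n|) -> cvg_unit_disc (sinc w al).
Proof. by move=> h; apply: (cvg_disc_le h); exact: norm_sinc_le. Qed.

Let cI : cvg_unit_disc (fun n => `|ipow 1 n : R|).
Proof. by rewrite norm_ipow; exact: cvg_disc_ipow. Qed.

Let cH : cvg_unit_disc (fun n => `|hpow 1 n : R|).
Proof. by rewrite norm_hpow; exact: cvg_disc_hpow. Qed.

Lemma mul_ipow1S n : n.+1%:R * ipow 1 n.+1 = 1 :> R.
Proof. by rewrite /ipow expr1 mulfV ?pnatr_eq0. Qed.

Lemma itv_unit r : `|r| < 1 -> -1 < r < 1 /\ -1 < (0 : R) < 1.
Proof. by rewrite ltr_norml => ->; rewrite ltrN10 ltr01. Qed.

Lemma logabs_psum r al : `|r| < 1 -> logabs r al = - psum (cosc (ipow 1) al) r.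
Proof.
move=> r1.
have h1 (x : R) : -1 < x < 1 -> is_derive x 1 (logabs ^~ al) ((x - cos al) / sqdist x al).
  by rewrite -ltr_norml; exact: is_derive_logabs.
have h2 (x : R) : -1 < x < 1 ->
    is_derive x 1 (fun x => - psum (cosc (ipow 1) al) x) ((x - cos al) / sqdist x al).
  rewrite -ltr_norml => x1.
  apply: is_derive_to (is_derive_opp (is_derive_psum (cvg_disc_cosc cI) x1)) _.
  rewrite (_ : pseries_diffs _ = fun n => cos (n.+1%:R * al)).
    by rewrite (psum_cos_sin al x1).1 -mulNr opprB.
  by apply/funext => n; rewrite /pseries_diffs /cosc mulrA mul_ipow1S mul1r.
have [r1' z1] := itv_unit r1.
have := eq_derive_itv h1 h2 r1' z1.
rewrite psum0 /cosc ipow0 mul0r oppr0 subr0 {2}/logabs /sqdist mulr0 mul0r subr0 expr0n addr0.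
by rewrite ln1 mul0r => /eqP; rewrite subr_eq0 => /eqP.
Qed.

Lemma argm_psum r al : `|r| < 1 -> argm r al = - psum (sinc (ipow 1) al) r.
Proof.
move=> r1.
have h1 (x : R) : -1 < x < 1 -> is_derive x 1 (argm ^~ al) (- sin al / sqdist x al).
  by rewrite -ltr_norml; exact: is_derive_argm.
have h2 (x : R) : -1 < x < 1 ->
    is_derive x 1 (fun x => - psum (sinc (ipow 1) al) x) (- sin al / sqdist x al).
  rewrite -ltr_norml => x1.
  apply: is_derive_to (is_derive_opp (is_derive_psum (cvg_disc_sinc cI) x1)) _.
  rewrite (_ : pseries_diffs _ = fun n => sin (n.+1%:R * al)).
    by rewrite (psum_cos_sin al x1).2 -mulNr.
  by apply/funext => n; rewrite /pseries_diffs /sinc mulrA mul_ipow1S mul1r.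
have [r1' z1] := itv_unit r1.
have := eq_derive_itv h1 h2 r1' z1.
rewrite psum0 /sinc ipow0 !mul0r oppr0 subr0 {2}/argm !mul0r atan0 oppr0.
by move=> /eqP; rewrite subr_eq0 => /eqP.
Qed.

Lemma cvg_disc_harmonic : cvg_unit_disc (fun n => `|series harmonic n : R|).
Proof.
have -> : (fun n => `|series harmonic n : R|) = pseries_diffs (hpow 1).
  by rewrite diffs_hpow1; apply/funext => n; rewrite ger0_norm// harmonic_sum_ge0.
by apply: cvg_unit_disc_diffs; exact: cvg_disc_hpow.
Qed.

(* The real part of [log^2 (1 - z)], [z = r e^(i al)]: [logabs] and [argm] are the real and
   imaginary parts of [log (1 - z)]. *)
Lemma sqr_log_psum r al : `|r| < 1 ->
  logabs r al ^+ 2 - argm r al ^+ 2 = 2 * psum (cosc (hpow 1) al) r.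
Proof.
move=> r1.
pose df x := 2 * (logabs x al * ((x - cos al) / sqdist x al) - argm x al * (- sin al / sqdist x al)).
have h1 (x : R) : -1 < x < 1 -> is_derive x 1 (fun x => logabs x al ^+ 2 - argm x al ^+ 2) (df x).
  rewrite -ltr_norml => x1.
  have d1 := is_derive_logabs al x1; have d2 := is_derive_argm al x1.
  derive_to.
    by derive_step; derive_step; [exact: d1|exact: d2].
  by rewrite /df /=; ring.
have h2 (x : R) : -1 < x < 1 -> is_derive x 1 (fun x => 2 * psum (cosc (hpow 1) al) x) (df x).
  rewrite -ltr_norml => x1.
  apply: is_derive_to (is_derive_mul (is_derive_const 2 x) (is_derive_psum (cvg_disc_cosc cH) x1)) _.
  rewrite mul0r add0r /df; congr (_ * _).
  have -> : pseries_diffs (cosc (hpow 1) al) = fun n => series harmonic n * cos (n.+1%:R * al).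
    by rewrite -diffs_hpow1; apply/funext => n; rewrite /pseries_diffs /cosc mulrA.
  (* The differentiated series has weights H_n, whose increments 1/(n+1) sum to the logarithm
     itself; the rotation equations thus express it through [logabs] and [argm]. *)
  have wS n : series harmonic n.+1 = series harmonic n + ipow 1 n.+1 :> R.
    by rewrite harmonic_sumS /ipow expr1.
  have w0 : series harmonic 0 = 0 :> R by rewrite /series /= big_geq.
  have ce : cvg_unit_disc (fun n => `|ipow 1 n.+1 : R|).
    apply: (@cvg_unit_disc_bounded _ _ 1) => n.
    by rewrite normr_id ger0_norm ?ipow_ge0// ipow_le1.
  have [] := psum_rot_eqs al x1 w0 wS cvg_disc_harmonic ce.
  have L0 : logabs x al = - (x * psum (fun n => ipow 1 n.+1 * cos (n.+1%:R * al)) x).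
    rewrite logabs_psum// psum_recl /cosc ?ipow0 ?mul0r ?add0r//.
    by apply: (cvg_disc_le ce) => // n; rewrite normrM ler_piMr// cos_max.
  have A0 : argm x al = - (x * psum (fun n => ipow 1 n.+1 * sin (n.+1%:R * al)) x).
    rewrite argm_psum// psum_recl /sinc ?ipow0 ?mul0r ?add0r//.
    by apply: (cvg_disc_le ce) => // n; rewrite normrM ler_piMr// sin_max.
  move: L0 A0; set C1 := psum _ x; set S1 := psum _ x; set X := psum _ x; set Y := psum _ x.
  rewrite !mul0r !add0r => L0 A0 EX EY.
  have EX' : X = - (cos al * logabs x al - sin al * argm x al) + x * (cos al * X - sin al * Y).
    by rewrite {1}EX L0 A0; ring.
  have EY' : Y = - (cos al * argm x al + sin al * logabs x al) + x * (cos al * Y + sin al * X).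
    by rewrite {1}EY L0 A0; ring.
  have [-> _] := solve_rotation x1 EX' EY'.
  rewrite mulrA [in RHS]mulrA -mulrBl; congr (_ / _).
  have := cos2Dsin2 al; move: (logabs x al) (argm x al) (cos al) (sin al) => l p c s E.
  transitivity (- c * l + s * p + x * l * (c ^+ 2 + s ^+ 2)); first by ring.
  by rewrite E; ring.
have [r1' z1] := itv_unit r1.
have := eq_derive_itv h1 h2 r1' z1.
have -> : logabs 0 al = 0.
  by rewrite /logabs /sqdist mulr0 mul0r subr0 expr0n addr0 ln1 mul0r.
have -> : argm 0 al = 0 by rewrite /argm !mul0r atan0 oppr0.
rewrite psum0 /cosc /hpow ipow0 mulr0 mul0r mulr0 expr0n !subr0.
by move=> /eqP; rewrite subr_eq0 => /eqP.
Qed.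

End LogFourier.

(** * Integrals over segments and passage to the limit under them *)

Section HasInt.
Context {R : realType}.
Implicit Types (f g F : R -> R) (a b x y v w : R) (m n : nat).
Notation mu := (@lebesgue_measure R).

(** Integrability travels with the value, so linear combinations and limits compose without side
    conditions. *)
Definition has_int a b f v :=
  mu.-integrable `[a, b] (EFin \o f) /\ (\int[mu]_(x in `[a, b]) (f x)%:E)%E = v%:E.

Lemma has_int_eq a b f g v w : has_int a b f v ->
  (forall x, a <= x <= b -> f x = g x) -> v = w -> has_int a b g w.
Proof.
move=> [fi fv] fg <-.
have E : {in [set` `[a, b]], (EFin \o f) =1 (EFin \o g)}.
  by move=> x; rewrite inE /= in_itv/= => xab; rewrite /= fg.
split; first by apply: eq_integrable fi => //.
by rewrite -fv; apply: eq_integral => x xab; have /= -> := E x xab.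
Qed.

Lemma has_int_unique a b f v w : has_int a b f v -> has_int a b f w -> v = w.
Proof. by move=> [_ fv] [_]; rewrite fv => -[]. Qed.

Lemma has_intD a b f g v w : has_int a b f v -> has_int a b g w ->
  has_int a b (fun x => f x + g x) (v + w).
Proof.
move=> [fi fv] [gi gw]; split.
  have -> : EFin \o (fun x => f x + g x) = ((EFin \o f) \+ (EFin \o g))%E by [].
  exact: integrableD.
by rewrite EFinD -fv -gw -(integralD _ fi gi)//; exact: measurable_itv.
Qed.

Lemma has_intZ a b f v (k : R) : has_int a b f v -> has_int a b (fun x => k * f x) (k * v).
Proof.
move=> [fi fv]; split.
  have -> : EFin \o (fun x => k * f x) = (fun x => k%:E * (EFin \o f) x)%E by [].
  exact: integrableZl.
by rewrite EFinM -fv -(integralZl _ fi)//; exact: measurable_itv.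
Qed.

Lemma has_intB a b f g v w : has_int a b f v -> has_int a b g w ->
  has_int a b (fun x => f x - g x) (v - w).
Proof.
move=> hf hg; apply: (has_int_eq (has_intD hf (has_intZ (-1) hg))) => [x _|];
  by rewrite mulN1r.
Qed.

Lemma has_int0 a b : has_int a b (fun=> 0) 0.
Proof.
split; first exact: integrable0.
exact: integral0.
Qed.

Lemma has_int_sum a b (f_ : nat -> R -> R) (v_ : nat -> R) n :
  (forall k, has_int a b (f_ k) (v_ k)) ->
  has_int a b (fun x => series (f_ ^~ x) n) (series v_ n).
Proof.
move=> hf; elim: n => [|n IH].
  by apply: (has_int_eq (has_int0 a b)) => [x _|]; rewrite /series /= big_geq.
by apply: (has_int_eq (has_intD IH (hf n))) => [x _|]; rewrite seriesSr.
Qed.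

Lemma has_int_FTC a b F f : a < b ->
  {within `[a, b], continuous f} -> {within `[a, b], continuous F} ->
  (forall x, a < x < b -> is_derive x 1 F (f x)) -> has_int a b f (F b - F a).
Proof.
move=> ab cf /(continuous_within_itvP _ ab)[_ Fa Fb] dF; split.
  by apply: continuous_compact_integrable => //; exact: segment_compact.
rewrite (continuous_FTC2 ab cf (F := F))//.
  split => // x; rewrite in_itv/= => xab.
  exact: (@ex_derive _ _ _ _ _ _ _ (dF x xab)).
move=> x; rewrite in_itv/= => xab; rewrite derive1E.
exact: (@derive_val _ _ _ _ _ _ _ (dF x xab)).
Qed.

(** Differentiability of the integrand supplies the continuity required by the fundamental
    theorem. *)
Lemma has_int_antiderivative a b F f f' : a < b ->
  (forall x, is_derive x 1 F (f x)) -> (forall x, is_derive x 1 f (f' x)) ->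
  has_int a b f (F b - F a).
Proof.
move=> ab dF df; apply: has_int_FTC => //.
- by apply: continuous_subspaceT => x; exact: is_derive_continuous (df x).
- by apply: continuous_subspaceT => x; exact: is_derive_continuous (dF x).
Qed.

(** On a segment constants are integrable, so a uniform bound serves as dominating function. *)
Lemma has_int_dominated a b (f_ : nat -> R -> R) f (v_ : nat -> R) v (M : R) : a <= b ->
  (forall n, has_int a b (f_ n) (v_ n)) ->
  (forall n x, a <= x <= b -> `|f_ n x| <= M) ->
  (forall x, a <= x <= b -> f_ n x @[n --> \oo] --> f x) ->
  v_ @ \oo --> v -> has_int a b f v.
Proof.
move=> ab hf hM hc cv.
have mD : measurable ([set` `[a, b]]) by exact: measurable_itv.
have mf n := measurable_int mu (hf n).1.
have cE x : `[a, b]%classic x -> (EFin \o f_ n) x @[n --> \oo] --> (EFin \o f) x.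
  by rewrite /= in_itv/= => xab; apply: cvg_EFin; [exact: nearW|exact: hc].
have [||||i1 _ i2] := @dominated_convergence _ _ R mu _ mD (fun n => EFin \o f_ n) (EFin \o f)
  (EFin \o cst M) mf.
- exact: (emeasurable_fun_cvg _ _ mf cE).
- exact: aeW.
- apply: continuous_compact_integrable; first exact: segment_compact.
  by apply: continuous_subspaceT => x; exact: cst_continuous.
- by apply: aeW => x n /=; rewrite in_itv/= => xab; rewrite lee_fin hM.
split => //.
have i3 : (fun n => (v_ n)%:E) @ \oo --> v%:E by apply: cvg_EFin => //; exact: nearW.
have E : (fun n => (v_ n)%:E) = [sequence (\int[mu]_(x in `[a, b]) (EFin \o f_ n) x)%E]_n.
  by apply/funext => n; have [_ <-] := hf n.
rewrite E in i3; exact: (cvg_unique _ i2 i3).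
Qed.

Lemma has_int_series a b (f_ : nat -> R -> R) (v_ M : nat -> R) : a <= b ->
  (forall n, has_int a b (f_ n) (v_ n)) ->
  (forall n x, a <= x <= b -> `|f_ n x| <= M n) -> cvgn (series M) -> cvgn (series v_) ->
  has_int a b (fun x => limn (series (f_ ^~ x))) (limn (series v_)).
Proof.
move=> ab hf hM cM cv.
have M0 n : 0 <= M n by apply: le_trans (hM n a _); rewrite ?lexx ?ab.
apply: (@has_int_dominated a b (fun n x => series (f_ ^~ x) n) _ (series v_) _ (limn (series M))) => //.
- by move=> n; exact: has_int_sum.
- move=> n x xab; apply: (@le_trans _ _ (series M n)).
    by apply: le_trans (ler_norm_sum _ _ _) _; apply: ler_sum => k _; exact: hM.
  by apply: nondecreasing_cvgn_le => //; apply/nondecreasing_seqP => k; rewrite seriesSr lerDl.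
- by move=> x xab; apply: (is_cvg_series_dom cM) => n; exact: hM.
Qed.

Lemma is_derive_sinM (k x : R) : is_derive x 1 (fun y => sin (k * y)) (k * cos (k * x)).
Proof.
have dk : is_derive x 1 (fun y : R => k * y) k.
  by derive_to; [do !derive_step|rewrite /=; ring].
by apply: is_derive_to (is_derive_compose (is_derive_sin _) dk) _; rewrite mulrC.
Qed.

Lemma is_derive_cosM (k x : R) : is_derive x 1 (fun y => cos (k * y)) (- (k * sin (k * x))).
Proof.
have dk : is_derive x 1 (fun y : R => k * y) k.
  by derive_to; [do !derive_step|rewrite /=; ring].
by apply: is_derive_to (is_derive_compose (is_derive_cos _) dk) _; ring.
Qed.

Lemma cos_natpi n : cos (n%:R * pi) = (-1) ^+ n :> R.
Proof.
elim: n => [|n IH]; first by rewrite mul0r cos0.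
by rewrite -natr1 mulrDl mul1r cosDpi IH exprS mulN1r.
Qed.

Lemma sin_natpi n : sin (n%:R * pi) = 0 :> R.
Proof.
elim: n => [|n IH]; first by rewrite mul0r sin0.
by rewrite -natr1 mulrDl mul1r sinDpi IH oppr0.
Qed.

End HasInt.

(** * The integral [I], zeta(2) and zeta(4) as Abel limits *)

Section LogSine.
Context {R : realType}.
Implicit Types (c w u : nat -> R) (r t x : R) (m n k : nat).

Notation h := (pi / 2 : R).

Let h0 : 0 < h.
Proof. by rewrite divr_gt0// pi_gt0. Qed.

(** The sequence starts at 1/2: the lower bound on [sqdist] uses that the radius stays away from
    0. *)
Definition radius k : R := 1 - k.+2%:R^-1.

Lemma radius_itv k : 2^-1 <= radius k < 1.
Proof.
rewrite /radius gtrBl invr_gt0 ltr0n andbT.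
have : k.+2%:R^-1 <= 2^-1 :> R by rewrite lef_pV2 ?posrE// ler_nat.
by move: (_^-1) => z; lra.
Qed.

Lemma norm_radius k : `|radius k| < 1.
Proof. by have /andP[? ?] := radius_itv k; rewrite ger0_norm//; lra. Qed.

Lemma cvg_radius : radius @ \oo --> (1 : R).
Proof.
rewrite -[X in _ --> X]subr0; apply: cvgB; first exact: cvg_cst.
by have := @cvg_harmonic R; rewrite -cvg_shiftS.
Qed.

Lemma psumM (a : R) c r : cvgn (pseries c r) ->
  limn (series (fun n => a * (c n * r ^+ n))) = a * psum c r.
Proof.
move=> cc; apply/cvg_lim => //.
rewrite (_ : series _ = fun n => a * pseries c r n); first exact: cvgMr.
by apply/funext => n; rewrite /series /= mulr_sumr.
Qed.

Lemma has_int_psum a b p (T : nat -> R -> R) u r P B : a <= b -> `|r| < 1 ->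
  (forall t, a <= t <= b -> `|p t| <= P) -> (forall n t, `|T n t| <= 1) ->
  (forall n, `|u n| <= B) ->
  (forall n, has_int a b (fun t => p t * T n t) (u n)) ->
  has_int a b (fun t => p t * psum (T ^~ t) r) (psum u r).
Proof.
move=> ab r1 pP T1 uB hu.
have P0 : 0 <= P by apply: le_trans (pP a _); rewrite ?lexx.
have r1' : `|(`|r|)| < 1 by rewrite normr_id.
have := @has_int_series R a b (fun n t => p t * (T n t * r ^+ n)) (fun n => u n * r ^+ n)
  (geometric P `|r|) ab.
case=> [n|n t tab|||H1 H2].
- by apply: (has_int_eq (has_intZ (r ^+ n) (hu n))) => [t _|]; ring.
- rewrite !normrM normrX /= ler_pM// ?mulr_ge0 ?exprn_ge0//; first exact: pP.
  by rewrite ler_piMl// exprn_ge0.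
- exact: is_cvg_geometric_series.
- exact: (cvg_unit_disc_bounded uB r1).
- apply: (has_int_eq (conj H1 H2)) => // t tab.
  by rewrite psumM//; exact: (cvg_unit_disc_bounded (fun n => T1 n t) r1).
Qed.

(** At each radius below 1 a geometric factor justifies termwise integration. Then [psum_abel]
    carries the values to radius 1, and the bound [Q], uniform in the radius, carries the
    integrands. *)
Lemma has_int_abel a b p (T : nat -> R -> R) u f P Q : a <= b ->
  (forall t, a <= t <= b -> `|p t| <= P) -> (forall n t, `|T n t| <= 1) ->
  (forall n, has_int a b (fun t => p t * T n t) (u n)) ->
  cvgn (series (fun n => `|u n|)) ->
  (forall k t, a <= t <= b -> `|p t * psum (T ^~ t) (radius k)| <= Q) ->
  (forall t, a <= t <= b -> p t * psum (T ^~ t) (radius k) @[k --> \oo] --> f t) ->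
  has_int a b f (limn (series u)).
Proof.
move=> ab pP T1 hu cu hQ hf.
have [B uB] : exists B, forall n, `|u n| <= B.
  have [K [_ Kf]] := cvg_series_bounded cu.
  exists (K + 1) => n; rewrite -[leLHS]normr_id; apply: Kf => //.
  by rewrite ltrDl.
apply: (@has_int_dominated R a b (fun k t => p t * psum (T ^~ t) (radius k)) f
  (fun k => psum u (radius k)) _ Q) => //.
- move=> k; exact: (has_int_psum ab (norm_radius k) pP T1 uB hu).
- apply: psum_abel => //; last exact: cvg_radius.
  by move=> k; exact: ltW (norm_radius k).
Qed.

Lemma has_int_mul_cos n : has_int 0 h (fun t => t * cosc (hpow 1) (2 * t) n)
  (4^-1 * (alt (hpow 3) n - hpow 3 n)).
Proof.
have [->|n0] := posnP n.
  apply: (has_int_eq (has_int0 0 h)) => [t _|]; rewrite /alt /cosc /hpow !ipow0; ring.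
pose k : R := n%:R * 2.
have kn0 : n%:R != 0 :> R by rewrite pnatr_eq0 -lt0n.
have k0 : k != 0 by rewrite mulf_neq0.
have dF t : is_derive t 1 (fun t => t * sin (k * t) / k + cos (k * t) / k ^+ 2) (t * cos (k * t)).
  have ds := is_derive_sinM k t; have dc := is_derive_cosM k t.
  by derive_to; [do !derive_step|rewrite /=; field].
have df t : is_derive t 1 (fun t => t * cos (k * t)) (cos (k * t) - t * (k * sin (k * t))).
  have dc := is_derive_cosM k t.
  by derive_to; [do !derive_step|rewrite /=; ring].
apply: (has_int_eq (has_intZ (hpow 1 n) (has_int_antiderivative h0 dF df))) => [t _|].
  by rewrite /cosc (mulrA n%:R) -/k; ring.
have kh : k * h = n%:R * pi by rewrite /k; field.
rewrite !kh cos_natpi sin_natpi !mulr0 cos0 sin0 /alt /hpow /ipow /k.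
by field.
Qed.

Lemma has_int_mul_sin n : has_int 0 h (fun t => t * sinc (ipow 1) (2 * t) n)
  (- (pi / 4) * alt (ipow 2) n).
Proof.
have [->|n0] := posnP n.
  apply: (has_int_eq (has_int0 0 h)) => [t _|]; rewrite /alt /sinc !ipow0; ring.
pose k : R := n%:R * 2.
have kn0 : n%:R != 0 :> R by rewrite pnatr_eq0 -lt0n.
have k0 : k != 0 by rewrite mulf_neq0.
have dF t : is_derive t 1 (fun t => sin (k * t) / k ^+ 2 - t * cos (k * t) / k) (t * sin (k * t)).
  have ds := is_derive_sinM k t; have dc := is_derive_cosM k t.
  by derive_to; [do !derive_step|rewrite /=; field].
have df t : is_derive t 1 (fun t => t * sin (k * t)) (sin (k * t) + t * (k * cos (k * t))).
  have dc := is_derive_sinM k t.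
  by derive_to; [do !derive_step|rewrite /=; ring].
apply: (has_int_eq (has_intZ (ipow 1 n) (has_int_antiderivative h0 dF df))) => [t _|].
  by rewrite /sinc (mulrA n%:R) -/k; ring.
have kh : k * h = n%:R * pi by rewrite /k; field.
rewrite !kh cos_natpi sin_natpi !mulr0 cos0 sin0 /alt /ipow /k.
by field.
Qed.

Lemma has_int_parabola_sin n : has_int 0 h (fun t => (t * (h - t)) * sinc (ipow 1) (2 * t) n)
  (4^-1 * (ipow 4 n - alt (ipow 4) n)).
Proof.
have [->|n0] := posnP n.
  apply: (has_int_eq (has_int0 0 h)) => [t _|]; rewrite /alt /sinc !ipow0; ring.
pose k : R := n%:R * 2.
have kn0 : n%:R != 0 :> R by rewrite pnatr_eq0 -lt0n.
have k0 : k != 0 by rewrite mulf_neq0.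
have dF t : is_derive t 1 (fun t => (h - 2 * t) * sin (k * t) / k ^+ 2
    - t * (h - t) * cos (k * t) / k - 2 * cos (k * t) / k ^+ 3) (t * (h - t) * sin (k * t)).
  have ds := is_derive_sinM k t; have dc := is_derive_cosM k t.
  by derive_to; [do !derive_step|rewrite /=; field].
have df t : is_derive t 1 (fun t => t * (h - t) * sin (k * t))
    ((h - 2 * t) * sin (k * t) + t * (h - t) * (k * cos (k * t))).
  have dc := is_derive_sinM k t.
  by derive_to; [do !derive_step|rewrite /=; ring].
apply: (has_int_eq (has_intZ (ipow 1 n) (has_int_antiderivative h0 dF df))) => [t _|].
  by rewrite /sinc (mulrA n%:R) -/k; ring.
have kh : k * h = n%:R * pi by rewrite /k; field.
rewrite !kh cos_natpi sin_natpi !mulr0 cos0 sin0 /alt /ipow /k.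
by field.
Qed.

Lemma argm_bound r t : `|argm r t| <= h.
Proof. by rewrite /argm normrN ler_norml; rewrite !ltW ?atan_gtNpi2 ?atan_ltpi2. Qed.

Lemma sin_half_pos t : 0 < t <= h -> 0 < sin t.
Proof.
move=> /andP[t0 th]; apply: sin_gt0_pi; rewrite t0 (le_lt_trans th)//.
by have := @pi_gt0 R; lra.
Qed.

Lemma cos2M t : cos (2 * t) = 1 - 2 * sin t ^+ 2 :> R.
Proof. by rewrite mulr_natl cos_mulr2n cos2sin2; ring. Qed.

Lemma sin2M t : sin (2 * t) = 2 * sin t * cos t :> R.
Proof. by rewrite mulr_natl sin_mulr2n; ring. Qed.

Lemma atan_cot t : 0 < t <= h -> atan (cos t / sin t) = h - t.
Proof.
move=> th; have s0 := sin_half_pos th.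
have -> : cos t / sin t = tan (h - t).
  by rewrite /tan sinB cosB sin_pihalf cos_pihalf !mul0r !mul1r subr0 add0r.
rewrite tanK// in_itv/=; move: th; have := @pi_gt0 R; lra.
Qed.

(** On the circle, 1 - e^(2it) has argument t - pi/2 for 0 < t. At t = 0 [argm] is 0 instead; the
    factor [t] makes one formula valid on the closed interval. *)
Lemma cvg_argm t : 0 <= t <= h -> t * argm (radius k) (2 * t) @[k --> \oo] --> - (t * (h - t)).
Proof.
move=> /andP[]; rewrite le_eqVlt => /predU1P[<- _|t0 th].
  by under eq_fun do rewrite mul0r; rewrite mul0r oppr0; exact: cvg_cst.
have th' : 0 < t <= h by rewrite t0.
rewrite -mulrN; apply: cvgMr; apply: cvgN.
rewrite -(atan_cot th').
have s0 := sin_half_pos th'.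
apply: (@continuous_cvg _ _ _ _ _ _ (@atan R)); first exact: continuous_atan.
have -> : cos t / sin t = 1 * sin (2 * t) / (1 - 1 * cos (2 * t)).
  rewrite cos2M sin2M !mul1r (_ : 1 - (1 - 2 * sin t ^+ 2) = 2 * sin t ^+ 2); last by ring.
  by field; rewrite gt_eqF.
have cr := cvg_radius.
have C (a : R) : a @[_ --> \oo] --> a by exact: cvg_cst.
apply: cvgM; first by apply: cvgM.
apply: cvgV; first by rewrite cos2M gt_eqF// (_ : _ - _ = 2 * sin t ^+ 2); [rewrite mulr_gt0 ?exprn_gt0|ring].
by apply: cvgB => //; apply: cvgM.
Qed.

Lemma cvg_argmN t : 0 <= t <= h -> - (t * argm (radius k) (2 * t)) @[k --> \oo] --> t * (h - t).
Proof.
by move=> th; rewrite -[X in _ --> X]opprK; apply: cvgN; exact: cvg_argm.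
Qed.

Lemma has_int_parabola : has_int 0 h (fun t => t * (h - t)) (h ^+ 3 / 6).
Proof.
have dF t : is_derive t 1 (fun t => h * t ^+ 2 / 2 - t ^+ 3 / 3) (t * (h - t)).
  by derive_to; [do !derive_step|rewrite /=; field].
have df t : is_derive t 1 (fun t => t * (h - t)) (h - 2 * t).
  by derive_to; [do !derive_step|rewrite /=; ring].
by apply: (has_int_eq (has_int_antiderivative h0 dF df)) => // ; field.
Qed.

Lemma has_int_cubic : has_int 0 h (fun t => t * (h - t) ^+ 2) (h ^+ 4 / 12).
Proof.
have dF t : is_derive t 1 (fun t => h ^+ 2 * t ^+ 2 / 2 - 2 * h * t ^+ 3 / 3 + t ^+ 4 / 4) (t * (h - t) ^+ 2).
  by derive_to; [do !derive_step|rewrite /=; field].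
have df t : is_derive t 1 (fun t => t * (h - t) ^+ 2) ((h - t) ^+ 2 - 2 * t * (h - t)).
  by derive_to; [do !derive_step|rewrite /=; ring].
by apply: (has_int_eq (has_int_antiderivative h0 dF df)) => // ; field.
Qed.

Lemma norm_ipow_le1 n : `|ipow 1 n : R| <= 1.
Proof. by rewrite ger0_norm ?ipow_ge0// ipow_le1. Qed.

Lemma limn_seriesZ (a : R) c : cvgn (series c) ->
  limn (series (fun n => a * c n)) = a * limn (series c).
Proof.
move=> cc; apply/cvg_lim => //.
rewrite (_ : series _ = fun n => a * series c n); first exact: cvgMr.
by apply/funext => n; rewrite /series /= mulr_sumr.
Qed.

Lemma is_cvg_series_normZ (a : R) c : cvgn (series (fun n => `|c n|)) ->
  cvgn (series (fun n => `|a * c n|)).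
Proof.
move=> cc; rewrite (_ : series _ = fun n => `|a| * series (fun n => `|c n|) n).
  exact: is_cvgMr.
by apply/funext => n; rewrite /series /= mulr_sumr; apply: eq_bigr => k _; rewrite normrM.
Qed.

Lemma norm_sinc_le1 t n : `|sinc (ipow 1) t n : R| <= 1.
Proof. by apply: le_trans (norm_sinc_le _ _ _) _; exact: norm_ipow_le1. Qed.

Lemma norm_cosc_le1 t n : `|cosc (hpow 1) t n : R| <= 1.
Proof.
by apply: le_trans (norm_cosc_le _ _ _) _; rewrite ger0_norm ?hpow_ge0// hpow_le1.
Qed.

Lemma psum_sinc_radius k t : psum (sinc (ipow 1) t) (radius k) = - argm (radius k) t.
Proof. by rewrite argm_psum ?norm_radius// opprK. Qed.

(** The sine expansion of pi/2 - t is integrated against [t]: termwise it gives - pi/4 times the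
    series, directly h^3 / 6. *)
Lemma lim_alt_ipow2 : limn (series (alt (ipow 2))) = - (pi ^+ 2 / 12) :> R.
Proof.
have c2 : cvgn (series (fun n => `|- (pi / 4) * alt (ipow 2) n| : R)).
  by apply: is_cvg_series_normZ; rewrite norm_alt_fun norm_ipow; exact: cvg_series_ipow.
have H : has_int 0 h (fun t => t * (h - t)) (limn (series (fun n => - (pi / 4) * alt (ipow 2) n))).
  apply: (@has_int_abel 0 h id (fun n t => sinc (ipow 1) (2 * t) n) _ _ h (h * h) (ltW h0)) => //.
  - by move=> t /andP[t0 th]; rewrite ger0_norm.
  - by move=> n t; exact: norm_sinc_le1.
  - exact: has_int_mul_sin.
  - move=> k t /andP[t0 th]; rewrite psum_sinc_radius normrM normrN ger0_norm//.
    by rewrite ler_pM// argm_bound.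
  - by move=> t tab; under eq_fun do rewrite psum_sinc_radius mulrN; exact: cvg_argmN.
have := has_int_unique H has_int_parabola.
rewrite limn_seriesZ; last exact: cvg_alt_ipow.
have p0 := @pi_gt0 R; move=> E; apply: (@mulfI _ (- (pi / 4))).
  by rewrite oppr_eq0 gt_eqF// divr_gt0.
by rewrite E; field.
Qed.

Lemma lim_ipow2 : limn (series (ipow 2)) = pi ^+ 2 / 6 :> R.
Proof.
have := @lim_alt_ipow R 0; rewrite lim_alt_ipow2.
have -> : 2^-1 ^+ 2 = 4^-1 :> R by field.
by move: (pi ^+ 2) (limn _) => p z; lra.
Qed.

(** The same scheme with the weight [t * (h - t)], whose sine coefficients are of order 1/n^3. It
    yields zeta(4) minus its alternating version, and [lim_alt_ipow] separates the two. *)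
Lemma lim_ipow4 : limn (series (ipow 4)) = pi ^+ 4 / 90 :> R.
Proof.
have c4 := @cvg_series_ipow R 2; have a4 := @cvg_alt_ipow R 2.
have c2 : cvgn (series (fun n => `|4^-1 * (ipow 4 n - alt (ipow 4) n)| : R)).
  apply: is_cvg_series_normZ.
  have c8 : cvgn (series (fun n => 2 * ipow 4 n : R)).
    rewrite (_ : series _ = fun n => 2 * series (ipow 4) n); first exact: is_cvgMr.
    by apply/funext => n; rewrite /series /= mulr_sumr.
  apply: (is_cvg_series_dom c8) => n; rewrite normr_id.
  apply: le_trans (ler_normB _ _) _; rewrite norm_alt ger0_norm ?ipow_ge0//.
  by rewrite mulr_natl mulr2n.
have H : has_int 0 h (fun t => t * (h - t) * (h - t))
    (limn (series (fun n => 4^-1 * (ipow 4 n - alt (ipow 4) n)))).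
  apply: (@has_int_abel 0 h (fun t => t * (h - t)) (fun n t => sinc (ipow 1) (2 * t) n) _ _
    (h * h) (h * h * h) (ltW h0)) => //.
  - move=> t /andP[t0 th]; rewrite ger0_norm ?mulr_ge0 ?subr_ge0//.
    by rewrite ler_pM ?subr_ge0// gerBl.
  - by move=> n t; exact: norm_sinc_le1.
  - exact: has_int_parabola_sin.
  - move=> k t /andP[t0 th]; rewrite psum_sinc_radius normrM normrN ler_pM//.
      rewrite ger0_norm ?mulr_ge0 ?subr_ge0//.
      by rewrite ler_pM ?subr_ge0// gerBl.
    exact: argm_bound.
  - move=> t tab; under eq_fun do rewrite psum_sinc_radius mulrN mulrAC -mulNr.
    by apply: cvgMl; exact: cvg_argmN.
have H' : has_int 0 h (fun t => t * (h - t) * (h - t)) (h ^+ 4 / 12).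
  by apply: (has_int_eq has_int_cubic) => // t _; ring.
have := has_int_unique H H'; rewrite limn_seriesZ; last exact: is_cvg_seriesB.
have -> : limn (series (fun n => ipow 4 n - alt (ipow 4) n)) =
   limn (series (ipow 4)) - limn (series (alt (ipow 4))) :> R by exact: lim_seriesB.
have := @lim_alt_ipow R 2.
have -> : h ^+ 4 = pi ^+ 4 / 16 :> R by field.
have -> : 2^-1 ^+ 4 = 16^-1 :> R by field.
by move: (pi ^+ 4) (limn _) (limn _) => p z w; lra.
Qed.

Lemma sin_ge_mul_cos t : 0 <= t <= pi -> t * cos t <= sin t.
Proof.
move=> /andP[t0 tp].
have df (x : R) : is_derive x 1 (fun x => sin x - x * cos x) (x * sin x).
  have ds := is_derive_sin x; have dc := is_derive_cos x.
  by derive_to; [derive_step; [exact: ds|derive_step; [exact: is_derive_var|exact: dc]]|rewrite /=; ring].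
have : {within `[0, t], continuous (fun x : R => sin x - x * cos x)}.
  by apply: continuous_subspaceT => x; exact: is_derive_continuous (df x).
move=> C; have [c] := MVT_segment t0 (fun x _ => df x) C.
rewrite in_itv/= => /andP[c0 ct]; rewrite mul0r sin0 !subr0 => E.
rewrite -subr_ge0 E !mulr_ge0// sin_ge0_pi// c0/=; exact: le_trans tp.
Qed.

(** Half angles: sin t = 2 sin(t/2) cos(t/2) >= t cos(t/2)^2 = t (1 + cos t) / 2. *)
Lemma sin_ge_half t : 0 <= t <= h -> t / 2 <= sin t.
Proof.
move=> /andP[t0 th]; have p0 := @pi_gt0 R.
have E : t = 2 * (t / 2) by field.
have c0 : 0 <= cos (t / 2) by apply: cos_ge0_pihalf; lra.
have ct : 0 <= cos t by apply: cos_ge0_pihalf; lra.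
have h1 : t / 2 * cos (t / 2) <= sin (t / 2) by apply: sin_ge_mul_cos; lra.
have h2 : cos t = 2 * cos (t / 2) ^+ 2 - 1 by rewrite [in LHS]E cos2M sin2cos2; ring.
rewrite [in leRHS]E sin2M -mulrA.
have : t / 2 * cos (t / 2) ^+ 2 <= sin (t / 2) * cos (t / 2).
  by rewrite expr2 mulrA; exact: ler_wpM2r.
have : 0 <= t * cos t by exact: mulr_ge0.
rewrite h2.
by move: (cos (t / 2) ^+ 2) (sin (t / 2) * cos (t / 2)) => a b; lra.
Qed.

(** Domination for the log-sine limit: [y] stands for [sqdist] at angle [2 * t], which is at least
    of order t^2. For y >= 1, ln y <= y - 1 <= 3 accounts for the term [9 * h]. *)
Lemma mul_sqr_ln_bound t (y : R) : 0 <= t <= h -> t ^+ 2 / 2 <= y -> 0 < y <= 4 ->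
  t * ln y ^+ 2 <= 7 + 9 * h.
Proof.
move=> /andP[t0 th] ty /andP[y0 y4].
have [y1|y1] := leP 1 y.
  have l0 : 0 <= ln y by exact: ln_ge0.
  have l3 : ln y <= 3.
    by have := @le_ln1Dx R (y - 1); rewrite addrCA subrr addr0 => /(_ _); lra.
  have : t * ln y ^+ 2 <= h * 3 ^+ 2 by rewrite ler_pM// ?exprn_ge0// lerXn2r// nnegrE.
  have := h0; rewrite expr2; move: h => z; lra.
set x := - ln y.
have x0 : 0 <= x by rewrite oppr_ge0 ln_le0// ltW.
have yE : y = (expR x)^-1 by rewrite -expRN /x opprK lnK.
have yx : y * x ^+ 4 <= 24.
  rewrite yE mulrC ler_pdivrMr ?expR_gt0//.
  have := expR_ge1Dxn 3 x0; rewrite !factS fact0 !muln1; lra.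
have -> : ln y ^+ 2 = x ^+ 2 by rewrite sqrrN.
(* Squared: (t x^2)^2 <= 2 y x^4 <= 48 < 7^2, where y x^4 <= 24 comes from the quartic term of the
   exponential. *)
have : t * x ^+ 2 <= 7.
  rewrite -(@ler_pXn2r _ 2)// ?nnegrE ?mulr_ge0 ?exprn_ge0//.
  rewrite exprMn -exprM.
  have : t ^+ 2 * x ^+ 4 <= 2 * y * x ^+ 4.
    by rewrite ler_wpM2r ?exprn_ge0//; lra.
  by rewrite -mulrA /=; lra.
have := h0; lra.
Qed.

Lemma sqdist_radius k t : 0 <= t <= h ->
  t ^+ 2 / 2 <= sqdist (radius k) (2 * t) /\ 0 < sqdist (radius k) (2 * t) <= 4.
Proof.
move=> th; have /andP[r0 r1] := radius_itv k.
(* In this form the lower bound follows from 4r >= 2 and sin t >= t / 2, and the upper one from (1 -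
   r)^2 + 4r = (1 + r)^2. *)
have -> : sqdist (radius k) (2 * t) = (1 - radius k) ^+ 2 + 4 * radius k * sin t ^+ 2.
  by rewrite /sqdist cos2M; ring.
have s2 := sin_ge_half th; move/andP: th => [t0 th].
have s4 : sin t ^+ 2 <= 1 by rewrite sin2cos2 gerBl sqr_ge0.
have s5 : t ^+ 2 / 4 <= sin t ^+ 2.
  rewrite (_ : t ^+ 2 / 4 = (t / 2) ^+ 2); last by field.
  by rewrite lerXn2r// nnegrE; lra.
have s6 := sqr_ge0 (sin t).
move: (radius k) (sin t ^+ 2) s4 s5 s6 r0 r1 => r s s4 s5 s6 r0 r1.
have q0 : 0 < (1 - r) ^+ 2 by rewrite exprn_gt0//; lra.
split; first by nra.
by apply/andP; split; nra.
Qed.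

Lemma cvg_logabs t : 0 <= t <= h ->
  t * logabs (radius k) (2 * t) ^+ 2 @[k --> \oo] --> t * ln (2 * sin t) ^+ 2.
Proof.
move=> /andP[]; rewrite le_eqVlt => /predU1P[<- _|t0 th].
  by under eq_fun do rewrite mul0r; rewrite mul0r; exact: cvg_cst.
have th' : 0 < t <= h by rewrite t0.
have s0 := sin_half_pos th'.
have s20 : 0 < 2 * sin t by rewrite mulr_gt0.
have -> : ln (2 * sin t) = ln ((2 * sin t) ^+ 2) / 2.
  by rewrite lnXn//; field.
apply: cvgMr.
have C (a : R) : a @[_ --> \oo] --> a by exact: cvg_cst.
have cr := cvg_radius.
have cl : logabs (radius k) (2 * t) @[k --> \oo] --> ln ((2 * sin t) ^+ 2) / 2.
  apply: cvgM => //; apply: (@continuous_cvg _ _ _ _ _ _ (@ln R)).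
    by apply: continuous_ln; rewrite exprn_gt0.
  rewrite [X in _ --> X](_ : _ = 1 - 2 * 1 * cos (2 * t) + 1 * 1); last by rewrite cos2M; ring.
  by apply: cvgD; [apply: cvgB => //; apply: cvgM => //; apply: cvgM|apply: cvgM].
exact: (cvgM cl cl).
Qed.

Lemma has_int_log_sine : has_int 0 h (fun t => t * ln (2 * sin t) ^+ 2)
  (2^-1 * (limn (series (alt (hpow 3))) - limn (series (hpow 3))) + pi ^+ 4 / 192).
Proof.
have h4 := @cvg_series_hpow R 1; have a4 := @cvg_alt_hpow R 1.
have c2 : cvgn (series (fun n => `|4^-1 * (alt (hpow 3) n - hpow 3 n)| : R)).
  apply: is_cvg_series_normZ.
  have c8 : cvgn (series (fun n => 2 * hpow 3 n : R)).
    rewrite (_ : series _ = fun n => 2 * series (hpow 3) n); first exact: is_cvgMr.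
    by apply/funext => n; rewrite /series /= mulr_sumr.
  apply: (is_cvg_series_dom c8) => n; rewrite normr_id.
  apply: le_trans (ler_normB _ _) _; rewrite norm_alt ger0_norm ?hpow_ge0//.
  by rewrite mulr_natl mulr2n.
have E k t : t * psum (cosc (hpow 1) (2 * t)) (radius k) =
    2^-1 * (t * logabs (radius k) (2 * t) ^+ 2 -
      t * argm (radius k) (2 * t) * argm (radius k) (2 * t)).
  have := sqr_log_psum (2 * t) (norm_radius k).
  by move=> F; rewrite -mulrA -mulrBr -expr2 F; field.
have H : has_int 0 h (fun t => 2^-1 * (t * ln (2 * sin t) ^+ 2 - t * (h - t) ^+ 2))
    (limn (series (fun n => 4^-1 * (alt (hpow 3) n - hpow 3 n)))).
  apply: (@has_int_abel 0 h id (fun n t => cosc (hpow 1) (2 * t) n) _ _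
    h (2^-1 * ((7 + 9 * h) / 4 + h * h * h)) (ltW h0)) => //.
  - by move=> t /andP[t0 th]; rewrite ger0_norm.
  - by move=> n t; exact: norm_cosc_le1.
  - exact: has_int_mul_cos.
  - move=> k t tab; rewrite E normrM ger0_norm// ler_wpM2l//.
    apply: le_trans (ler_normB _ _) _; have [q1 q2] := sqdist_radius k tab.
    have /andP[t0 th] := tab; apply: lerD.
      rewrite ger0_norm; last by apply: mulr_ge0 => //; exact: sqr_ge0.
      rewrite /logabs.
      rewrite (_ : t * _ ^+ 2 = t * ln (sqdist (radius k) (2 * t)) ^+ 2 / 4); last by field.
      by apply: ler_wpM2r => //; exact: mul_sqr_ln_bound.
    by rewrite !normrM !ler_pM ?mulr_ge0 ?argm_bound// ger0_norm.
  - move=> t tab; under eq_fun do rewrite E.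
    apply: cvgMr; apply: cvgB; first exact: cvg_logabs.
    have /andP[] := tab; rewrite le_eqVlt => /predU1P[<- _|t0 th].
      by under eq_fun do rewrite !mul0r; rewrite mul0r; exact: cvg_cst.
    have ca := cvg_argm tab.
    (* Only [t * argm] has a known limit, so the term with [argm] squared is written as the square
       of that product divided by [t]. *)
    have -> : t * (h - t) ^+ 2 = t^-1 * (- (t * (h - t)) * - (t * (h - t))).
      by field; rewrite gt_eqF.
    have E2 k : t * argm (radius k) (2 * t) * argm (radius k) (2 * t) =
        t^-1 * (t * argm (radius k) (2 * t) * (t * argm (radius k) (2 * t))).
      by field; rewrite gt_eqF.
    by under eq_fun do rewrite E2; apply: cvgMr; apply: cvgM.
(* Adding back the contribution of the argument, h^4 / 12 = pi^4 / 192, isolates the squared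
   logarithm. *)
apply: (has_int_eq (has_intD (has_intZ 2 H) has_int_cubic)) => [t _|].
  by field.
rewrite limn_seriesZ; last exact: is_cvg_seriesB.
have -> : limn (series (fun n => alt (hpow 3) n - hpow 3 n)) =
   limn (series (alt (hpow 3))) - limn (series (hpow 3)) :> R by exact: lim_seriesB.
by field.
Qed.

End LogSine.

(** * Primitives of even powers of sine and the inner integrals of [J] *)

Section SinePowers.
Context {R : realType}.
Implicit Types (t x : R) (n : nat).

Notation h := (pi / 2 : R).

(** The primitive of [sin t ^+ n.*2] vanishing at 0, given by the reduction formula of integration
    by parts so that it can be differentiated by induction. *)
Fixpoint sin_int n t : R :=
  if n is n'.+1 then
    ((2 * n'%:R + 1) * sin_int n' t - sin t ^+ (n'.*2).+1 * cos t) / (2 * n'%:R + 2)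
  else t.

Let nat_pos n : 0 < 2 * n%:R + 2 :> R.
Proof. by rewrite ltr_wpDl// mulr_ge0. Qed.

Lemma is_derive_sin_int n t : is_derive t 1 (sin_int n) (sin t ^+ n.*2).
Proof.
elim: n => [|n IH] /=; first by rewrite expr0; exact: is_derive_var.
have ds := is_derive_sin t; have dc := is_derive_cos t.
derive_to.
  derive_step; last by do !derive_step.
  derive_step; last first.
    by derive_step; [notypeclasses refine (is_derive_exprn _ ds)|exact: dc].
  by derive_step; [exact: is_derive_const|exact: IH].
rewrite /= mul0r add0r mulr0 addr0 doubleS !exprS -(natr1 n.*2) -mul2n natrM.
have n0 := nat_pos n.
have E := cos2Dsin2 t.
move: (sin t ^+ (2 * n)) => S.
have -> : sin t * (sin t * S) = S * (1 - cos t ^+ 2) by rewrite -E; ring.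
rewrite (_ : sin t * S * - sin t = S * (cos t ^+ 2 - 1)); last by rewrite -E; ring.
by field; rewrite gt_eqF.
Qed.

Lemma sin_int0 n : sin_int n 0 = 0.
Proof. by elim: n => //= n ->; rewrite sin0 mulr0 exprS mul0r mul0r subr0 mul0r. Qed.

Lemma ge0_of_derive (F f : R -> R) t : 0 <= t -> F 0 = 0 ->
  (forall x, is_derive x 1 F (f x)) -> (forall x, 0 <= x <= t -> 0 <= f x) -> 0 <= F t.
Proof.
move=> t0 F0 dF f0.
have C : {within `[0, t], continuous F}.
  by apply: continuous_subspaceT => x; exact: is_derive_continuous (dF x).
have [c] := MVT_segment t0 (fun x _ => dF x) C.
rewrite in_itv/= F0 !subr0 => cab ->.
by rewrite mulr_ge0// f0.
Qed.

(** The left side is a primitive of sin^(2n) cos, which is at most sin^(2n). Together with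
    [sin_int_le] this settles the behaviour at 0 of the quotients below. *)
Lemma sin_int_ge n t : 0 <= t <= pi -> sin t ^+ (n.*2).+1 / (2 * n%:R + 1) <= sin_int n t.
Proof.
move=> /andP[t0 tp]; rewrite -subr_ge0.
have n1 : 0 < 2 * n%:R + 1 :> R by rewrite ltr_wpDl// mulr_ge0.
apply: (@ge0_of_derive (fun t => sin_int n t - sin t ^+ (n.*2).+1 / (2 * n%:R + 1))
  (fun t => sin t ^+ n.*2 * (1 - cos t))) => //.
- by rewrite sin_int0 sin0 exprS !mul0r subr0.
- move=> x; have ds := is_derive_sin x.
  derive_to.
    derive_step; first exact: is_derive_sin_int.
    by derive_step; [notypeclasses refine (is_derive_exprn _ ds)|do !derive_step].
  by rewrite /= -(natr1 n.*2) -mul2n natrM mulr0 addr0; field; rewrite gt_eqF.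
- move=> x /andP[x0 xt]; rewrite mulr_ge0 ?exprn_ge0 ?subr_ge0 ?cos_le1//.
  by rewrite sin_ge0_pi// x0 (le_trans xt).
Qed.

Lemma sin_int_ge0 n t : 0 <= t <= pi -> 0 <= sin_int n t.
Proof.
move=> tp; apply: le_trans (sin_int_ge n tp).
by rewrite divr_ge0 ?exprn_ge0 ?sin_ge0_pi// addr_ge0// mulr_ge0.
Qed.

(** The gap between the two sides has derivative [sin_int n t * sin t], nonnegative on the
    interval. *)
Lemma sin_int_le n t : 0 <= t <= pi ->
  sin_int n t * cos t <= sin t ^+ (n.*2).+1 / (2 * n%:R + 1).
Proof.
move=> /andP[t0 tp]; rewrite -subr_ge0.
have n1 : 0 < 2 * n%:R + 1 :> R by rewrite ltr_wpDl// mulr_ge0.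
apply: (@ge0_of_derive (fun t => sin t ^+ (n.*2).+1 / (2 * n%:R + 1) - sin_int n t * cos t)
  (fun t => sin_int n t * sin t)) => //.
- by rewrite sin_int0 sin0 exprS !mul0r subr0.
- move=> x; have ds := is_derive_sin x; have dc := is_derive_cos x.
  have dA := is_derive_sin_int n x.
  derive_to.
    derive_step; last by derive_step; [exact: dA|exact: dc].
    by derive_step; [notypeclasses refine (is_derive_exprn _ ds)|do !derive_step].
  by rewrite /= -(natr1 n.*2) -mul2n natrM mulr0 addr0; field; rewrite gt_eqF.
- move=> x /andP[x0 xt]; have xp : 0 <= x <= pi by rewrite x0 (le_trans xt).
  by rewrite mulr_ge0 ?sin_int_ge0 ?sin_ge0_pi.
Qed.

(** At t = 0 the numerator vanishes, so the value is 0; this is also the limit, whence continuity on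
    the closed interval. *)
Definition sin_ratio n t : R := sin_int n t / sin t ^+ n.*2.

Let h0 : 0 < h.
Proof. by rewrite divr_gt0// pi_gt0. Qed.

Lemma cvg_at_right_sandwich (f lo up : R -> R) (l : R) :
  (forall t, 0 < t < h -> lo t <= f t <= up t) ->
  {for 0, continuous lo} -> {for 0, continuous up} -> lo 0 = l -> up 0 = l ->
  f x @[x --> 0^'+] --> l.
Proof.
move=> fb cl cu l0 u0.
have cl' : lo x @[x --> 0^'+] --> l by rewrite -l0; exact: cvg_at_right_filter.
have cu' : up x @[x --> 0^'+] --> l by rewrite -u0; exact: cvg_at_right_filter.
apply: squeeze_cvgr cl' cu'.
near=> t; apply: fb; apply/andP; split; near: t.
  exact: nbhs_right_gt.
exact: nbhs_right_lt.
Unshelve. all: by end_near. Qed.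

Lemma continuous_sin_ratio n : {within `[0, h], continuous (sin_ratio n)}.
Proof.
have C t : 0 < t <= h -> {for t, continuous (sin_ratio n)}.
  move=> th; have s0 := sin_half_pos th.
  have dA := is_derive_sin_int n t; have ds := is_derive_sin t.
  have sn : sin t ^+ n.*2 != 0 by rewrite expf_neq0// gt_eqF.
  have dE : is_derive t 1 (fun t => sin t ^+ n.*2) ((n.*2)%:R * sin t ^+ (n.*2).-1 * cos t).
    exact: is_derive_exprn.
  have H : is_derive t 1 (sin_ratio n) _ :=
    is_derive_mul dA (@is_derive_inv _ (fun t => sin t ^+ n.*2) t _ sn dE).
  exact: is_derive_continuous H.
apply/(continuous_within_itvP _ h0); split.
- by move=> t; rewrite in_itv/= => /andP[t0 th]; apply: C; rewrite t0 ltW.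
- have f0 : sin_ratio n 0 = 0 by rewrite /sin_ratio sin_int0 mul0r.
  rewrite f0.
  apply: (@cvg_at_right_sandwich _ (fun=> 0) (fun t => sin t / ((2 * n%:R + 1) * cos t))).
  + move=> t /andP[t0 th]; have pp := @pi_gt0 R.
    have s0 : 0 < sin t by apply: sin_half_pos; rewrite t0 ltW.
    have c0 : 0 < cos t by apply: cos_gt0_pihalf; lra.
    have tp : 0 <= t <= pi by lra.
    have n1 : 0 < 2 * n%:R + 1 :> R by rewrite ltr_wpDl// mulr_ge0.
    have sn : 0 < sin t ^+ n.*2 by exact: exprn_gt0.
    rewrite /sin_ratio; apply/andP; split.
      by apply: divr_ge0; [exact: sin_int_ge0|exact: ltW].
    rewrite ler_pdivrMr ?exprn_gt0//.
    rewrite (_ : sin t / _ * _ = sin t ^+ (n.*2).+1 / (2 * n%:R + 1) / cos t).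
      by rewrite ler_pdivlMr// sin_int_le.
    by rewrite exprS; field; rewrite !gt_eqF.
  + exact: cst_continuous.
  + have ds := is_derive_sin (0 : R); have dc := is_derive_cos (0 : R).
    have n1 : 2 * n%:R + 1 != 0 :> R by rewrite gt_eqF// ltr_wpDl// mulr_ge0.
    have nz : (2 * n%:R + 1) * cos 0 != 0 :> R by rewrite cos0 mulr1.
    have di := @is_derive_inv _ (fun t => (2 * n%:R + 1) * cos t) 0 _ nz
      (is_derive_mul (is_derive_const _ _) dc).
    exact: is_derive_continuous (is_derive_mul ds di).
  + by [].
  + by rewrite sin0 mul0r.
- by apply: cvg_at_left_filter; apply: C; rewrite h0 lexx.
Qed.

(** The primitive behind the two-term recurrence. Its value at 0 is the limit, as [sin_int n t]
    behaves like sin^(2n+1) / (2n+1) there. *)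
Definition sin_cot n t : R :=
  if t == 0 then (2 * n%:R + 1)^-1 else sin_int n t * cos t / sin t ^+ (n.*2).+1.

Lemma is_derive_sin_cot n t : 0 < t <= h ->
  is_derive t 1 (sin_cot n)
    (2 * n%:R * sin_ratio n t - (2 * n%:R + 2) * sin_ratio n.+1 t).
Proof.
move=> th; have s0 := sin_half_pos th.
have dA := is_derive_sin_int n t; have ds := is_derive_sin t; have dc := is_derive_cos t.
have sn : sin t ^+ (n.*2).+1 != 0 by rewrite expf_neq0// gt_eqF.
have dE : is_derive t 1 (fun t => sin t ^+ (n.*2).+1) ((n.*2).+1%:R * sin t ^+ n.*2 * cos t).
  exact: is_derive_exprn.
have dg := is_derive_mul (is_derive_mul dA dc) (@is_derive_inv _ (fun t => sin t ^+ (n.*2).+1) t _ sn dE).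
have t0 : t != 0 by have /andP[/gt_eqF ->] := th.
apply: (near_eq_is_derive _ (is_derive_to dg _)).
  have /andP[tp _] := th.
  near=> x; rewrite /sin_cot gt_eqF//; near: x.
  exact: lt_nbhsr.
have E : cos t ^+ 2 = 1 - sin t ^+ 2 by exact: cos2sin2.
rewrite /sin_ratio doubleS /= !exprS -(natr1 n.*2) -mul2n natrM.
have n0 := nat_pos n.
have S0 : sin t ^+ (2 * n) != 0 by rewrite expf_neq0// gt_eqF.
move: (sin_int n t) (sin t ^+ (2 * n)) S0 => A S S0.
rewrite (_ : sin t * S * cos t = sin t * (S * cos t)); last by ring.
transitivity ((S * cos t * sin t - A * sin t ^+ 2 - (2 * n%:R + 1) * A * cos t ^+ 2)
    / (sin t ^+ 2 * S)).
  by field; rewrite S0 gt_eqF.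
by rewrite E; field; rewrite S0 !gt_eqF.
Unshelve. all: by end_near. Qed.

Lemma has_int_sin_ratio_rec n v : has_int 0 h (sin_ratio n) v ->
  has_int 0 h (sin_ratio n.+1) ((2 * n%:R * v + (2 * n%:R + 1)^-1) / (2 * n%:R + 2)).
Proof.
move=> hv; have n0 := nat_pos n.
pose phi t := 2 * n%:R * sin_ratio n t - (2 * n%:R + 2) * sin_ratio n.+1 t.
have cphi : {within `[0, h], continuous phi}.
  by move=> t; apply: cvgB; apply: cvgMr; exact: continuous_sin_ratio.
have n1 : 0 < 2 * n%:R + 1 :> R by rewrite ltr_wpDl// mulr_ge0.
have cg : {within `[0, h], continuous (sin_cot n)}.
  apply/(continuous_within_itvP _ h0); split.
  - move=> t; rewrite in_itv/= => /andP[t0 th].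
    by apply: (is_derive_continuous (@is_derive_sin_cot n t _)); rewrite t0 ltW.
  - have g0 : sin_cot n 0 = (2 * n%:R + 1)^-1 by rewrite /sin_cot eqxx.
    rewrite g0.
    apply: (@cvg_at_right_sandwich _ (fun t => cos t / (2 * n%:R + 1)) (fun=> (2 * n%:R + 1)^-1)).
    + move=> t /andP[t0 th]; have pp := @pi_gt0 R.
      have s0 : 0 < sin t by apply: sin_half_pos; rewrite t0 ltW.
      have c0 : 0 < cos t by apply: cos_gt0_pihalf; lra.
      have tp : 0 <= t <= pi by lra.
      have sn : 0 < sin t ^+ (n.*2).+1 by exact: exprn_gt0.
      rewrite /sin_cot gt_eqF//; apply/andP; split.
        rewrite ler_pdivlMr// mulrAC -mulrA (mulrC (sin_int n t)) ler_wpM2l//; first exact: ltW.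
        exact: sin_int_ge.
      by rewrite ler_pdivrMr// [leRHS]mulrC; exact: sin_int_le.
    + by apply: cvgM; [exact: continuous_cos|exact: cvg_cst].
    + exact: cst_continuous.
    + by rewrite cos0 mul1r.
    + by [].
  - apply: cvg_at_left_filter.
    by apply: (is_derive_continuous (@is_derive_sin_cot n h _)); rewrite h0 lexx.
have dg t : 0 < t < h -> is_derive t 1 (sin_cot n) (phi t).
  by move=> /andP[t0 th]; apply: is_derive_sin_cot; rewrite t0 ltW.
have H := has_int_FTC h0 cphi cg dg.
apply: (has_int_eq (has_intZ (2 * n%:R + 2)^-1 (has_intB (has_intZ (2 * n%:R) hv) H))).
  by move=> t _; rewrite /phi; field; rewrite gt_eqF.
(* The primitive vanishes at pi/2 with the cosine, and its value at 0 is the inhomogeneous term of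
   the recurrence. *)
rewrite /sin_cot eqxx gt_eqF// cos_pihalf mulr0 mul0r.
by field; rewrite !gt_eqF.
Qed.

Lemma has_int_sin_ratio n : has_int 0 h (sin_ratio n.+1)
  ((\sum_(0 <= j < n.+1) (2 * j%:R + 1)^-1) / (2 * n.+1%:R)).
Proof.
elim: n => [|n IH].
  (* The recurrence multiplies this initial integral by 2n = 0, so pi disappears and only odd
     harmonic sums remain. *)
  have hid : has_int 0 h id (h ^+ 2 / 2).
    have dF t : is_derive t 1 (fun t => t ^+ 2 / 2 : R) t.
      by derive_to; [do !derive_step|rewrite /=; field].
    by apply: (has_int_eq (has_int_antiderivative h0 dF is_derive_var)) => //; field.
  have h0' : has_int 0 h (sin_ratio 0) (h ^+ 2 / 2).
    by apply: (has_int_eq hid) => // t _; rewrite /sin_ratio /= expr0 divr1.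
  apply: (has_int_eq (has_int_sin_ratio_rec h0')) => //.
  by rewrite big_nat1; field.
apply: (has_int_eq (has_int_sin_ratio_rec IH)) => //.
rewrite [in RHS]big_nat_recr//= -(natr1 n.+1).
have : 0 <= n.+1%:R :> R by [].
have : n.+1%:R != 0 :> R by rewrite pnatr_eq0.
move: (n.+1%:R) (\sum_(_ <= _ < _) _) => z s z1 z0.
by field; do !(apply/andP; split); rewrite ?gt_eqF//; lra.
Qed.

End SinePowers.

(** * Parseval for the logarithm: its mean square over a full turn *)

Section Parseval.
Context {R : realType}.
Implicit Types (w : nat -> R) (a b c d r t : R) (m n : nat).

Let be d t : R := 2 * pi * t + d.

Lemma sin_add_2pi_nat n t : sin (t + n%:R * (2 * pi)) = sin t :> R.
Proof. by rewrite mulr_natl (mulr_natl pi 2) (periodicn (@sinD2pi R)). Qed.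

Lemma has_int_cos_period m d : (0 < m)%N -> has_int 0 1 (fun t => cos (m%:R * be d t)) 0.
Proof.
move=> m0; have m1 : m%:R != 0 :> R by rewrite pnatr_eq0 -lt0n.
have q0 : 2 * pi != 0 :> R by rewrite gt_eqF// mulr_gt0// pi_gt0.
have dl t : is_derive t 1 (fun t => m%:R * be d t) (m%:R * (2 * pi)).
  by rewrite /be; derive_to; [do !derive_step|rewrite /=; ring].
have dF t : is_derive t 1 (fun t => sin (m%:R * be d t) / (m%:R * (2 * pi))) (cos (m%:R * be d t)).
  derive_to.
    by derive_step; [notypeclasses refine (is_derive_compose (is_derive_sin _) (dl t))|do !derive_step].
  rewrite /=; move: (2 * pi) q0 (cos _) => q q0 z.
  by field; rewrite q0 m1.
have df t : is_derive t 1 (fun t => cos (m%:R * be d t)) (- sin (m%:R * be d t) * (m%:R * (2 * pi))).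
  exact: (is_derive_compose (is_derive_cos _) (dl t)).
apply: (has_int_eq (has_int_antiderivative ltr01 dF df)) => //.
have -> : m%:R * be d 1 = m%:R * be d 0 + m%:R * (2 * pi) by rewrite /be; ring.
by rewrite sin_add_2pi_nat subrr.
Qed.

Lemma has_int_cst c : has_int 0 1 (fun=> c) c.
Proof.
have dF t : is_derive t 1 (fun t => c * t) c.
  by derive_to; [do !derive_step|rewrite /=; ring].
by apply: (has_int_eq (has_int_antiderivative ltr01 dF (fun t => is_derive_const c t))) => //; ring.
Qed.

Lemma has_int_cos_cos m n d : (m < n)%N ->
  has_int 0 1 (fun t => cos (m%:R * be d t) * cos (n%:R * be d t)) 0.
Proof.
move=> mn.
have h1 := @has_int_cos_period (n + m) d (leq_trans (leq_ltn_trans (leq0n m) mn) (leq_addr _ _)).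
have h2 := @has_int_cos_period (n - m) d; rewrite subn_gt0 in h2; have {}h2 := h2 mn.
apply: (has_int_eq (has_intZ 2^-1 (has_intD h1 h2))) => [t _|]; last by rewrite addr0 mulr0.
rewrite natrD natrB; last exact: ltnW.
by rewrite mulrDl mulrBl cosD cosB; field.
Qed.

Lemma has_int_cos_sqr n d : (0 < n)%N ->
  has_int 0 1 (fun t => cos (n%:R * be d t) ^+ 2) 2^-1.
Proof.
move=> n0; have h1 := @has_int_cos_period (n + n) d (leq_trans n0 (leq_addr _ _)).
apply: (has_int_eq (has_intZ 2^-1 (has_intD (has_int_cst 1) h1))) => [t _|]; last by rewrite addr0 mulr1.
by rewrite natrD mulrDl cosD -!expr2 sin2cos2; field.
Qed.

(** Induction on the number of terms: the cross term with the new cosine integrates to 0 and its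
    square to 1/2. With [w 0 = 0] the constant mode is carried by [c] alone. *)
Lemma has_int_parseval c w d n : w 0%N = 0 ->
  has_int 0 1 (fun t => (c - series (cosc w (be d t)) n) ^+ 2)
    (c ^+ 2 + 2^-1 * series (fun k => w k ^+ 2) n).
Proof.
move=> w0; elim: n => [|n IH].
  apply: (has_int_eq (has_int_cst (c ^+ 2))) => [t _|]; rewrite /series /= big_geq//.
    by rewrite subr0.
  by rewrite mulr0 addr0.
have [->|n0] := posnP n.
  apply: (has_int_eq (has_int_cst (c ^+ 2))) => [t _|]; rewrite /series /= big_nat1.
    by rewrite /cosc w0 mul0r subr0.
  by rewrite w0 expr0n mulr0 addr0.
have hX : has_int 0 1 (fun t => (c - series (cosc w (be d t)) n) * cos (n%:R * be d t)) 0.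
  (* [has_int_sum] asks for a value at every index, while orthogonality holds for k < n; the guard
     sets the other coefficients to 0. *)
  have hk k : has_int 0 1 (fun t => (if (k < n)%N then w k else 0) *
      (cos (k%:R * be d t) * cos (n%:R * be d t))) 0.
    case: ifPn => kn.
      by apply: (has_int_eq (has_intZ (w k) (has_int_cos_cos d kn))) => //; rewrite mulr0.
    by apply: (has_int_eq (has_int0 0 1)) => // t _; rewrite mul0r.
  have hs := has_int_sum n hk.
  apply: (has_int_eq (has_intB (has_intZ c (has_int_cos_period d n0)) hs)) => [t _|].
    rewrite mulrBl; congr (_ - _); rewrite /series /= mulr_suml.
    by rewrite !big_mkord; apply: eq_bigr => k _; rewrite ltn_ord /cosc mulrA.
  by rewrite mulr0 sub0r /series /= big1 ?oppr0.
apply: (has_int_eq (has_intD (has_intD IH (has_intZ (- 2 * w n) hX))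
  (has_intZ (w n ^+ 2) (has_int_cos_sqr d n0)))) => [t _|].
  by rewrite seriesSr /cosc; ring.
by rewrite seriesSr; field.
Qed.

Lemma has_int_sqr_logabs c r d : `|r| < 1 ->
  has_int 0 1 (fun t => (c + logabs r (be d t)) ^+ 2)
    (c ^+ 2 + 2^-1 * psum (ipow 2) (r ^+ 2)).
Proof.
move=> r1; pose w n := ipow 1 n * r ^+ n.
have w0 : w 0%N = 0 by rewrite /w ipow0 mul0r.
have r1' : `|(`|r|)| < 1 by rewrite normr_id.
have cg := is_cvg_geometric_series (a := 1) r1'.
have wle n t : `|cosc w t n| <= geometric 1 `|r| n.
  apply: le_trans (norm_cosc_le _ _ _) _; rewrite /w normrM normrX /=.
  by rewrite ler_wpM2r ?exprn_ge0// norm_ipow_le1.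
have E t : (fun n => cosc (ipow 1) t n * r ^+ n) = cosc w t.
  by apply/funext => n; rewrite /cosc /w; ring.
pose B := `|c| + limn (series (geometric 1 `|r|)).
apply: (@has_int_dominated _ 0 1 (fun n t => (c - series (cosc w (be d t)) n) ^+ 2) _
   (fun n => c ^+ 2 + 2^-1 * series (fun k => w k ^+ 2) n) _ (B ^+ 2)) => //.
- by move=> n; exact: has_int_parseval.
- move=> n t _; rewrite normrX lerXn2r ?nnegrE//.
    by apply: le_trans (_ : `|c| <= _) => //; rewrite lerDl; apply: limr_ge => //;
      apply: nearW => k; apply: sumr_ge0 => i _ /=; rewrite mul1r exprn_ge0.
  apply: le_trans (ler_normB _ _) _; rewrite lerD2l.
  apply: (@le_trans _ _ (series (geometric 1 `|r|) n)).
    by apply: le_trans (ler_norm_sum _ _ _) _; apply: ler_sum => k _; exact: wle.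
  apply: nondecreasing_cvgn_le => //.
  by apply/nondecreasing_seqP => k; rewrite seriesSr lerDl /= mul1r exprn_ge0.
- move=> t _; rewrite logabs_psum// /psum /pseries E.
  have cs : series (cosc w (be d t)) n @[n --> \oo] --> limn (series (cosc w (be d t))).
    by apply: (is_cvg_series_dom cg) => n; exact: wle.
  have cB : c - series (cosc w (be d t)) n @[n --> \oo] --> c - limn (series (cosc w (be d t))).
    by apply: cvgB => //; exact: cvg_cst.
  exact: (cvgM cB cB).
- apply: cvgD; first exact: cvg_cst.
  apply: cvgMr; rewrite (_ : series _ = pseries (ipow 2) (r ^+ 2)).
    apply: cvg_disc_ipow.
    by rewrite normrX expr_lt1.
  apply/funext => n; rewrite /series /pseries /=; apply: eq_bigr => k _.
  by rewrite /w /ipow exprMn expr1 -exprVn -!exprM mulnC.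
Qed.

(** Factoring out the larger term, |a + b e^(i theta)| = |a| |1 + (b/a) e^(i theta)|, which is
    [logabs] at radius [- (b / a)] shifted by [ln |a|]. *)
Lemma has_int_sqr_ln_norm a b d : `|b| < `|a| ->
  has_int 0 1 (fun t => ln (Num.sqrt (a ^+ 2 + b ^+ 2 + 2 * a * b * cos (2 * pi * t + d))) ^+ 2)
    (ln `|a| ^+ 2 + 2^-1 * psum (ipow 2) ((b / a) ^+ 2)).
Proof.
move=> ba; have a0 : 0 < `|a| by apply: le_lt_trans ba.
have aN0 : a != 0 by rewrite -normr_gt0.
have r1 : `|- (b / a)| < 1 by rewrite normrN normrM normfV ltr_pdivrMr// mul1r.
apply: (has_int_eq (has_int_sqr_logabs (ln `|a|) d r1)) => [t _|]; last by rewrite sqrrN.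
congr (_ ^+ 2); rewrite /logabs -/(be d t).
have D0 := sqdist_gt0 (be d t) r1.
have -> : a ^+ 2 + b ^+ 2 + 2 * a * b * cos (be d t) = `|a| ^+ 2 * sqdist (- (b / a)) (be d t).
  by rewrite real_normK ?num_real// /sqdist; field.
rewrite sqrtrM ?sqr_ge0// sqrtr_sqr normr_id lnM ?posrE ?sqrtr_gt0//.
congr (_ + _).
by rewrite -[in LHS](sqr_sqrtr (ltW D0)) lnXn ?sqrtr_gt0//; field.
Qed.

End Parseval.

(** * Tonelli on rectangles, affine substitutions and periodic translations *)

Section LebesgueTools.
Context {R : realType}.
Notation mu := (@lebesgue_measure R).
Notation RT := (measurableTypeR R).
Local Open Scope ereal_scope.

Lemma measurable_fun_integral_l (B : set RT) (f : RT * RT -> \bar R) : measurable B ->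
  measurable_fun setT f -> (forall z, 0 <= f z) ->
  measurable_fun setT (fun x : RT => \int[mu]_(y in B) f (x, y)).
Proof.
move=> mB mf f0.
have mg : measurable_fun setT (f \_ (setT `*` B)).
  apply: (measurable_restrictT f (measurableX measurableT mB)).1.
  exact: measurable_funTS.
have g0 z : 0 <= (f \_ (setT `*` B)) z by rewrite /patch; case: ifP.
have := @measurable_fun_fubini_tonelli_F _ _ RT RT R mu _ mg g0.
rewrite /fubini_F; congr (measurable_fun _ _).
apply/funext => x; rewrite [RHS]integral_mkcond; apply: eq_integral => y _.
by rewrite /patch !in_setX in_setT.
Qed.

(** Extension by 0 outside the rectangle reduces this to Tonelli on the whole plane. *)
Lemma tonelli_itv (A B : set RT) (f : RT * RT -> \bar R) : measurable A -> measurable B ->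
  measurable_fun setT f -> (forall z, 0 <= f z) ->
  \int[mu]_(x in A) \int[mu]_(y in B) f (x, y) = \int[mu]_(y in B) \int[mu]_(x in A) f (x, y).
Proof.
move=> mA mB mf f0.
have mg : measurable_fun setT (f \_ (A `*` B)).
  apply: (measurable_restrictT f (measurableX mA mB)).1.
  exact: measurable_funTS.
have g0 z : 0 <= (f \_ (A `*` B)) z by rewrite /patch; case: ifP.
have := @fubini_tonelli _ _ RT RT R mu mu _ mg g0.
have -> : \int[mu]_x \int[mu]_y (f \_ (A `*` B)) (x, y) = \int[mu]_(x in A) \int[mu]_(y in B) f (x, y).
  rewrite [RHS]integral_mkcond; apply: eq_integral => x _; rewrite [RHS]/patch.
  case: ifPn => xA.
    rewrite [RHS]integral_mkcond; apply: eq_integral => y _.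
    by rewrite /patch in_setX xA.
  by rewrite integral0_eq// => y _; rewrite /patch in_setX (negbTE xA).
move=> ->.
rewrite [RHS]integral_mkcond; apply: eq_integral => y _; rewrite [RHS]/patch.
case: ifPn => yB.
  rewrite [RHS]integral_mkcond; apply: eq_integral => x _.
  by rewrite /patch in_setX yB andbT.
by rewrite integral0_eq// => x _; rewrite /patch in_setX (negbTE yB) andbF.
Qed.

Lemma integral2_symmetrize (A : set RT) (f : RT * RT -> \bar R) : measurable A ->
  measurable_fun setT f -> (forall z, 0 <= f z) ->
  \int[mu]_(x in A) \int[mu]_(y in A) (f (x, y) + f (y, x)) =
  \int[mu]_(x in A) \int[mu]_(y in A) f (x, y) + \int[mu]_(x in A) \int[mu]_(y in A) f (x, y).
Proof.
move=> mA mf f0.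
have mf' : measurable_fun [set: RT * RT] (fun z => f (z.2, z.1)).
  by apply: (measurableT_comp mf); apply: measurable_fun_pair; [exact: measurable_snd|exact: measurable_fst].
have F0 (x : RT) : 0 <= \int[mu]_(y in A) f (x, y) by exact: integral_ge0.
have F0' (x : RT) : 0 <= \int[mu]_(y in A) f (y, x) by exact: integral_ge0.
rewrite [X in _ + X](tonelli_itv mA mA mf f0) -ge0_integralD//; last 2 first.
- by apply: measurable_funTS; exact: measurable_fun_integral_l.
- by apply: measurable_funTS; exact: (measurable_fun_integral_l mA mf').
apply: eq_integral => x _; rewrite ge0_integralD//; apply: measurable_funTS.
- exact: (measurableT_comp mf (pair1_measurable x)).
- exact: (measurableT_comp mf (pair2_measurable x)).
Qed.

Lemma measurable_affine (c d : R) : measurable_fun [set: RT] (fun x : RT => (c * x + d)%R : RT).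
Proof.
apply: continuous_measurable_fun => x.
by apply: cvgD; [apply: cvgMr; exact: cvg_id|exact: cvg_cst].
Qed.

(** The push-forward of Lebesgue measure along x -> c x + d, scaled by |c| so that it is Lebesgue
    measure again; substitution then becomes integration against a push-forward. *)
Definition affine_image (c d : R) : {measure set RT -> \bar R} :=
  mscale (NngNum (normr_ge0 c))
    (measure_function_pushforward__canonical__measure_function_Measure mu (measurable_affine c d)).

Lemma affine_imageE (c d : R) (A : set RT) :
  affine_image c d A = `|c|%:E * mu ((fun x => (c * x + d)%R) @^-1` A).
Proof. by []. Qed.

(** By uniqueness of Lebesgue measure, half-open intervals are enough. A negative [c] exchanges
    their open and closed ends, hence the two cases. *)
Lemma lebesgue_measure_affine (c d : R) (A : set RT) : c != 0%R -> measurable A ->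
  mu A = affine_image c d A.
Proof.
move=> c0 mA; apply: lebesgue_measure_unique => // X [[p q] /= pq <-].
rewrite affine_imageE.
have [cp|cn|/eqP] := ltgtP 0%R c; last by rewrite eq_sym (negbTE c0).
- have -> : (fun x => (c * x + d)%R) @^-1` `]p, q]%classic = `]((p - d) / c)%R, ((q - d) / c)%R]%classic.
    apply/seteqP; split => x /=; rewrite !in_itv/= => /andP[x1 x2]; apply/andP; split.
    + by rewrite ltr_pdivrMr//; lra.
    + by rewrite ler_pdivlMr//; lra.
    + by move: x1; rewrite ltr_pdivrMr//; lra.
    + by move: x2; rewrite ler_pdivlMr//; lra.
  rewrite !lebesgue_measure_itv/= !lte_fin ltr_pM2r ?invr_gt0// ltrD2r.
  case: ifP => // _; last by rewrite mule0.
  by rewrite gtr0_norm// -!EFinB -EFinM; congr EFin; field; rewrite gt_eqF.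
- have -> : (fun x => (c * x + d)%R) @^-1` `]p, q]%classic = `[((q - d) / c)%R, ((p - d) / c)%R[%classic.
    apply/seteqP; split => x /=; rewrite !in_itv/= => /andP[x1 x2]; apply/andP; split.
    + by rewrite ler_ndivrMr//; lra.
    + by rewrite ltr_ndivlMr//; lra.
    + by move: x2; rewrite ltr_ndivlMr//; lra.
    + by move: x1; rewrite ler_ndivrMr//; lra.
  rewrite !lebesgue_measure_itv/= !lte_fin ltr_nM2r ?invr_lt0// ltrD2r.
  case: ifP => // _; last by rewrite mule0.
  by rewrite ltr0_norm// -!EFinB -EFinM; congr EFin; field; rewrite lt_eqF.
Qed.

Lemma ge0_integral_affine (c d : R) (D : set RT) (f : RT -> \bar R) : c != 0%R -> measurable D ->
  measurable_fun setT f -> (forall x, 0 <= f x) ->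
  \int[mu]_(x in D) f x =
  `|c|%:E * \int[mu]_(x in (fun x => (c * x + d)%R) @^-1` D) f (c * x + d)%R.
Proof.
move=> c0 mD mf f0.
rewrite (@eq_measure_integral _ _ _ D (affine_image c d)); last first.
  by move=> A mA _; exact: lebesgue_measure_affine.
rewrite ge0_integral_mscale//; last exact: measurable_funTS.
congr (_ * _); rewrite ge0_integral_pushforward//.
- exact: measurable_affine.
- exact: measurable_funTS.
Qed.

(** The intervals ]0, 1] and ]c, 1 + c] share ]c, 1], and the leftover ]1, 1 + c] is ]0, c] moved by
    one period. Half-open intervals keep the pieces disjoint. *)
Lemma integral_periodic_shift (g : RT -> \bar R) (c : R) : (0 <= c <= 1)%R ->
  measurable_fun setT g -> (forall x, 0 <= g x) -> (forall x, g (x + 1)%R = g x) ->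
  \int[mu]_(x in `[0%R, 1%R]) g x = \int[mu]_(x in `[0%R, 1%R]) g (x + c)%R.
Proof.
move=> /andP[c0 c1] mg g0 gp.
have mgi (i : interval R) : measurable_fun [set` i] g by exact: measurable_funTS.
have mgc : measurable_fun [set: RT] (fun x => g (x + c)%R).
  have := measurable_affine 1 c; under eq_fun do rewrite mul1r.
  by move=> h; exact: measurableT_comp.
have shift (a b e : R) : \int[mu]_(x in `](a + e)%R, (b + e)%R]) g x =
    \int[mu]_(x in `]a, b]) g (x + e)%R.
  rewrite (@ge0_integral_affine 1 e)// ?oner_neq0// normr1 mul1e.
  have -> : (fun x => (1 * x + e)%R) @^-1` `](a + e)%R, (b + e)%R]%classic = `]a, b]%classic.
    by apply/seteqP; split => x /=; rewrite !in_itv/= mul1r ltrD2r lerD2r.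
  by apply: eq_integral => x _; rewrite mul1r.
have split (a b e : R) : (a <= b <= e)%R -> \int[mu]_(x in `]a, e]) g x =
    \int[mu]_(x in `]a, b]) g x + \int[mu]_(x in `]b, e]) g x.
  move=> /andP[ab be].
  rewrite (@itv_bndbnd_setU _ _ (BRight a) (BRight b) (BRight e)) ?bnd_simp//.
  rewrite ge0_integral_setU//; first exact: measurable_funTS.
  apply/disj_setPS => x [/=]; rewrite !in_itv/= => /andP[_ xb] /andP[bx _].
  by move: (lt_le_trans bx xb); rewrite ltxx.
rewrite -[LHS]integral_itv_obnd_cbnd// -[RHS]integral_itv_obnd_cbnd; last exact: measurable_funTS.
rewrite -shift add0r (@split c 1%R (1 + c)%R); last by rewrite c1 lerDl.
rewrite (@split 0%R c 1%R) ?c0// addeC; congr (_ + _).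
have -> : `]1%R, (1 + c)%R] = `](0 + 1)%R, (c + 1)%R] by rewrite add0r addrC.
rewrite shift; by apply: eq_integral => x _; rewrite gp.
Qed.

End LebesgueTools.

(** * The integrand after translation and the folding onto [0, pi/2] *)

Section Reduction.
Context {R : realType}.
Notation mu := (@lebesgue_measure R).
Notation RT := (measurableTypeR R).
Notation h := (pi / 2 : R).
Implicit Types (t s u v x y a b : R) (n : nat).

(** With A = pi t1, S = pi s and U = 2 pi t2 + S, one has 1 + x = 2 cos(A) e^(iA) and y + z =
    e^(i(U-S)) + e^(i(U+S)) = 2 cos(S) e^(iU); the law of cosines concludes. *)
Lemma absP_shift t1 t2 s : absP t1 t2 (s + t2) =
  Num.sqrt ((2 * cos (pi * t1)) ^+ 2 + (2 * cos (pi * s)) ^+ 2 +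
    2 * (2 * cos (pi * t1)) * (2 * cos (pi * s)) * cos (2 * pi * t2 + (pi * s - pi * t1))).
Proof.
rewrite /absP; congr Num.sqrt.
pose A := pi * t1; pose S := pi * s; pose T := 2 * pi * t2.
have E1 : 2 * pi * t1 = 2 * A by rewrite /A mulrA.
have E2 : 2 * pi * (s + t2) = T + S + S by rewrite /T /S; ring.
have E3 : T = T + S - S by ring.
have E4 : 2 * pi * t2 + (pi * s - pi * t1) = T + S - A by rewrite /T /S /A; ring.
rewrite E4 E1 E2 -/T {1}E3 [in sin T]E3 -/A -/S.
rewrite cos2M sin2M !(cosD (T + S) S) !(sinD (T + S) S) !(cosB (T + S)) !(sinB (T + S)).
have cA := cos2sin2 A.
rewrite (_ : 1 + (1 - 2 * sin A ^+ 2) = 2 * cos A ^+ 2); last by rewrite cA; ring.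
move: (T + S) => U.
have [cU cS] := (cos2sin2 U, cos2sin2 S).
rewrite (_ : 2 * cos A ^+ 2 + _ + _ = 2 * cos A * cos A + 2 * cos S * cos U); last by ring.
rewrite (_ : 2 * sin A * cos A + _ + _ = 2 * cos A * sin A + 2 * cos S * sin U); last by ring.
transitivity ((2 * cos A) ^+ 2 * (cos A ^+ 2 + sin A ^+ 2) + (2 * cos S) ^+ 2 * (cos U ^+ 2 + sin U ^+ 2)
   + 2 * (2 * cos A) * (2 * cos S) * (cos U * cos A + sin U * sin A)); first by ring.
by rewrite !cos2Dsin2 !mulr1.
Qed.

Local Notation sqln t1 t2 t3 := (ln (absP t1 t2 t3) ^+ 2).

Lemma measurable_cos_comp d (T : measurableType d) (f : T -> R) :
  measurable_fun setT f -> measurable_fun setT (fun z => cos (f z)).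
Proof.
by move=> mf; apply: (measurableT_comp _ mf); apply: continuous_measurable_fun; exact: continuous_cos.
Qed.

Lemma measurable_sin_comp d (T : measurableType d) (f : T -> R) :
  measurable_fun setT f -> measurable_fun setT (fun z => sin (f z)).
Proof.
by move=> mf; apply: (measurableT_comp _ mf); apply: continuous_measurable_fun; exact: continuous_sin.
Qed.

Lemma measurable_sqln t1 d (T : measurableType d) (f g : T -> R) :
  measurable_fun setT f -> measurable_fun setT g ->
  measurable_fun setT (fun z => (sqln t1 (f z) (g z))%:E).
Proof.
move=> mf mg; apply/measurable_EFinP; apply: measurable_funX.
apply: (measurableT_comp (@measurable_ln R)).
apply: measurableT_comp; first by apply: continuous_measurable_fun; exact: sqrt_continuous.
have mM (k : T -> R) : measurable_fun setT k -> measurable_fun setT (fun z => 2 * pi * k z).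
  by move=> mk; apply: measurable_funM => //; exact: measurable_cst.
apply: measurable_funD; apply: measurable_funX.
  apply: measurable_funD; last by apply: measurable_cos_comp; exact: mM.
  apply: measurable_funD; last by apply: measurable_cos_comp; exact: mM.
  exact: measurable_cst.
apply: measurable_funD; last by apply: measurable_sin_comp; exact: mM.
apply: measurable_funD; last by apply: measurable_sin_comp; exact: mM.
exact: measurable_cst.
Qed.

Lemma mean_coef_ge0 n x : 0 <= 2^-1 * ipow 2 n * x ^+ n.*2.
Proof.
apply: mulr_ge0; first by apply: mulr_ge0 => //; exact: ipow_ge0.
by rewrite -mul2n exprM; apply: exprn_ge0; exact: sqr_ge0.
Qed.

Local Open Scope ereal_scope.

(* The inverse is written [u `^ (-1)], which agrees with [u^-1] for [0 <= u], because the
   library proves [powR] measurable. *)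
Definition mean_sqln u v : \bar R :=
  (ln (2 * u) ^+ 2)%:E + \sum_(n <oo) (2^-1 * ipow 2 n * (v * u `^ (-1)) ^+ n.*2)%:E.

Lemma mean_sqln_ge0 u v : 0 <= mean_sqln u v.
Proof.
apply: adde_ge0; first by rewrite lee_fin sqr_ge0.
by apply: nneseries_ge0 => n _ _; rewrite lee_fin mean_coef_ge0.
Qed.

Lemma nneseries_EFin (f : nat -> R) : cvgn (series f) ->
  \sum_(n <oo) (f n)%:E = (limn (series f))%:E.
Proof.
move=> cf; rewrite -EFin_lim//; congr (limn _); apply/funext => n.
by rewrite /series /= sumEFin.
Qed.

Lemma mean_sqlnE u v : (0 <= v < u)%R ->
  mean_sqln u v = (ln (2 * u) ^+ 2 + 2^-1 * psum (ipow 2) ((v / u) ^+ 2))%:E.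
Proof.
move=> /andP[v0 vu]; have u0 : (0 < u)%R by exact: le_lt_trans vu.
have r0 : (0 <= v / u)%R by rewrite divr_ge0// ltW.
have r1 : (`|(v / u) ^+ 2| < 1)%R.
  by rewrite ger0_norm ?exprn_ge0// expr_lt1// ltr_pdivrMr// mul1r.
have cr := cvg_disc_ipow r1 : cvgn (pseries (ipow 2) ((v / u) ^+ 2)).
rewrite /mean_sqln EFinD powR_inv1 ?ltW//; congr (_ + _).
rewrite -psumM//.
rewrite (_ : (fun n => 2^-1 * (ipow 2 n * _))%R = (fun n => 2^-1 * ipow 2 n * (v / u) ^+ n.*2)%R); last first.
  by apply/funext => n; rewrite -exprM mul2n mulrA.
rewrite nneseries_EFin//.
rewrite (_ : series _ = fun n => (2^-1 * pseries (ipow 2) ((v / u) ^+ 2) n)%R); first exact: is_cvgMr.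
apply/funext => n; rewrite /pseries /series /= mulr_sumr; apply: eq_bigr => k _.
by rewrite -exprM mul2n mulrA.
Qed.

(** One triangle of the symmetric [F]: for nonnegative arguments Parseval applies where v < u, and
    [upper_sqln u v + upper_sqln v u] is F (2u) (2v) off the diagonal. *)
Definition upper_sqln u v : \bar R := if (v < u)%R then mean_sqln u v else 0.

Lemma upper_sqln_ge0 u v : 0 <= upper_sqln u v.
Proof. by rewrite /upper_sqln; case: ifP => // _; exact: mean_sqln_ge0. Qed.

Lemma measurable_upper_sqln d (T : measurableType d) (f g : T -> R) :
  measurable_fun setT f -> measurable_fun setT g ->
  measurable_fun setT (fun z => upper_sqln (f z) (g z)).
Proof.
move=> mf mg; apply: measurable_fun_ifT => //; first exact: measurable_fun_ltr.
apply: emeasurable_funD.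
  apply/measurable_EFinP; apply: measurable_funX; apply: (measurableT_comp (@measurable_ln R)).
  by apply: measurable_funM => //; exact: measurable_cst.
apply: ge0_emeasurable_sum => [n z _ _|n _].
  by rewrite lee_fin mean_coef_ge0.
apply/measurable_EFinP; apply: measurable_funM; first exact: measurable_cst.
apply: measurable_funX; apply: measurable_funM => //.
exact: (measurableT_comp (@measurable_powR R (-1)%R) mf).
Qed.

(** The substitutions t = 1/2 - x/pi and t = 1/2 + x/pi on the two halves both turn |cos(pi t)| into
    sin x, and each contributes 1/pi. *)
Lemma integral_fold (f : RT -> \bar R) : measurable_fun setT f -> (forall x, 0 <= f x) ->
  \int[mu]_(t in `[0%R, 1%R]) f `|cos (pi * t)|%R =
  (2 / pi)%:E * \int[mu]_(t in `[0%R, h]) f (sin t).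
Proof.
move=> mf f0; have p0 := @pi_gt0 R; have pN0 : (pi : R) != 0%R by rewrite gt_eqF.
have mg : measurable_fun [set: RT] (fun t => f `|cos (pi * t)|%R).
  apply: (measurableT_comp mf).
  apply: (measurableT_comp (@normr_measurable R setT)).
  by apply: measurable_cos_comp; apply: measurable_funM => //; exact: measurable_cst.
have ms : measurable_fun [set: RT] (fun t => f (sin t)).
  by apply: (measurableT_comp mf); apply: measurable_sin_comp.
have s0 t : (0 <= t <= h)%R -> (0 <= sin t)%R.
  by move=> /andP[t0 th]; apply: sin_ge0_pi; rewrite t0/= (le_trans th)//; lra.
have E1 : \int[mu]_(t in `[0%R, 2^-1%R]) f `|cos (pi * t)|%R =
    pi^-1%:E * \int[mu]_(t in `[0%R, h]) f (sin t).
  rewrite (@ge0_integral_affine _ (- pi^-1)%R 2^-1%R _ _ _ _ mg)//; last first.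
    by rewrite oppr_eq0 invr_neq0.
  rewrite normrN gtr0_norm ?invr_gt0//; congr (_ * _).
  have -> : (fun x => (- pi^-1 * x + 2^-1)%R) @^-1` `[0%R, 2^-1%R]%classic = `[0%R, h]%classic.
    apply/seteqP; split => x /=; rewrite !in_itv/= => /andP[x1 x2].
      have x3 : (pi^-1 * x <= 2^-1)%R by lra.
      have x4 : (0 <= pi^-1 * x)%R by lra.
      move: x3 x4; rewrite (mulrC _ x) pmulr_lge0 ?invr_gt0// => x3 ->/=.
      by move: x3; rewrite ler_pdivrMr// mulrC.
    have x3 : (pi^-1 * x <= 2^-1)%R by rewrite (mulrC _ x) ler_pdivrMr// mulrC.
    have x4 : (0 <= pi^-1 * x)%R by rewrite mulr_ge0// invr_ge0 ltW.
    by apply/andP; split; lra.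
  apply: eq_integral => x; rewrite inE/= in_itv/= => xh; congr f.
  have -> : (pi * (- pi^-1 * x + 2^-1))%R = (h - x)%R.
    by rewrite mulrDr mulNr mulrN mulVKf// addrC.
  by rewrite cosB cos_pihalf sin_pihalf mul0r mul1r add0r ger0_norm// s0.
have E2 : \int[mu]_(t in `]2^-1%R, 1%R]) f `|cos (pi * t)|%R =
    pi^-1%:E * \int[mu]_(t in `[0%R, h]) f (sin t).
  rewrite (@ge0_integral_affine _ (pi^-1)%R 2^-1%R _ _ _ _ mg)//; last first.
    by rewrite invr_neq0.
  rewrite gtr0_norm ?invr_gt0//; congr (_ * _).
  rewrite -[RHS]integral_itv_obnd_cbnd//; last exact: measurable_funTS.
  have -> : (fun x => (pi^-1 * x + 2^-1)%R) @^-1` `]2^-1%R, 1%R]%classic = `]0%R, h]%classic.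
    apply/seteqP; split => x /=; rewrite !in_itv/= => /andP[x1 x2].
      have x3 : (pi^-1 * x <= 2^-1)%R by lra.
      have x4 : (0 < pi^-1 * x)%R by lra.
      move: x3 x4; rewrite (mulrC _ x) pmulr_lgt0 ?invr_gt0// => x3 ->/=.
      by move: x3; rewrite ler_pdivrMr// mulrC.
    have x3 : (pi^-1 * x <= 2^-1)%R by rewrite (mulrC _ x) ler_pdivrMr// mulrC.
    have x4 : (0 < pi^-1 * x)%R by rewrite mulr_gt0// invr_gt0.
    by apply/andP; split; lra.
  apply: eq_integral => x; rewrite inE/= in_itv/= => /andP[x0 xh]; congr f.
  have -> : (pi * (pi^-1 * x + 2^-1))%R = (h + x)%R.
    by rewrite mulrDr mulVKf// addrC.
  by rewrite cosD cos_pihalf sin_pihalf mul0r mul1r sub0r normrN ger0_norm// s0// (ltW x0).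
rewrite (@itv_bndbnd_setU _ _ (BLeft 0%R) (BRight 2^-1%R) (BRight 1%R)) ?bnd_simp; last 2 first.
- by rewrite invr_ge0.
- by rewrite invf_le1 ?ler1n.
rewrite ge0_integral_setU//; last 2 first.
- exact: measurable_funTS.
- apply/disj_setPS => x [/=]; rewrite !in_itv/= => /andP[_ xb] /andP[bx _].
  by move: (lt_le_trans bx xb); rewrite ltxx.
rewrite E1 E2 -ge0_muleDl ?lee_fin ?invr_ge0 ?ltW// -EFinD; congr (_%:E * _).
by rewrite mulr_natl mulr2n.
Qed.

End Reduction.

(** * Evaluation of the triple integral *)

Section Assembly.
Context {R : realType}.
Notation mu := (@lebesgue_measure R).
Notation RT := (measurableTypeR R).
Notation h := (pi / 2 : R).
Implicit Types (t s u v x y a b : R) (n : nat).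
Local Notation sqln t1 t2 t3 := (ln (absP t1 t2 t3) ^+ 2).
Local Open Scope ereal_scope.

(** Exchanging [t1] and [s] changes only the sign of the constant phase, on which the mean over a
    full turn does not depend. *)
Lemma integral_sqln t1 s : (`|cos (pi * s)| < `|cos (pi * t1)|)%R ->
  \int[mu]_(t2 in `[0%R, 1%R]) (sqln t1 t2 (s + t2)%R)%:E =
    mean_sqln `|cos (pi * t1)| `|cos (pi * s)| /\
  \int[mu]_(t2 in `[0%R, 1%R]) (sqln s t2 (t1 + t2)%R)%:E =
    mean_sqln `|cos (pi * t1)| `|cos (pi * s)|.
Proof.
move=> st.
have ab : (`|2 * cos (pi * s)| < `|2 * cos (pi * t1)|)%R.
  by rewrite !normrM ltr_pM2l ?normr_gt0.
have E : mean_sqln `|cos (pi * t1)| `|cos (pi * s)| =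
  (ln `|2 * cos (pi * t1)| ^+ 2 +
    2^-1 * psum (ipow 2) (((2 * cos (pi * s)) / (2 * cos (pi * t1))) ^+ 2))%R%:E.
  rewrite mean_sqlnE ?normr_ge0// normrM (ger0_norm (ler0n R 2)) -normf_div real_normK ?num_real//.
  by rewrite -mulf_div divff ?pnatr_eq0// mul1r.
split; rewrite E.
  under eq_integral do rewrite absP_shift.
  exact: (has_int_sqr_ln_norm (pi * s - pi * t1) ab).2.
rewrite -(has_int_sqr_ln_norm (pi * t1 - pi * s) ab).2.
apply: eq_integral => t2 _; rewrite absP_shift; congr ((ln (Num.sqrt _) ^+ 2)%:E).
by ring.
Qed.

(** Sine increases on [0, pi/2], so the condition [sin s < sin t] cuts the domain down to s < t.
    There the logarithm is constant in [s], whence the weight [t], and each power of sin s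
    integrates to a [sin_ratio]. *)
Lemma integral_upper_sqln t : (0 <= t <= h)%R ->
  \int[mu]_(s in `[0%R, h]) upper_sqln (sin t) (sin s) =
  (t * ln (2 * sin t) ^+ 2)%:E + \sum_(n <oo) (2^-1 * ipow 2 n * sin_ratio n t)%:E.
Proof.
move=> /andP[]; rewrite le_eqVlt => /predU1P[<- _|t0 th].
  rewrite integral0_eq => [|s]; last first.
    rewrite /= in_itv/= sin0 => /andP[s0 sh]; rewrite /upper_sqln ifF//.
    apply/negbTE; rewrite -leNgt; apply: sin_ge0_pi; rewrite s0/= (le_trans sh)//.
    by have := @pi_gt0 R; lra.
  rewrite mul0r add0e eseries0// => n _ _.
  by rewrite /sin_ratio sin_int0 mul0r mulr0.
have p0 := @pi_gt0 R.
have st : (0 < sin t)%R by apply: sin_half_pos; rewrite t0.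
pose g s := mean_sqln (sin t) (sin s).
transitivity (\int[mu]_(s in `[0%R, h]) (g \_ `[0%R, t[) s).
  apply: eq_integral => s; rewrite inE/= in_itv/= => /andP[s0 sh].
  have -> : upper_sqln (sin t) (sin s) = if (s < t)%R then g s else 0.
    by rewrite /upper_sqln ltr_sin// in_itv/=; lra.
  rewrite /patch; case: ifPn => sth; first by rewrite ifT// inE/= in_itv/= s0.
  by rewrite ifF//; apply/negbTE; rewrite notin_setE/= in_itv/= s0/=; exact/negP.
rewrite -integral_mkcondr setIidr; last first.
  move=> s; rewrite /= !in_itv/= => /andP[-> sth]/=; exact: ltW (lt_le_trans sth th).
have mc n : measurable_fun [set: RT] (fun s => (2^-1 * ipow 2 n * (sin s * sin t `^ (-1)) ^+ n.*2)%:E).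
  apply/measurable_EFinP; apply: measurable_funM; first exact: measurable_cst.
  apply: measurable_funX; apply: measurable_funM; last exact: measurable_cst.
  exact: measurable_sin_comp.
have c0 n s : 0 <= (2^-1 * ipow 2 n * (sin s * sin t `^ (-1)) ^+ n.*2)%:E.
  by rewrite lee_fin mean_coef_ge0.
have ms : measurable_fun [set: RT] (fun s =>
    \sum_(n <oo) (2^-1 * ipow 2 n * (sin s * sin t `^ (-1)) ^+ n.*2)%:E).
  by apply: ge0_emeasurable_sum => // n s _ _.
rewrite /g /mean_sqln ge0_integralD; [|exact: measurable_itv|
  by move=> s _; rewrite lee_fin sqr_ge0|exact: measurable_cst|
  by move=> s _; apply: nneseries_ge0 => n _ _; exact: c0|exact: measurable_funTS].
congr (_ + _).
  rewrite (integral_cst _ _ (ln (2 * sin t) ^+ 2)%:E)//= lebesgue_measure_itv/= lte_fin t0.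
  by rewrite -EFinB -EFinM subr0 mulrC.
rewrite integral_nneseries; [|exact: measurable_itv|
  by move=> n; exact: measurable_funTS|by move=> n s _; exact: c0].
apply: eq_eseriesr => n _.
rewrite integral_itv_bndo_bndc; last exact: (measurable_funTS (mc n)).
have df x : is_derive x 1%R (fun x => sin x ^+ n.*2)%R ((n.*2)%:R * sin x ^+ (n.*2).-1 * cos x)%R.
  by apply: is_derive_exprn; exact: is_derive_sin.
have H : has_int 0 t (fun s => (2^-1 * ipow 2 n * (sin s * sin t `^ (-1)) ^+ n.*2)%R)
    (2^-1 * ipow 2 n * sin_ratio n t)%R.
  apply: (has_int_eq (has_intZ (2^-1 * ipow 2 n / sin t ^+ n.*2)
    (has_int_antiderivative t0 (is_derive_sin_int n) df))) => [s _|].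
    rewrite powR_inv1 ?ltW// exprMn exprVn.
    by move: (sin t ^- n.*2)%R => z; ring.
  rewrite sin_int0 subr0 /sin_ratio.
  by move: (sin t ^- n.*2)%R => z; ring.
exact: H.2.
Qed.

Lemma integral2_upper_sqln :
  \int[mu]_(t in `[0%R, h]) \int[mu]_(s in `[0%R, h]) upper_sqln (sin t) (sin s) =
  (2^-1 * (limn (series (alt (hpow 3))) - limn (series (hpow 3))) + pi ^+ 4 / 192 +
   2^-1 * (2 * (limn (series (hpow 3)) + limn (series (ipow 4))
       + limn (series (alt (hpow 3))) + limn (series (alt (ipow 4))))
     - 4^-1 * (limn (series (hpow 3)) + limn (series (ipow 4)))))%R%:E.
Proof.
have p0 := @pi_gt0 R.
transitivity (\int[mu]_(t in `[0%R, h]) ((t * ln (2 * sin t) ^+ 2)%:E +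
    \sum_(n <oo) (2^-1 * ipow 2 n * sin_ratio n t)%:E)).
  by apply: eq_integral => t; rewrite inE/= in_itv/= => th; exact: integral_upper_sqln.
have [L1 L2] := @has_int_log_sine R.
(* The index 0 has its own value, which the coefficient [ipow 2 0 = 0] removes in [hT]. *)
have hS n : has_int 0 h (sin_ratio n)
    (if n is n'.+1 then (\sum_(0 <= j < n) (2 * j%:R + 1)^-1) / (2 * n%:R) else h ^+ 2 / 2)%R.
  case: n => [|n]; last exact: has_int_sin_ratio.
  have dF t : is_derive t 1%R (fun t => t ^+ 2 / 2 : R)%R t.
    by derive_to; [do !derive_step|rewrite /=; field].
  have hp : (0 < h)%R by rewrite divr_gt0.
  apply: (has_int_eq (has_int_antiderivative hp dF is_derive_var)) => [t _|].
    by rewrite /sin_ratio /= expr0 divr1.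
  by rewrite expr0n mul0r subr0.
have hT n : has_int 0 h (fun t => 2^-1 * ipow 2 n * sin_ratio n t)%R
    (2^-1 * ((\sum_(0 <= j < n) (2 * j%:R + 1)^-1) / (2 * n%:R ^+ 3)))%R.
  apply: (has_int_eq (has_intZ (2^-1 * ipow 2 n) (hS n))) => //.
  case: n => [|n]; first by rewrite ipow0 big_geq// mulr0 !mul0r mulr0.
  have nz : n.+1%:R != 0%R :> R by rewrite pnatr_eq0.
  rewrite /ipow; move: (n.+1%:R)%R nz (\sum_(_ <= _ < _) _)%R => z z0 w.
  by field.
have T0 n t : (0 <= t <= h)%R -> (0 <= 2^-1 * ipow 2 n * sin_ratio n t)%R.
  move=> /andP[t0 th]; have tp : (0 <= t <= pi)%R by lra.
  apply: mulr_ge0; first by rewrite mulr_ge0 ?ipow_ge0.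
  by apply: divr_ge0; [exact: sin_int_ge0|rewrite exprn_ge0// sin_ge0_pi].
have mT n := measurable_int mu (hT n).1.
have T0' n t : `[0%R, h]%classic t -> 0 <= (2^-1 * ipow 2 n * sin_ratio n t)%:E.
  by rewrite /= in_itv/= => th; rewrite lee_fin; exact: T0.
rewrite ge0_integralD; [|exact: measurable_itv|
  by move=> t; rewrite /= in_itv/= => /andP[t0 _]; rewrite lee_fin mulr_ge0 ?sqr_ge0|
  exact: (measurable_int mu L1)|
  by move=> t th; apply: nneseries_ge0 => n _ _; exact: T0'|
  by apply: ge0_emeasurable_sum => [n t th _|n _]; [exact: T0'|exact: mT]].
rewrite [in RHS]EFinD L2; congr (_ + _).
rewrite integral_nneseries; [|exact: measurable_itv|exact: mT|exact: T0'].
under eq_eseriesr => n _ do rewrite (hT n).2.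
have cJ := @cvg_odd_harmonic_sum R.
have cJ2 : series (fun n => 2^-1 * ((\sum_(0 <= j < n) (2 * j%:R + 1)^-1) / (2 * n%:R ^+ 3)))%R N @[N --> \oo] -->
   (2^-1 * (2 * (limn (series (hpow 3)) + limn (series (ipow 4))
       + limn (series (alt (hpow 3))) + limn (series (alt (ipow 4))))
     - 4^-1 * (limn (series (hpow 3)) + limn (series (ipow 4)))) : R)%R.
  under eq_fun do rewrite /series /= -mulr_sumr.
  exact: cvgMr.
rewrite nneseries_EFin; first by rewrite (cvg_lim _ cJ2).
by apply/cvg_ex; eexists; exact: cJ2.
Qed.

Lemma measurable_abscos : measurable_fun [set: RT] (fun s => `|cos (pi * s)|%R : RT).
Proof.
apply: (measurableT_comp (@normr_measurable R setT)).
by apply: measurable_cos_comp; apply: measurable_funM => //; exact: measurable_cst.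
Qed.

Lemma integral2_sqln_fixed t1 :
  \int[mu]_(t2 in `[0%R, 1%R]) \int[mu]_(t3 in `[0%R, 1%R]) (sqln t1 t2 t3)%:E =
  \int[mu]_(s in `[0%R, 1%R]) (upper_sqln `|cos (pi * t1)| `|cos (pi * s)| +
    upper_sqln `|cos (pi * s)| `|cos (pi * t1)|)%R.
Proof.
have m1 : measurable_fun [set: RT * RT] (fun z => (sqln t1 z.1 (z.2 + z.1)%R)%:E).
  apply: measurable_sqln; first exact: measurable_fst.
  by apply: measurable_funD; [exact: measurable_snd|exact: measurable_fst].
have m2 : measurable_fun [set: RT * RT] (fun z => (sqln t1 z.2 (z.1 + z.2)%R)%:E).
  apply: measurable_sqln; first exact: measurable_snd.
  by apply: measurable_funD; [exact: measurable_fst|exact: measurable_snd].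
transitivity (\int[mu]_(t2 in `[0%R, 1%R]) \int[mu]_(s in `[0%R, 1%R]) (sqln t1 t2 (s + t2)%R)%:E).
  apply: eq_integral => t2; rewrite inE/= in_itv/= => t2i.
  apply: (@integral_periodic_shift _ (fun t3 => (sqln t1 t2 t3)%:E)) => //.
  - by apply: measurable_sqln; [exact: measurable_cst|exact: measurable_id].
  - by move=> x; rewrite lee_fin sqr_ge0.
  - move=> x; rewrite /absP (_ : 2 * pi * (x + 1) = 2 * pi * x + pi *+ 2)%R.
      by rewrite cosD2pi sinD2pi.
    by rewrite -mulr_natl; move: (pi : R) => p; ring.
transitivity (\int[mu]_(s in `[0%R, 1%R]) \int[mu]_(t2 in `[0%R, 1%R]) (sqln t1 t2 (s + t2)%R)%:E).
  apply: (@tonelli_itv _ _ _ (fun z => (sqln t1 z.1 (z.2 + z.1)%R)%:E)) => //.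
  by move=> z; rewrite lee_fin sqr_ge0.
apply: ge0_ae_eq_integral => //.
- apply: measurable_funTS.
  apply: (@measurable_fun_integral_l _ _ (fun z => (sqln t1 z.2 (z.1 + z.2)%R)%:E)) => //.
  by move=> z; rewrite lee_fin sqr_ge0.
- apply: measurable_funTS; apply: emeasurable_funD.
    by apply: measurable_upper_sqln; [exact: measurable_cst|exact: measurable_abscos].
  by apply: measurable_upper_sqln; [exact: measurable_abscos|exact: measurable_cst].
- by move=> s _; apply: integral_ge0 => t _; rewrite lee_fin sqr_ge0.
- by move=> s _; apply: adde_ge0; exact: upper_sqln_ge0.
pose c := cos (pi * t1).
(* The diagonal |cos(pi s)| = |cos(pi t1)|, where Parseval gives nothing, meets [0, 1] in at most
   two points, as s -> cos(pi s) is injective there. *)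
exists [set acos c / pi; acos (- c) / pi]%R; split.
- by apply: measurableU; exact: measurable_set1.
- by apply: countable_lebesgue_measure0; apply: finite_set_countable; exact: finite_set2.
move=> s /= /not_implyP[]; rewrite in_itv/= => /andP[s0 s1] neq.
have p0 := @pi_gt0 R.
have aK d : cos (pi * s) = d -> s = (acos d / pi)%R.
  move=> <-; rewrite cosK ?in_itv/=; first by rewrite mulrAC divff ?gt_eqF// mul1r.
  by rewrite mulr_ge0 ?(ltW p0)//= ler_piMr// ltW.
have [lt|gt|/eqP] := ltgtP `|cos (pi * s)|%R `|c|%R.
- case: neq; rewrite (integral_sqln lt).1 /upper_sqln lt ifF ?adde0//.
  by apply/negbTE; rewrite -leNgt ltW.
- case: neq; rewrite (integral_sqln gt).2 /upper_sqln gt ifF ?add0e//.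
  by apply/negbTE; rewrite -leNgt ltW.
- by rewrite eqr_norm2 => /orP[]/eqP /aK; [left|right].
Qed.

(** Each of the two foldings contributes 2/pi and the symmetry of the square a factor 2, so 8/pi^2 =
    2 (2/pi)^2. *)
Lemma mu_1xyzE : mu_1xyz R 2 = (8 / pi ^+ 2)%R%:E *
  \int[mu]_(t in `[0%R, h]) \int[mu]_(s in `[0%R, h]) upper_sqln (sin t) (sin s).
Proof.
have p0 := @pi_gt0 R.
pose G u v := upper_sqln u v + upper_sqln v u.
have G0 u v : 0 <= G u v by apply: adde_ge0; exact: upper_sqln_ge0.
pose g u := \int[mu]_(s in `[0%R, h]) G u (sin s).
have msin2 : measurable_fun [set: RT * RT] (fun z => sin z.2).
  by apply: measurable_sin_comp; exact: measurable_snd.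
have mg : measurable_fun [set: RT] g.
  apply: (@measurable_fun_integral_l _ _ (fun z => G z.1 (sin z.2))) => //.
  apply: emeasurable_funD; apply: measurable_upper_sqln => //; exact: measurable_fst.
have g0 u : 0 <= g u by exact: integral_ge0.
have c0 : (0 <= 2 / pi :> R)%R by rewrite divr_ge0// ltW.
transitivity (\int[mu]_(t in `[0%R, 1%R]) ((2 / pi)%R%:E * g `|cos (pi * t)|%R)).
  apply: eq_integral => t1 _; rewrite integral2_sqln_fixed.
  rewrite (@integral_fold R (G `|cos (pi * t1)|%R))//.
  apply: emeasurable_funD.
    by apply: measurable_upper_sqln; [exact: measurable_cst|exact: measurable_id].
  by apply: measurable_upper_sqln; [exact: measurable_id|exact: measurable_cst].
rewrite (@integral_fold R (fun u => (2 / pi)%R%:E * g u)); last 2 first.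
- by apply: emeasurable_funM => //; exact: measurable_cst.
- by move=> u; rewrite mule_ge0.
have mgs : measurable_fun [set: RT] (fun t => g (sin t)).
  apply: (measurableT_comp mg).
  by apply: measurable_sin_comp; exact: measurable_id.
rewrite ge0_integralZl_EFin//; last exact: measurable_funTS.
rewrite muleA -EFinM.
set A := \int[mu]_(t in _) \int[mu]_(s in _) _.
have mU : measurable_fun [set: RT * RT] (fun z => upper_sqln (sin z.1) (sin z.2)).
  apply: measurable_upper_sqln => //.
  by apply: measurable_sin_comp; exact: measurable_fst.
have T := integral2_symmetrize (measurable_itv `[0%R, h]) mU (fun z => upper_sqln_ge0 _ _).
rewrite [X in _ * X](_ : _ = A + A); last exact: T.
rewrite -mule2n -mule_natl muleA -EFinM; congr (_%:E * _).
by move: (gt_eqF p0); move: (pi : R) => p /negbT pN0; field.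
Qed.

End Assembly.

Theorem theorem4p7 (R : realType) :
  mu_1xyz R 2 =
  (12 / pi ^+ 2 * lambda 4 (2^-1 : R) - pi ^+ 2 / 5)%:E.
Proof.
rewrite mu_1xyzE integral2_upper_sqln -EFinM; congr EFin.
rewrite lambda4E// lam4_half.
have := @lim_alt_ipow R 2; have := @lim_euler_sum R; rewrite lim_ipow2 lim_ipow4.
move: (gt_eqF (@pi_gt0 R)); move: (pi : R) => p /negbT pN0.
move: (limn (series (hpow 3))) (limn (series (alt (ipow 4)))) (limn (series (alt (hpow 3)))) => S B A E1 E2.
(* From 2 (S + zeta(4)) = zeta(2)^2 = p^4 / 36. *)
have -> : S = p ^+ 4 / 72 - p ^+ 4 / 90.
  by apply: (addIr (p ^+ 4 / 90)); rewrite subrK; move: E1; rewrite (_ : (p ^+ 2 / 6) ^+ 2 = p ^+ 4 / 36); [lra|field].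
have -> : B = - (7 / 8 * (p ^+ 4 / 90)).
  by move: E2; rewrite (_ : 2 * 2^-1 ^+ 4 = 8^-1); [lra|field].
(* Now I + J / 2 = 3 A / 2 + p^4 / 160 and lambda_4 (1/2) = A + p^4 / 48, whence the coefficient 12
   and the remainder p^2 / 20 - p^2 / 4 = - p^2 / 5. *)
by field.
Qed.
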